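(* Let $d\ge 1$, $\beta>0$, and let $\{\xi(\mathbf{x}),\ \mathbf{x}\in\mathbb{R}^d\}$ be a (homogeneous and isotropic) Gamma-correlated random field of index $\beta$ with correlation function $\gamma$. Assume that $$\gamma(\|\mathbf{z}\|)=\frac{\mathcal{L}(\|\mathbf{z}\|)}{\|\mathbf{z}\|^{\delta}},\qquad \mathbf z\in\mathbb{R}^d,\quad 0<\delta<d,$$ where $\mathcal{L}$ is slowly varying at infinity. Let $\mathcal{D}\subset\mathbb{R}^d$ be a regular compact domain, let $F\in L^2((0,\infty),p_\beta(u)\,du)$ have generalized Laguerre rank equal to $k\ge 1$, and assume $0<\delta<d/k$. Put $$a_{d,k}(\mathcal{D})=\left[\int_{\mathcal D}\int_{\mathcal D}\frac{d\mathbf{x}\,d\mathbf{y}}{\|\mathbf{x}-\mathbf{y}\|^{k\delta}}\right]^{1/2},$$ $$S_T^L=\frac{1}{a_{d,k}(\mathcal{D})\,\mathcal{L}^{k/2}(T)\,T^{d-(k\delta)/2}}\left[\int_{\mathcal{D}(T)}F(\xi(\mathbf{x}))\,d\mathbf{x}-C_0^L\,T^d|\mathcal{D}|\right].$$ If the limiting distribution of $S_T^L$ as $T\to\infty$ exists, then it coincides with the limit distribution, as $T\to\infty$, of the random variable $$\frac{C_k^L}{a_{d,k}(\mathcal{D})\,\mathcal{L}^{k/2}(T)\,T^{d-(k\delta)/2}}\int_{\mathcal{D}(T)}e_k^{(\beta)}(\xi(\mathbf{x}))\,d\mathbf{x}.$$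
   Context: Gamma density: $p_\beta(u)=\frac{1}{\Gamma(\beta)}u^{\beta-1}e^{-u}$, $u>0$. Normalized Laguerre polynomials: $e_k^{(\beta)}(u)=L_k^{(\beta-1)}(u)\left[\frac{k!\,\Gamma(\beta)}{\Gamma(\beta+k)}\right]^{1/2}$, where $L_k^{(\beta)}(u)=\frac{1}{k!}u^{-\beta}e^{u}\frac{d^k}{du^k}\{e^{-u}u^{\beta+k}\}$. They form a complete orthonormal system of $L^2((0,\infty),p_\beta(u)du)$, with $e_0^{(\beta)}\equiv 1$ and $e_1^{(\beta)}(u)=\beta^{-1/2}(\beta-u)$. Laguerre coefficients and rank: for $F\in L^2((0,\infty),p_\beta(u)du)$, $C_q^L=\int_0^\infty F(u)e_q^{(\beta)}(u)p_\beta(u)\,du$, $q\ge 0$ (so $C_0^L=\mathrm{E}[F(\xi(\mathbf{x}))]$). The (generalized) Laguerre rank of $F$ is the smallest $k\ge 1$ with $C_k^L\neq 0$. Gamma-correlated random field: a measurable, mean-square continuous, homogeneous and isotropic random field $\{\xi(\mathbf{x}),\mathbf{x}\in\mathbb{R}^d\}$ whose one-dimensional marginals have density $p_\beta$ and whose bivariate densities (of $(\xi(\mathbf{x}),\xi(\mathbf{y}))$, $\mathbf x\ne\mathbf y$) are $$p_\beta(u,w,\|\mathbf{x}-\mathbf{y}\|)=p_\beta(u)p_\beta(w)\Big[1+\sum_{k=1}^\infty\gamma^k(\|\mathbf{x}-\mathbf{y}\|)\,e_k^{(\beta)}(u)\,e_k^{(\beta)}(w)\Big],$$ where $\gamma(\|\mathbf{x}-\mathbf{y}\|)=\mathrm{Corr}(\xi(\mathbf{x}),\xi(\mathbf{y}))$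 is a continuous non-negative definite kernel with $\sum_{k\ge1}\gamma^{2k}(\|\mathbf{z}\|)<\infty$ for $\|\mathbf{z}\|>0$. Domain: $\mathcal{D}$ is a compact set with $\mathbf{0}\in\mathcal{D}$, whose interior has positive Lebesgue measure and whose boundary has null Lebesgue measure, and which is Dirichlet regular: every boundary point $\mathbf{x}_0$ is regular, i.e. the Green kernel $G^{\mathcal D}$ of the domain satisfies $\lim_{\mathbf{x}\to\mathbf{x}_0}G^{\mathcal{D}}(\mathbf{x},\mathbf{y})=0$ for all $\mathbf{y}\in\mathcal{D}$. $\mathcal{D}(T)=\{T\mathbf{x}:\mathbf{x}\in\mathcal{D}\}$ is the homothetic image with center $\mathbf{0}$ and factor $T>0$; $|\mathcal{D}|$ is the Lebesgue measure. *)

(* Defs.v *)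
From HB Require Import structures.
From mathcomp Require Import all_boot all_order all_algebra.
From mathcomp Require Import all_classical all_reals all_analysis.

Set Implicit Arguments.
Unset Strict Implicit.
Unset Printing Implicit Defensive.

Import Order.TTheory GRing.Theory Num.Theory.
Import numFieldNormedType.Exports.

Local Open Scope classical_set_scope.
Local Open Scope ring_scope.

(* The library puts the product sigma-algebra on tuples; the same construction
   on row vectors gives, for T = R, the Borel sets of 'rV[R]_n. *)
Section measurable_rV.
Context {d : measure_display} {T : sigmaRingType d}.
Variable n : nat.

Let coors : 'I_n -> 'rV[T]_n -> T := fun i x => x ord0 i.

Let rV_set0 : g_sigma_preimage coors set0.
Proof. exact: sigma_algebra0. Qed.

Let rV_setC A : g_sigma_preimage coors A -> g_sigma_preimage coors (~` A).
Proof. exact: sigma_algebraC. Qed.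

Let rV_bigcup (F : (set _)^nat) : (forall i, g_sigma_preimage coors (F i)) ->
  g_sigma_preimage coors (\bigcup_i (F i)).
Proof. exact: sigma_algebra_bigcup. Qed.

HB.instance Definition _ := @isMeasurable.Build (measure_tuple_display d)
  'rV[T]_n (g_sigma_preimage coors) rV_set0 rV_setC rV_bigcup.

End measurable_rV.

Section lebesgue_rV.
Context {R : realType}.

Lemma measurable_rV_coord n (j : 'I_n) :
  measurable_fun setT (fun v : 'rV[R]_n => v ord0 j).
Proof.
move=> _ Y mY; rewrite setTI; apply: sub_sigma_algebra.
rewrite -bigcup_seq/=; exists j => /=; first by rewrite mem_index_enum.
by exists Y => //; rewrite setTI.
Qed.

Lemma measurable_fun_rV d (T : measurableType d) n (f : T -> 'rV[R]_n) :
  (forall i, measurable_fun setT (fun t => f t ord0 i)) ->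
  measurable_fun setT f.
Proof.
move=> mf _ Y mY; rewrite setTI.
have sub : g_sigma_preimage (fun (i : 'I_n) (x : 'rV[R]_n) => x ord0 i)
    `<=` [set B | measurable (f @^-1` B)].
  apply: smallest_sub => [|B].
    split => [|A mA|F mF] /=.
    - by rewrite preimage_set0.
    - by rewrite setTD preimage_setC; exact: measurableC.
    - by rewrite preimage_bigcup; apply: bigcup_measurable => k _; exact: mF.
  rewrite -bigcup_seq/= => -[i _ [A mA <-]].
  by have := mf i measurableT A mA; rewrite !setTI.
exact: (sub Y mY).
Qed.

Definition rV_cons n (z : measurableTypeR R * 'rV[R]_n) : 'rV[R]_n.+1 :=
  \row_i oapp (fun j => z.2 ord0 j) z.1 (unlift ord0 i).

Definition rV_uncons n (v : 'rV[R]_n.+1) : measurableTypeR R * 'rV[R]_n :=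
  (v ord0 ord0, \row_j v ord0 (lift ord0 j)).

Lemma rV_consK n : cancel (@rV_cons n) (@rV_uncons n).
Proof.
case=> x v; rewrite /rV_uncons !mxE unlift_none; congr pair.
by apply/rowP => j; rewrite !mxE liftK.
Qed.

Lemma measurable_rV_cons n : measurable_fun setT (@rV_cons n).
Proof.
apply: measurable_fun_rV => i; case: (unliftP ord0 i) => [j ->|->].
- rewrite [X in measurable_fun _ X](_ : _ =
    (fun v : 'rV[R]_n => v ord0 j) \o snd); last first.
    by apply/funext => z /=; rewrite mxE liftK.
  by apply: measurableT_comp => //; exact: measurable_rV_coord.
- rewrite [X in measurable_fun _ X](_ : _ = fst); first exact: measurable_fst.
  by apply/funext => z /=; rewrite mxE unlift_none.
Qed.

Lemma measurable_rV_uncons n : measurable_fun setT (@rV_uncons n).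
Proof.
apply: measurable_fun_pair; first exact: measurable_rV_coord.
apply: measurable_fun_rV => i.
under eq_fun do rewrite mxE; exact: measurable_rV_coord.
Qed.

Section lebesgue_rV_step.
Variables (n : nat) (mu : {sigma_finite_measure set 'rV[R]_n -> \bar R}).

Definition lebesgue_rV_step : set 'rV[R]_n.+1 -> \bar R :=
  pushforward (lebesgue_measure \x mu)%E (@rV_cons n).

Let step0 : lebesgue_rV_step set0 = 0%E.
Proof. by rewrite /lebesgue_rV_step /pushforward preimage_set0 measure0. Qed.

Let step_ge0 A : (0 <= lebesgue_rV_step A)%E.
Proof. by rewrite /lebesgue_rV_step /pushforward; exact: measure_ge0. Qed.

Let measurable_preimage A : measurable A -> measurable (@rV_cons n @^-1` A).
Proof.
by move=> mA; rewrite -[X in measurable X]setTI; exact: measurable_rV_cons.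
Qed.

Let step_sigma_additive : semi_sigma_additive lebesgue_rV_step.
Proof.
move=> F mF tF mUF; rewrite /lebesgue_rV_step /pushforward preimage_bigcup.
apply: measure_semi_sigma_additive.
- by move=> i; exact: measurable_preimage.
- by apply/trivIsetP => /= i j _ _ ij; rewrite -preimage_setI;
    move/trivIsetP : tF => /(_ _ _ _ _ ij) ->//; rewrite preimage_set0.
- by rewrite -preimage_bigcup; exact: measurable_preimage.
Qed.

HB.instance Definition _ := isMeasure.Build _ _ _ lebesgue_rV_step
  step0 step_ge0 step_sigma_additive.

Let step_sigma_finite : sigma_finite setT lebesgue_rV_step.
Proof.
have /sigma_finiteP[F [TF ndF Foo]] :=
  sigma_finiteT (lebesgue_measure :
    {sigma_finite_measure set (measurableTypeR R) -> \bar R}).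
have /sigma_finiteP[G [TG ndG Goo]] := sigma_finiteT mu.
exists (fun i => @rV_uncons n @^-1` (F i `*` G i)) => [|i].
  rewrite -preimage_bigcup -(preimage_setT (@rV_uncons n)); congr (_ @^-1` _).
  apply/seteqP; split=> // -[x y] _.
  have [k _ Fkx] : (\bigcup_k F k) x by rewrite -TF.
  have [l _ Gly] : (\bigcup_k G k) y by rewrite -TG.
  exists (maxn k l) => //; split=> /=.
    by move: x Fkx; exact/subsetPset/ndF/leq_maxl.
  by move: y Gly; exact/subsetPset/ndG/leq_maxr.
have [mF Fi] := Foo i; have [mG Gi] := Goo i; split.
  by rewrite -[X in measurable X]setTI; apply: measurable_rV_uncons => //;
    exact: measurableX.
rewrite /lebesgue_rV_step /pushforward -comp_preimage.
rewrite (_ : _ \o _ = id) ?preimage_id; last exact/funext/rV_consK.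
by rewrite product_measure1E// lte_mul_pinfty// ge0_fin_numE.
Qed.

HB.instance Definition _ := Measure_isSigmaFinite.Build _ _ _ lebesgue_rV_step
  step_sigma_finite.

End lebesgue_rV_step.

Fixpoint lebesgue_rV n : {sigma_finite_measure set 'rV[R]_n -> \bar R} :=
  match n return {sigma_finite_measure set 'rV[R]_n -> \bar R} with
  | 0%N => dirac (0 : 'rV[R]_0)
  | m.+1 => lebesgue_rV_step (lebesgue_rV m)
  end.

Lemma lebesgue_rV_box n (A : 'I_n -> set R) : (forall i, measurable (A i)) ->
  lebesgue_rV n [set v | forall i, A i (v ord0 i)] =
  (\prod_(i < n) @lebesgue_measure R (A i))%E.
Proof.
elim: n A => [|n IH] A mA.
  by rewrite big_ord0 /= /dirac indicE mem_set// => -[].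
pose B : set 'rV[R]_n :=
  [set v : 'rV[R]_n | forall j : 'I_n, A (lift ord0 j) (v ord0 j)].
have mB : measurable B.
  have -> : B = \bigcap_(j in [set: 'I_n])
      ((fun v : 'rV[R]_n => v ord0 j) @^-1` A (lift ord0 j)).
    by apply/seteqP; split=> [v vA j _|v vA j]; exact: vA.
  apply: fin_bigcap_measurable => // j _; rewrite -[X in measurable X]setTI.
  exact: measurable_rV_coord.
rewrite big_ord_recl -(IH (fun j => A (lift ord0 j)))// -/B.
rewrite /= /lebesgue_rV_step /pushforward -product_measure1E//; last exact: mA.
congr ((_ \x _)%E _).
apply/seteqP; split=> -[x v] /=.
  move=> xvA; split=> [|j]; first by have := xvA ord0; rewrite mxE unlift_none.
  by have := xvA (lift ord0 j); rewrite mxE liftK.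
by move=> [xA vA] i; rewrite mxE; case: unliftP => [j|] -> /=;
  [exact: vA|exact: xA].
Qed.

End lebesgue_rV.

(* The norm of the library on row vectors is the sup norm. *)
Definition enorm {R : realType} d (x : 'rV[R]_d) : R :=
  Num.sqrt (\sum_i x ord0 i ^+ 2).

Section laguerre.
Context {R : realType}.
Implicit Types (a b u : R) (F : R -> R).

Local Notation leb := (@lebesgue_measure R).

Definition gamma_fun b : R :=
  \int[leb]_(t in `]0, +oo[) (t `^ (b - 1) * expR (- t)).

(* Only meaningful for u > 0; it is only integrated over ]0, +oo[ below. *)
Definition gamma_pdf b u : R := u `^ (b - 1) * expR (- u) / gamma_fun b.

(* Rodrigues' formula; it is the Laguerre polynomial only for u > 0. *)
Definition laguerre a k u : R :=
  k`!%:R^-1 * u `^ (- a) * expR u *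
  derive1n k (fun v : R => expR (- v) * v `^ (a + k%:R)) u.

Definition laguerre_e b k u : R :=
  laguerre (b - 1) k u * Num.sqrt (k`!%:R * gamma_fun b / gamma_fun (b + k%:R)).

Definition L2_gamma b F : Prop :=
  measurable_fun (`]0, +oo[ : set R) F /\
  (\int[leb]_(u in `]0%R, +oo[) (F u ^+ 2 * gamma_pdf b u)%:E < +oo)%E.

Definition laguerre_coef b F q : R :=
  \int[leb]_(u in `]0, +oo[) (F u * laguerre_e b q u * gamma_pdf b u).

Definition laguerre_rank b F k : Prop :=
  [/\ (1 <= k)%N, laguerre_coef b F k != 0 &
      forall j, (1 <= j < k)%N -> laguerre_coef b F j = 0].

(* [p] is the bilinear Laguerre expansion with correlation [r]; the series is
   required to converge at every point of the open quadrant. *)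
Definition gamma_bivariate_pdf b (r : R) (p : R -> R -> R) : Prop :=
  forall u w, 0 < u -> 0 < w ->
    gamma_pdf b u * gamma_pdf b w *
      (1 + \sum_(1 <= k < n.+1) r ^+ k * laguerre_e b k u * laguerre_e b k w)
    @[n --> \oo] --> p u w.

End laguerre.

Section random_field.
Context {R : realType} {d : nat} {dO : measure_display}
  {Omega : measurableType dO} (P : probability Omega R).
Implicit Types (xi : 'rV[R]_d -> Omega -> R) (x y h : 'rV[R]_d).

Definition correlation (X Y : Omega -> R) : R :=
  fine (covariance P X Y) /
    (Num.sqrt (fine (variance P X)) * Num.sqrt (fine (variance P Y))).

Definition mean_square_continuous xi : Prop :=
  forall x, ('E_P[(fun w => (xi y w - xi x w) ^+ 2)%R] @[y --> x] --> 0)%E.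

(* Homogeneity and isotropy are the usual second-order (wide sense) notions. *)
Definition homogeneous_field xi : Prop :=
  forall h, (forall x, 'E_P[xi (x + h)%R] = 'E_P[xi x])%E /\
    (forall x y, covariance P (xi (x + h)) (xi (y + h)) =
                 covariance P (xi x) (xi y)).

Definition isotropic_field xi : Prop :=
  forall g : 'M[R]_d, g *m g^T = 1%:M -> \det g = 1 ->
    (forall x, 'E_P[xi (x *m g)] = 'E_P[xi x])%E /\
    (forall x y, covariance P (xi (x *m g)) (xi (y *m g)) =
                 covariance P (xi x) (xi y)).

Definition nonneg_definite_radial (gamma : R -> R) : Prop :=
  forall n (c : 'I_n -> R) (x : 'I_n -> 'rV[R]_d),
    0 <= \sum_i \sum_j c i * c j * gamma (enorm (x i - x j)).

Record gamma_correlated_field (b : R) (gamma : R -> R) xi : Prop := {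
  gcf_measurable :
    measurable_fun setT (fun z : 'rV[R]_d * Omega => xi z.1 z.2) ;
  gcf_continuous : mean_square_continuous xi ;
  gcf_homogeneous : homogeneous_field xi ;
  gcf_isotropic : isotropic_field xi ;
  gcf_marginal : forall x (A : set (measurableTypeR R)), measurable A ->
    P (xi x @^-1` A) =
    (\int[lebesgue_measure]_(u in A `&` `]0%R, +oo[) (gamma_pdf b u)%:E)%E ;
  gcf_correlation : forall x y,
    correlation (xi x) (xi y) = gamma (enorm (x - y)) ;
  gcf_gamma_continuous : continuous (fun z : 'rV[R]_d => gamma (enorm z)) ;
  gcf_gamma_nonneg_definite : nonneg_definite_radial gamma ;
  gcf_gamma_summable : forall z : 'rV[R]_d, 0 < enorm z ->
    cvgn [series gamma (enorm z) ^+ (2 * k.+1)]_k ;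
  gcf_bivariate : forall x y, x != y ->
    exists2 p, gamma_bivariate_pdf b (gamma (enorm (x - y))) p &
    forall A : set (measurableTypeR R * measurableTypeR R), measurable A ->
      P ((fun w => (xi x w, xi y w)) @^-1` A) =
      (\int[lebesgue_measure \x lebesgue_measure]_(z in
          A `&` (`]0%R, +oo[ `*` `]0%R, +oo[)) (p z.1 z.2)%:E)%E }.

Definition cvg_in_law (X : R -> Omega -> R)
    (mu : probability (measurableTypeR R) R) : Prop :=
  (\forall t \near +oo, measurable_fun setT (X t)) /\
  forall f : R -> R, continuous f -> bounded_fun f ->
    ('E_P[f \o X t] @[t --> +oo%R] --> \int[mu]_x (f x)%:E)%E.

(* Functions of the field are only given on ]0, +oo[, where the field takes its
   values almost surely; they are extended by 0. *)
Definition field_integral xi (G : R -> R) (A : set 'rV[R]_d) (w : Omega) : R :=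
  \int[lebesgue_rV d]_(x in A) ((G \_ `]0, +oo[) (xi x w)).

End random_field.

Section dirichlet_regular.
Context {R : realType} {d : nat}.
Implicit Types (U D : set 'rV[R]_d) (h : 'rV[R]_d -> R) (x y : 'rV[R]_d).

Definition partial (i : 'I_d) h : 'rV[R]_d -> R :=
  fun x => 'D_(delta_mx ord0 i) h x.

(* [U] is meant to be open. *)
Definition harmonic_on U h : Prop :=
  forall x, U x ->
    [/\ forall i, derivable h x (delta_mx ord0 i),
        forall i j, derivable (partial i h) x (delta_mx ord0 j),
        forall i j, {for x, continuous (partial j (partial i h))} &
        \sum_i partial i (partial i h) x = 0].

Definition unit_ball_volume : R :=
  fine (lebesgue_rV d [set x | enorm x <= 1]).

(* Fundamental solution of minus the Laplacian; for d = 1 the second branch is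
   - `|z| / 2. The value at z = 0 is irrelevant. *)
Definition fundamental_solution (z : 'rV[R]_d) : R :=
  if d == 2%N then - ln (enorm z) / (2 * unit_ball_volume)
  else enorm z `^ (2 - d%:R) / (d%:R * (d%:R - 2) * unit_ball_volume).

Definition harmonic_minorant U y h : Prop :=
  harmonic_on U h /\
  forall x, U x -> x != y -> h x <= fundamental_solution (x - y).

(* Fundamental solution with pole y minus its greatest harmonic minorant on U
   (which exists, and is the pointwise supremum, when U is open and bounded). *)
Definition green_kernel U x y : R :=
  fundamental_solution (x - y) -
  sup [set h x | h in [set h | harmonic_minorant U y h]].

Definition dirichlet_regular D : Prop :=
  forall x0, (closure D `\` D°) x0 -> forall y, D° y ->
    green_kernel D° x y @[x --> within D° (nbhs x0)] --> (0 : R).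

Definition regular_compact_domain D : Prop :=
  [/\ compact D, D 0, (0 < lebesgue_rV d D°)%E,
      lebesgue_rV d (closure D `\` D°) = 0%E & dirichlet_regular D].

Definition homothetic (T : R) D : set 'rV[R]_d := [set T *: x | x in D].

Definition a_const (k : nat) (delta : R) D : R :=
  Num.sqrt (fine (\int[lebesgue_rV d]_(x in D) \int[lebesgue_rV d]_(y in D)
    (enorm (x - y) `^ (- (k%:R * delta)))%:E)%E).

End dirichlet_regular.

Definition slowly_varying {R : realType} (L : R -> R) : Prop :=
  [/\ measurable_fun (`]0, +oo[ : set R) L, \forall t \near +oo, 0 < L t &
      forall c, 0 < c -> L (c * t) / L t @[t --> +oo] --> (1 : R)].

Section functionals.
Context {R : realType} {d : nat} {dO : measure_display}
  {Omega : measurableType dO}.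
Variables (b delta : R) (L : R -> R) (D : set 'rV[R]_d)
  (xi : 'rV[R]_d -> Omega -> R) (F : R -> R) (k : nat).

Definition normalization (T : R) : R :=
  a_const k delta D * L T `^ (k%:R / 2) * T `^ (d%:R - k%:R * delta / 2).

Definition S_L (T : R) (w : Omega) : R :=
  (normalization T)^-1 *
  (field_integral xi F (homothetic T D) w
   - laguerre_coef b F 0 * T ^+ d * fine (lebesgue_rV d D)).

Definition S_L_leading (T : R) (w : Omega) : R :=
  laguerre_coef b F k / normalization T *
  field_integral xi (laguerre_e b k) (homothetic T D) w.

End functionals.

(* Main.v *)
(** The Laguerre functions [e_j] diagonalise the bivariate laws of the field: if
    [G] is square integrable for the Gamma law and orthogonal to [e_0, ..., e_k],
    then [|E G(xi x) G(xi y)| <= |gamma(x - y)|^(k+1) E G(xi 0)^2] for [x <> y].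
    Apply this to [G = F - C_0 - C_k e_k], for which [S_L - S_L_leading] is
    almost surely the normalized integral of [G(xi x)] over [D(T)]. Its second
    moment is at most a constant times the mean of [|gamma(x - y)|^(k+1)] over
    [D(T) x D(T)], divided by [gamma(T)^k]. It tends to 0: cutting
    balls into dyadic shells, regular variation of [gamma] together with
    [k delta < d] makes the integral of [|gamma|^(k+1)] over a ball of radius
    proportional to [T] negligible with respect to [gamma(T)^k T^d], because of
    the extra factor [gamma], which tends to 0. Slutsky's lemma concludes. *)
From HB Require Import structures.
Require Import Defs.
From mathcomp Require Import all_boot all_order all_algebra finmap.
From mathcomp Require Import all_classical all_reals all_analysis.
From mathcomp Require Import measurable_realfun ring lra.

Set Implicit Arguments.
Unset Strict Implicit.
Unset Printing Implicit Defensive.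

Import Order.TTheory GRing.Theory Num.Theory.
Import numFieldNormedType.Exports.

Local Open Scope classical_set_scope.
Local Open Scope ring_scope.

(** * The Gamma function *)

(** The Laguerre series is summed on the kernel rather than on [G]: the density of the law of
    [(xi x, xi y)] with respect to the product of its marginals is the pointwise sum of
    [r^i e_i(u) e_i(w)], and Fatou's lemma turns this into an L2 sum as soon as [|r| < 1]. That
    strict bound comes from the summability of the even powers of [gamma] and is available off the
    diagonal only, so the diagonal gets a kernel equal to 1. All information on the Gamma function
    is drawn from the total mass 1 of the marginal density; Rodrigues' formula then makes
    orthonormality an algebraic fact about moments. In the integral of [|gamma|^(k+1)], the exponent
    [(k+1) delta] may lie below, at or above [d]. Comparing ball integrals with [gamma(t)^k t^d]
    avoids the distinction: this function varies with index [d - k delta > 0], so the ratio obeys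
    [u(2t) <= q u(t) + o(1)] with [q < 1]. The recursion needs [gamma] bounded on [t, 2t] by a
    multiple of [gamma(t)], a uniform bound that Baire's theorem extracts from the continuity of
    [gamma]. *)

Section gamma_function.
Context {R : realType}.
Implicit Types (s t u : R).

Local Notation leb := (@lebesgue_measure R).

Definition gamma_integrand s t : R := t `^ (s - 1) * expR (- t).

Lemma gamma_integrand_ge0 s t : 0 <= gamma_integrand s t.
Proof. by rewrite mulr_ge0 ?powR_ge0 ?expR_ge0. Qed.

Lemma measurable_gamma_integrand s : measurable_fun setT (gamma_integrand s).
Proof.
apply: measurable_funM; first exact: measurable_powR.
by apply: measurableT_comp => //; exact: measurable_funN.
Qed.

Lemma continuous_powR_gt0 s t : 0 < t -> {for t, continuous (fun x => x `^ s)}.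
Proof.
move=> t0; apply: differentiable_continuous; apply/derivable1_diffP.
by apply: derivable_powR; rewrite in_itv/= t0.
Qed.

Definition gamma_integral s : \bar R :=
  (\int[leb]_(t in `]0%R, +oo[) (gamma_integrand s t)%:E)%E.

(** Compact intervals on which integration by parts applies. The shift by 2 keeps their endpoints
    strictly ordered even for [n = 0]. *)
Definition exhaust n : set R := `[n.+2%:R^-1, n.+2%:R]%classic.

Lemma cvg_integral_exhaust (f : R -> R) : (forall t, 0 <= f t) ->
  measurable_fun setT f ->
  (\int[leb]_(t in exhaust n) (f t)%:E @[n --> \oo] -->
   \int[leb]_(t in `]0%R, +oo[) (f t)%:E)%E.
Proof.
move=> f0 mf.
have -> : (`]0%R, +oo[%classic : set R) =
    \bigcup_n exhaust n.
  apply/seteqP; split=> [t /=|t [n _]] /=; rewrite !in_itv /= ?andbT.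
    move=> t0; exists (Num.truncn (t + t^-1)) => //; rewrite /exhaust/= in_itv/=.
    have := truncnS_gt (t + t^-1).
    set m := Num.truncn _ => tm.
    have tm2 : t + t^-1 < m.+2%:R by apply: lt_trans tm _; rewrite ltr_nat.
    apply/andP; split; last by rewrite ltW// (le_lt_trans _ tm2)// lerDl invr_ge0 ltW.
    rewrite -[leRHS]invrK lef_pV2 ?posrE ?invr_gt0//.
    by rewrite ltW// (le_lt_trans _ tm2)// lerDr ltW.
  by rewrite /exhaust/= in_itv/= => /andP[+ _]; apply: lt_le_trans; rewrite invr_gt0.
apply: ge0_nondecreasing_set_cvg_integral => //.
- apply/nondecreasing_seqP => n; rewrite subsetEset => t; rewrite /exhaust/= !in_itv /=.
  move=> /andP[nt tn]; apply/andP; split.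
    by rewrite (le_trans _ nt)// lef_pV2 ?posrE// ler_nat.
  by rewrite (le_trans tn)// ler_nat.
- by move=> n; exact: measurable_itv.
- by move=> n; apply/measurable_EFinP; apply: measurable_funS mf.
- by move=> n t _; rewrite lee_fin.
Qed.

(** For an integer m above s, the Taylor term x^(m+1) / (m+1)! is below e^x, so x^s e^(-x) is at
    most (m+1)! / x. *)
Lemma cvg_powR_expRN s : n.+2%:R `^ s * expR (- n.+2%:R) @[n --> \oo] --> (0 : R).
Proof.
pose m := (Num.truncn `|s|).+1.
have sm : s <= m%:R by rewrite ltW// (le_lt_trans (ler_norm s))// truncnS_gt.
apply: (@squeeze_cvgr _ _ _ _ (fun=> 0) (fun n => m.+1`!%:R / n.+2%:R)).
- near=> n; apply/andP; split; first by rewrite mulr_ge0 ?powR_ge0 ?expR_ge0.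
  rewrite expRN ler_pdivrMr ?expR_gt0//.
  have := expR_ge1Dxn m (ler0n R n.+2); set e := expR _ => He.
  have He2 : n.+2%:R ^+ m.+1 / m.+1`!%:R <= e by apply: le_trans He; rewrite lerDr.
  apply: (@le_trans _ _ (n.+2%:R ^+ m)).
    by rewrite -powR_mulrn// ler_powR// ler1n.
  rewrite -mulrA [X in _ <= _ * X]mulrC -ler_pdivrMl ?ltr0n ?fact_gt0//.
  by rewrite ler_pdivlMr// -mulrA -exprSr mulrC.
- exact: cvg_cst.
- rewrite -[X in _ --> X](mulr0 (m.+1`!%:R)).
  apply: cvgM; first exact: cvg_cst.
  apply/gtr0_cvgV0; first by near=> n.
  by apply/cvgrnyP; apply/cvgnyPge => A; near=> n; near: n; exists A => // n /= An; rewrite (leq_trans An)// leqW.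
Unshelve. all: by end_near. Qed.

Lemma cvg_powR_inv s : 0 < s -> n.+2%:R^-1 `^ s @[n --> \oo] --> (0 : R).
Proof.
move=> s0; move/cvg_at_rightP : (powR_cvg0 s0); apply; split=> [n|].
  by rewrite invr_gt0.
apply/gtr0_cvgV0; first by near=> n.
by apply/cvgrnyP; apply/cvgnyPge => A; near=> n; near: n; exists A => // n /= An; rewrite (leq_trans An)// leqW.
Unshelve. all: by end_near. Qed.

(** Integration by parts on the exhausting intervals, with boundary terms tending to 0. Working in
    the extended reals lets finiteness at [s + 1] be deduced from finiteness at [s]. *)
Lemma gamma_integralS s : 0 < s ->
  (gamma_integral (s + 1) = s%:E * gamma_integral s)%E.
Proof.
move=> s0.
have cvg1 := cvg_integral_exhaust (gamma_integrand_ge0 (s + 1)) (measurable_gamma_integrand (s + 1)).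
have cvg2 := cvg_integral_exhaust (gamma_integrand_ge0 s) (measurable_gamma_integrand s).
have parts n : (\int[leb]_(t in exhaust n) (gamma_integrand (s + 1) t)%:E =
    (n.+2%:R^-1 `^ s * expR (- n.+2%:R^-1) - n.+2%:R `^ s * expR (- n.+2%:R))%:E
    + s%:E * \int[leb]_(t in exhaust n) (gamma_integrand s t)%:E)%E.
  have lt12 : n.+2%:R^-1 < n.+2%:R :> R.
    by rewrite (@lt_trans _ _ 1) ?invf_lt1 ?ltr1n.
  have pos t : t \in `[n.+2%:R^-1, n.+2%:R] -> 0 < t :> R.
    by rewrite in_itv/= => /andP[+ _]; apply: lt_le_trans; rewrite invr_gt0.
  have dF t : 0 < t -> is_derive t 1 (fun x : R => x `^ s) (s * t `^ (s - 1)).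
    move=> t0; apply: DeriveDef; first by apply: derivable_powR; rewrite in_itv/= t0.
    by rewrite -derive1E powR_derive1// in_itv/= t0.
  have dG (t : R) : is_derive t 1 (fun x : R => - expR (- x)) (expR (- t)).
    by apply: is_derive_eq; rewrite /GRing.scale/=; ring.
  pose f t : R := s * t `^ (s - 1).
  have := @integration_by_parts R (fun x => x `^ s) (fun x => - expR (- x)) f (fun t => expR (- t)) _ _ lt12.
  have cf : {within `[n.+2%:R^-1, n.+2%:R], continuous f}.
    have cf (t : R) : 0 < t -> {for t, continuous f}.
      by move=> t0; apply: continuousM; [exact: cst_continuous|exact: continuous_powR_gt0].
    by apply: continuous_in_subspaceT => t; rewrite inE/= => /pos; exact: cf.
  move=> /(_ cf).
  have dcF : derivable_oo_LRcontinuous (fun x : R => x `^ s) n.+2%:R^-1 n.+2%:R.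
    have cF t : 0 < t -> {for t, continuous (fun x : R => x `^ s)}.
      exact: continuous_powR_gt0.
    split.
    - by move=> t /subset_itv_oo_cc /pos t0; have [] := dF t t0.
    - by apply: cvg_at_right_filter; apply: cF; rewrite invr_gt0.
    - by apply: cvg_at_left_filter; apply: cF.
  move=> /(_ dcF).
  have dFE : {in `]n.+2%:R^-1, n.+2%:R[, (fun x : R => x `^ s)^`()%classic =1 f}.
    by move=> t /subset_itv_oo_cc /pos t0; rewrite derive1E; have [_ ->] := dF t t0.
  move=> /(_ dFE).
  have cg : {within `[n.+2%:R^-1, n.+2%:R], continuous (fun t : R => expR (- t))}.
    apply: continuous_subspaceT => t.
    by apply: continuous_comp; [exact: continuousN|exact: continuous_expR].
  move=> /(_ cg).
  have dcG : derivable_oo_LRcontinuous (fun x : R => - expR (- x)) n.+2%:R^-1 n.+2%:R.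
    have cG (t : R) : {for t, continuous (fun x : R => - expR (- x))}.
      by apply: differentiable_continuous; apply/derivable1_diffP; have [] := dG t.
    split.
    - by move=> t _; have [] := dG t.
    - by apply: cvg_at_right_filter; apply: cG.
    - by apply: cvg_at_left_filter; apply: cG.
  move=> /(_ dcG).
  have dGE : {in `]n.+2%:R^-1, n.+2%:R[, (fun x : R => - expR (- x))^`()%classic =1 (fun t => expR (- t))}.
    by move=> t _; rewrite derive1E; have [_ ->] := dG t.
  move=> /(_ dGE) {dGE dcG cg dFE dcF cf}.
  rewrite /exhaust /gamma_integrand addrK => ->.
  rewrite -ge0_integralZl//; last 3 first.
  - by apply/measurable_EFinP; apply: measurable_funS (measurable_gamma_integrand s).
  - by move=> t _; rewrite lee_fin gamma_integrand_ge0.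
  - by rewrite lee_fin ltW.
  rewrite !mulrN opprK [X in X%:E]addrC; congr (_ + _)%E.
  transitivity (- (\int[leb]_(x in `[n.+2%:R^-1%R, n.+2%:R%R])
      (- (s%:E * (gamma_integrand s x)%:E))))%E.
    congr (- _)%E; apply: eq_integral => t _.
    by rewrite -EFinM -EFinN /f /gamma_integrand; congr (_%:E); ring.
  rewrite integral_ge0N ?oppeK// => t _.
  by rewrite -EFinM lee_fin mulr_ge0 ?gamma_integrand_ge0 ?ltW.
have cvg3 : (\int[leb]_(t in exhaust n) (gamma_integrand (s + 1) t)%:E @[n --> \oo] -->
    0 + s%:E * gamma_integral s)%E.
  under eq_fun do rewrite parts.
  apply: cvgeD; first by rewrite fin_num_adde_defr.
  - apply: cvg_EFin; first by near=> n.
    rewrite -[0]subr0; apply: cvgB; last exact: cvg_powR_expRN.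
    rewrite -[0](mul0r (expR (- 0))); apply: cvgM; first exact: cvg_powR_inv.
    apply: continuous_cvg; first exact: continuous_expR.
    apply: cvgN; apply/gtr0_cvgV0; first by near=> n.
    by apply/cvgrnyP; apply/cvgnyPge => A; near=> n; near: n; exists A => // n /= An; rewrite (leq_trans An)// leqW.
  - by apply: cvgeZl.
by have := cvg_unique _ cvg1 cvg3; rewrite add0e; apply; exact: ereal_hausdorff.
Unshelve. all: by end_near. Qed.

Lemma gamma_integral_ge0 s : (0 <= gamma_integral s)%E.
Proof. by apply: integral_ge0 => t _; rewrite lee_fin gamma_integrand_ge0. Qed.

(** An infinite integral would give [gamma_fun b] the default value 0, and dividing by 0 would make
    the density vanish identically, against total mass 1. *)
Lemma gamma_pdf_normalized b :
  (\int[leb]_(u in `]0%R, +oo[) (gamma_pdf b u)%:E = 1)%E ->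
  gamma_integral b = (gamma_fun b)%:E /\ 0 < gamma_fun b.
Proof.
rewrite /gamma_pdf => norm.
have gE : gamma_fun b = fine (gamma_integral b) by [].
have g0 : gamma_fun b != 0.
  apply/eqP => g0; move: norm; rewrite g0 invr0.
  under eq_integral do rewrite mulr0.
  by rewrite integral0 => /eqP; rewrite eq_sym onee_eq0.
have gfin : gamma_integral b \is a fin_num.
  move: g0; rewrite gE; have := gamma_integral_ge0 b.
  by case: (gamma_integral b) => //= _; rewrite eqxx.
split; first by rewrite gE fineK.
by rewrite lt_def g0 gE fine_ge0 // gamma_integral_ge0.
Qed.

Lemma gamma_integral_addn b n : 0 < b ->
  gamma_integral b = (gamma_fun b)%:E -> 0 < gamma_fun b ->
  gamma_integral (b + n%:R) = (gamma_fun (b + n%:R))%:E /\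
  0 < gamma_fun (b + n%:R).
Proof.
move=> b0 gb gb0; elim: n => [|n [IH1 IH2]]; first by rewrite addr0.
have bn0 : 0 < b + n%:R by rewrite ltr_wpDr.
have E : gamma_integral (b + n.+1%:R) = ((b + n%:R) * gamma_fun (b + n%:R))%:E.
  by rewrite -natr1 addrA gamma_integralS// IH1 EFinM.
have E' : gamma_fun (b + n.+1%:R) = (b + n%:R) * gamma_fun (b + n%:R).
  by rewrite /gamma_fun /Rintegral -/(gamma_integral _) E.
by rewrite E E'; split=> //; exact: mulr_gt0.
Qed.

Lemma gamma_funS b n : 0 < b ->
  gamma_integral b = (gamma_fun b)%:E -> 0 < gamma_fun b ->
  gamma_fun (b + n.+1%:R) = (b + n%:R) * gamma_fun (b + n%:R).
Proof.
move=> b0 gb gb0; have [E1 _] := gamma_integral_addn n b0 gb gb0.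
have [E2 _] := gamma_integral_addn n.+1 b0 gb gb0.
apply: EFin_inj; rewrite -E2 -natr1 addrA gamma_integralS ?ltr_wpDr//.
by rewrite E1 EFinM.
Qed.

End gamma_function.

(** * Laguerre polynomials *)

Section rodrigues.
Context {R : realType}.
Implicit Types (b c u : R) (p q : {poly R}).

(* [d^j/du^j (e^-u u^c) = e^-u u^(c - j) (rodrigues c j).[u]] for u > 0 *)
Fixpoint rodrigues c j : {poly R} :=
  if j is i.+1 then
    'X * (rodrigues c i)^`() + ((c - i%:R)%:P - 'X) * rodrigues c i
  else 1.

Lemma powR_subr1 c u : 0 < u -> u `^ c = u * u `^ (c - 1).
Proof.
move=> u0; rewrite -{1}(subrK 1 c) [LHS]powRD ?(gt_eqF u0) ?implybT//.
by rewrite powRr1 ?ltW// mulrC.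
Qed.

Lemma derive1n_rodrigues c j u : 0 < u ->
  derive1n j (fun v => expR (- v) * v `^ c) u =
  expR (- u) * u `^ (c - j%:R) * (rodrigues c j).[u].
Proof.
elim: j u => [|j IH] u u0; first by rewrite /= subr0 hornerE mulr1.
rewrite derive1nS derive1E.
(* The induction hypothesis holds only on the open half-line, hence in a neighbourhood of u, which
   suffices for the derivative at u. *)
rewrite (@near_eq_derive _ _ _ _
    (fun v => expR (- v) * v `^ (c - j%:R) * (rodrigues c j).[v])); last first.
  by near=> v; apply: IH; near: v; exact: lt_nbhsr.
have dP : is_derive u 1 (fun x : R => x `^ (c - j%:R))
    ((c - j%:R) * u `^ (c - j%:R - 1)).
  apply: DeriveDef; first by apply: derivable_powR; rewrite in_itv/= u0.
  by rewrite -derive1E powR_derive1// in_itv/= u0.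
have dE : is_derive u 1 (fun v : R => expR (- v)) (- expR (- u)).
  by apply: is_derive_eq; rewrite /GRing.scale/=; ring.
have dH := is_derive_poly (rodrigues c j) u.
have dEP := is_deriveM dE dP.
have [_ ->] := is_deriveM dEP dH.
have -> : c - j.+1%:R = c - j%:R - 1 by rewrite -natr1 opprD addrA.
have sE (x y : R) : x *: (y : R^o) = x * y by [].
rewrite !sE /= !(hornerD, hornerM, hornerX, hornerN, hornerC).
rewrite !fctE (powR_subr1 (c - j%:R) u0).
ring.
Unshelve. all: by end_near. Qed.

(** Degree and leading coefficient determine the j-th derivative, which is all that repeated
    integration by parts leaves of these polynomials. *)
Lemma coef_rodrigues c j :
  (rodrigues c j)`_j = (-1) ^+ j /\ forall m, (j < m)%N -> (rodrigues c j)`_m = 0.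
Proof.
elim: j => [|j [IH1 IH2]]; first by split=> [|m m0]; rewrite coefC// gtn_eqF.
have E m : (rodrigues c j.+1)`_m.+1 =
    (rodrigues c j)`_m.+1 *+ m.+1 + (c - j%:R) * (rodrigues c j)`_m.+1 -
    (rodrigues c j)`_m.
  by rewrite /= coefD coefXM/= coef_deriv mulrBl coefB coefCM coefXM addrA.
split=> [|[//|m] jm]; rewrite E.
  by rewrite IH1 IH2// mul0rn mulr0 add0r sub0r exprS mulN1r.
by rewrite !IH2// ?mul0rn ?mulr0 ?addr0 ?subr0// ltnW.
Qed.

Lemma size_rodrigues c j : (size (rodrigues c j) <= j.+1)%N.
Proof. by apply/leq_sizeP => m; exact: (coef_rodrigues c j).2. Qed.

Lemma derivn_rodrigues_small c i j : (i < j)%N -> (rodrigues c i)^`(j) = 0.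
Proof. by move=> ij; rewrite derivn_poly0// (leq_trans (size_rodrigues _ _)). Qed.

Lemma derivn_rodrigues c j :
  (rodrigues c j)^`(j) = ((-1) ^+ j * j`!%:R)%:P.
Proof.
apply/polyP => m; rewrite coef_derivn coefC.
case: m => [|m] /=; first by rewrite addn0 (coef_rodrigues c j).1 ffactnn mulr_natr.
by rewrite (coef_rodrigues c j).2 ?mul0rn// addnS ltnS leq_addr.
Qed.

End rodrigues.

(** * Orthonormality of the Laguerre polynomials, through Gamma moments *)

Section gamma_moment.
Context {R : realType}.
Variable b : R.
Hypothesis b0 : 0 < b.
Hypothesis norm_b :
  (\int[lebesgue_measure]_(u in `]0%R, +oo[) (gamma_pdf b u)%:E = 1)%E.
Implicit Types (u : R) (p q : {poly R}).

Local Notation leb := (@lebesgue_measure R).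

Lemma gamma_fun_addn_gt0 n : 0 < gamma_fun (b + n%:R).
Proof.
by have [? ?] := gamma_pdf_normalized norm_b; have [] := gamma_integral_addn n b0.
Qed.

Lemma gamma_fun_addnS n :
  gamma_fun (b + n.+1%:R) = (b + n%:R) * gamma_fun (b + n%:R).
Proof. by have [? ?] := gamma_pdf_normalized norm_b; exact: gamma_funS. Qed.

Lemma gamma_fun_gt0 : 0 < gamma_fun b.
Proof. by have := gamma_fun_addn_gt0 0; rewrite addr0. Qed.

(** Algebraic form of the integral of u^(b+n-1) p(u) e^(-u) over the half-line; orthogonality then
    follows from the recurrence of the Gamma function alone, and integrals come back in
    [integral_poly_gamma_pdf]. *)
Definition gamma_moment n p : R :=
  \sum_(i < size p) p`_i * gamma_fun (b + (n + i)%:R).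

Lemma gamma_moment_wide N n p : (size p <= N)%N ->
  gamma_moment n p = \sum_(i < N) p`_i * gamma_fun (b + (n + i)%:R).
Proof.
move=> pN; rewrite /gamma_moment -!(big_mkord xpredT (fun i => p`_i * gamma_fun (b + (n + i)%:R))).
rewrite [RHS](big_cat_nat (n := size p))//= [X in _ + X]big_nat_cond.
by rewrite [X in _ + X]big1 ?addr0// => i /andP[/andP[pi _] _]; rewrite nth_default ?mul0r.
Qed.

Lemma gamma_moment_linear n : linear (gamma_moment n : {poly R} -> R^o).
Proof.
move=> a p q; pose N := maxn (size (a *: p + q)) (maxn (size p) (size q)).
have h1 : (size (a *: p + q)%R <= N)%N by rewrite leq_max leqnn.
have h2 : (size p <= N)%N by rewrite !leq_max leqnn orbT.
have h3 : (size q <= N)%N by rewrite !leq_max leqnn !orbT.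
rewrite (gamma_moment_wide n h1) (gamma_moment_wide n h2) (gamma_moment_wide n h3).
rewrite scaler_sumr -big_split/=; apply: eq_bigr => i _.
by rewrite coefD coefZ mulrDl scalerAl.
Qed.

HB.instance Definition _ n := GRing.isLinear.Build R {poly R} R^o _ _ (gamma_moment_linear n).

Lemma gamma_momentMX n p : gamma_moment n ('X * p) = gamma_moment n.+1 p.
Proof.
rewrite (@gamma_moment_wide (size p).+1); last first.
  by rewrite mulrC (leq_trans (size_polyMleq _ _))// size_polyX addn2.
rewrite big_ord_recl coefXM/= mul0r add0r; apply: eq_bigr => i _.
by rewrite coefXM/= addnS addSn.
Qed.

Lemma gamma_momentC n a : gamma_moment n a%:P = a * gamma_fun (b + n%:R).
Proof.
rewrite (@gamma_moment_wide 1) ?size_polyC_leq1//.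
by rewrite big_ord1 coefC eqxx addn0.
Qed.

(** The integrand behind this moment is the derivative of u^(b+n) p(u) e^(-u), which vanishes at
    both ends of the half-line. *)
Lemma gamma_moment_parts n p :
  gamma_moment n ('X * p^`() + ((b + n%:R)%:P - 'X) * p) = 0.
Proof.
rewrite mulrBl linearD linearB/= gamma_momentMX gamma_momentMX mul_polyC linearZ/=.
rewrite (@gamma_moment_wide (size p) n.+1 p^`()); last first.
  have [->|p0] := eqVneq p 0; first by rewrite deriv0.
  by rewrite ltnW// lt_size_deriv.
apply/eqP; rewrite addrCA addrA subr_eq0 -/(gamma_moment n p); apply/eqP.
rewrite /gamma_moment scaler_sumr.
have -> : \sum_(i < size p) p^`()`_i * gamma_fun (b + (n.+1 + i)%:R) =
    \sum_(i < size p) i%:R * (p`_i * gamma_fun (b + (n + i)%:R)).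
  rewrite -(big_mkord xpredT (fun i => p^`()`_i * gamma_fun (b + (n.+1 + i)%:R))).
  rewrite -(big_mkord xpredT (fun i => i%:R * (p`_i * gamma_fun (b + (n + i)%:R)))).
  case pm : (size p) => [|m]; first by rewrite !big_geq.
  rewrite big_nat_recr//= [RHS]big_nat_recl//= mul0r add0r.
  rewrite coef_deriv nth_default ?pm// mul0rn mul0r addr0.
  by apply: eq_bigr => i _; rewrite coef_deriv -[_ *+ i.+1]mulr_natl -mulrA addSn addnS.
rewrite -big_split/=; apply: eq_bigr => i _.
rewrite addSn gamma_fun_addnS natrD /GRing.scale/=; ring.
Qed.

(* Repeated integration by parts, moving the j derivatives to [q]. *)
Lemma gamma_moment_rodrigues J j q : (j <= J)%N ->
  gamma_moment (J - j) (q * rodrigues (b - 1 + J%:R) j) =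
  (-1) ^+ j * gamma_moment J q^`(j).
Proof.
elim: j q => [|j IH] q jJ; first by rewrite subn0 mulr1 expr0 mul1r.
pose r := rodrigues (b - 1 + J%:R) j; rewrite derivSn exprS -mulrA -IH 1?ltnW// -/r.
(* Leibniz' rule: up to the term carrying q', the product has the exact form annihilated by
   [gamma_moment_parts]. *)
have -> : q * rodrigues (b - 1 + J%:R) j.+1 =
    ('X * (q * r)^`() + ((b + (J - j.+1)%:R)%:P - 'X) * (q * r)) -
    'X * (q^`() * r).
  rewrite /= -/r derivM.
  have -> : b - 1 + J%:R - j%:R = b + (J - j.+1)%:R.
    by rewrite natrB// -natr1; ring.
  by ring.
rewrite linearB/= gamma_moment_parts sub0r mulN1r; congr (- _).
by rewrite gamma_momentMX -subSn.
Qed.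

Definition laguerre_poly k : {poly R} :=
  (Num.sqrt (k`!%:R * gamma_fun b / gamma_fun (b + k%:R)) / k`!%:R) *:
  rodrigues (b - 1 + k%:R) k.

Lemma laguerre_eE k u : 0 < u -> laguerre_e b k u = (laguerre_poly k).[u].
Proof.
move=> u0; rewrite /laguerre_e /laguerre derive1n_rodrigues// /laguerre_poly hornerZ.
rewrite addrK.
have e1 : expR u * expR (- u) = 1 by rewrite -expRD subrr expR0.
have u1 : u `^ (- (b - 1)) * u `^ (b - 1) = 1.
  by rewrite -powRD ?addNr ?powRr0// (gt_eqF u0) implybT.
set x := u `^ _ in u1 *; set y := u `^ _ in u1 *; set e := expR u in e1 *.
set f := expR _ in e1 *.
transitivity (Num.sqrt (k`!%:R * gamma_fun b / gamma_fun (b + k%:R)) * k`!%:R^-1 *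
  (rodrigues (b - 1 + k%:R) k).[u] * ((e * f) * (x * y))); first by ring.
by rewrite e1 u1 !mulr1.
Qed.

Lemma laguerre_poly0 : laguerre_poly 0 = 1.
Proof.
by rewrite /laguerre_poly /= fact0 addr0 mul1r divff ?gt_eqF ?gamma_fun_gt0// sqrtr1 divr1 scale1r.
Qed.

(** All j derivatives of Rodrigues' formula are moved onto the factor of degree i < j, which they
    annihilate. *)
Lemma laguerre_poly_orthogonal i j : (i < j)%N ->
  gamma_moment 0 (laguerre_poly i * laguerre_poly j) = 0.
Proof.
move=> ij; rewrite /laguerre_poly -scalerAl -scalerAr !linearZ/=.
rewrite -(subnn j) gamma_moment_rodrigues// derivn_rodrigues_small//.
by rewrite linear0 !mulr0 !scaler0.
Qed.

(** Moving the k derivatives leaves the constant (-1)^k k!, and the square root is calibrated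
    against it. The value is [gamma_fun b] instead of 1 because moments are taken before dividing by
    the mass. *)
Lemma laguerre_poly_norm k :
  gamma_moment 0 (laguerre_poly k * laguerre_poly k) = gamma_fun b.
Proof.
rewrite /laguerre_poly -scalerAl -scalerAr !linearZ/=.
rewrite -{1}(subnn k) gamma_moment_rodrigues// derivn_rodrigues gamma_momentC.
set s : R := Num.sqrt _.
have ss : s * s = k`!%:R * gamma_fun b / gamma_fun (b + k%:R).
  rewrite -expr2; apply: sqr_sqrtr; apply: divr_ge0.
    by apply: mulr_ge0; [exact: ler0n|exact/ltW/gamma_fun_gt0].
  exact/ltW/gamma_fun_addn_gt0.
have kf : k`!%:R != 0 :> R by rewrite pnatr_eq0 -lt0n fact_gt0.
have gk : gamma_fun (b + k%:R) != 0 by rewrite gt_eqF ?gamma_fun_addn_gt0.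
have sgn : (-1) ^+ k * (-1) ^+ k = 1 :> R by rewrite -exprMn mulrNN mulr1 expr1n.
rewrite /GRing.scale/=.
transitivity ((s * s) * (k`!%:R^-1 * k`!%:R^-1 * k`!%:R) *
  gamma_fun (b + k%:R) * ((-1) ^+ k * (-1) ^+ k)); first by ring.
by rewrite sgn ss mulr1 divfK// mulrAC divfK// mulrAC mulfV// mul1r.
Qed.

Lemma gamma_pdf_ge0 u : 0 <= gamma_pdf b u.
Proof.
by rewrite /gamma_pdf !mulr_ge0 ?powR_ge0 ?expR_ge0// invr_ge0 ltW ?gamma_fun_gt0.
Qed.

Lemma gamma_pdf_gt0 u : 0 < u -> 0 < gamma_pdf b u.
Proof.
by move=> u0; rewrite /gamma_pdf !mulr_gt0 ?powR_gt0 ?expR_gt0// invr_gt0 gamma_fun_gt0.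
Qed.

Lemma measurable_gamma_pdf : measurable_fun setT (gamma_pdf b).
Proof.
apply: measurable_funM => //; exact: measurable_gamma_integrand.
Qed.

Lemma integral_monomial_gamma_pdf n :
  leb.-integrable `]0, +oo[ (fun u => (u ^+ n * gamma_pdf b u)%:E) /\
  (\int[leb]_(u in `]0%R, +oo[) (u ^+ n * gamma_pdf b u)%:E =
   (gamma_fun (b + n%:R) / gamma_fun b)%:E)%E.
Proof.
have mono u : u \in `]0, +oo[%classic -> (u ^+ n * gamma_pdf b u)%:E =
    ((gamma_fun b)^-1%:E * (gamma_integrand (b + n%:R) u)%:E)%E.
  rewrite inE/= in_itv/= andbT => u0; rewrite -EFinM; congr (_%:E).
  rewrite /gamma_pdf /gamma_integrand -powR_mulrn ?ltW//.
  have -> : u `^ (b + n%:R - 1) = u `^ n%:R * u `^ (b - 1).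
    by rewrite -powRD ?(gt_eqF u0) ?implybT// addrCA addrA.
  by ring.
have I : (\int[leb]_(u in `]0%R, +oo[) (u ^+ n * gamma_pdf b u)%:E =
    (gamma_fun (b + n%:R) / gamma_fun b)%:E)%E.
  under eq_integral => u uu do rewrite (mono u uu).
  rewrite ge0_integralZl//; last 3 first.
  - by apply/measurable_EFinP; apply: measurable_funS (measurable_gamma_integrand _).
  - by move=> u _; rewrite lee_fin gamma_integrand_ge0.
  - by rewrite lee_fin invr_ge0 ltW ?gamma_fun_gt0.
  have [? ?] := gamma_pdf_normalized norm_b.
  by rewrite -/(gamma_integral _) (gamma_integral_addn n b0 _ _).1// -EFinM mulrC.
split=> //; apply/integrableP; split.
  apply/measurable_EFinP; apply: measurable_funM; first exact: measurable_funX.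
  by apply: measurable_funS measurable_gamma_pdf.
suff -> : (\int[leb]_(u in `]0%R, +oo[) `|(u ^+ n * gamma_pdf b u)%:E| =
    \int[leb]_(u in `]0%R, +oo[) (u ^+ n * gamma_pdf b u)%:E)%E by rewrite I ltry.
apply: eq_integral => u; rewrite inE/= in_itv/= andbT => u0.
by rewrite ger0_norm// mulr_ge0 ?gamma_pdf_ge0// exprn_ge0// ltW.
Qed.

Lemma integral_poly_gamma_pdf p :
  leb.-integrable `]0, +oo[ (fun u => (p.[u] * gamma_pdf b u)%:E) /\
  (\int[leb]_(u in `]0%R, +oo[) (p.[u] * gamma_pdf b u)%:E =
   (gamma_moment 0 p / gamma_fun b)%:E)%E.
Proof.
(* The extra weight u^n closes the induction on the polynomial: a factor X raises n by one. *)
suff H n : leb.-integrable `]0, +oo[ (fun u => (u ^+ n * p.[u] * gamma_pdf b u)%:E) /\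
  (\int[leb]_(u in `]0%R, +oo[) (u ^+ n * p.[u] * gamma_pdf b u)%:E =
   (gamma_moment n p / gamma_fun b)%:E)%E.
  have [H1 H2] := H 0%N; split; last rewrite -H2.
  - by apply: eq_integrable H1 => // u _; rewrite expr0 mul1r.
  - by apply: eq_integral => u _; rewrite expr0 mul1r.
elim/poly_ind: p n => [|p c IH] n.
  have E u : (u ^+ n * 0.[u] * gamma_pdf b u)%:E = 0%E by rewrite horner0 mulr0 mul0r.
  split; first by apply: eq_integrable (integrable0 _ _) => // u _; rewrite E.
  by rewrite (eq_integral (cst 0%E)) ?integral0 ?linear0 ?mul0r// => u _; rewrite E.
have [I1 E1] := IH n.+1; have [I2 E2] := integral_monomial_gamma_pdf n.
have I2' : leb.-integrable `]0, +oo[ (fun u => c%:E * (u ^+ n * gamma_pdf b u)%:E)%E.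
  exact: integrableZl.
have E u : (u ^+ n * (p * 'X + c%:P).[u] * gamma_pdf b u)%:E =
    ((u ^+ n.+1 * p.[u] * gamma_pdf b u)%:E + c%:E * (u ^+ n * gamma_pdf b u)%:E)%E.
  by rewrite -EFinM -EFinD; congr (_%:E); rewrite hornerMXaddC exprS; ring.
split; first by apply: eq_integrable (integrableD _ I1 I2') => // u _; rewrite E.
under eq_integral do rewrite E.
rewrite integralD// E1 integralZl// E2.
rewrite -EFinM -EFinD; congr (_%:E).
by rewrite [p * 'X]mulrC linearD/= gamma_momentMX gamma_momentC; ring.
Qed.

End gamma_moment.

(** * Square-integrable functions and orthonormal expansions *)

Section square_integrable.
Context {R : realType} {d} {T : measurableType d}.
Variable mu : {measure set T -> \bar R}.
Implicit Types (f g h : T -> R) (c : R).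

Definition square_integrable f :=
  measurable_fun setT f /\ mu.-integrable setT (fun x => (f x ^+ 2)%:E).

Local Notation int1 f := (mu.-integrable setT (EFin \o f)).

Lemma square_integrable_mul f g : square_integrable f -> square_integrable g ->
  int1 (fun x => f x * g x).
Proof.
move=> [mf If] [mg Ig]; apply: le_integrable (integrableD _ If Ig) => //.
  by apply/measurable_EFinP; exact: measurable_funM.
move=> x _; rewrite /= lee_fin [leRHS]ger0_norm ?addr_ge0 ?sqr_ge0//.
rewrite normrM -(real_normK (num_real (f x))) -(real_normK (num_real (g x))).
by have := sqr_ge0 (`|f x| - `|g x|); rewrite sqrrB; nra.
Qed.

Lemma square_integrableD f g : square_integrable f -> square_integrable g ->
  square_integrable (fun x => f x + g x).
Proof.
move=> L2f L2g; have Ifg := square_integrable_mul L2f L2g.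
have [mf If] := L2f; have [mg Ig] := L2g.
split; first exact: measurable_funD.
have I := integrableD measurableT (integrableD measurableT If Ig) (integrableZl measurableT 2 Ifg).
apply: eq_integrable I => // x _ /=.
by rewrite -EFinM -!EFinD; congr (_%:E); ring.
Qed.

Lemma square_integrableZ c f : square_integrable f ->
  square_integrable (fun x => c * f x).
Proof.
move=> [mf If]; split; first exact: measurable_funM.
apply: eq_integrable (integrableZl measurableT (c ^+ 2) If) => // x _ /=.
by rewrite exprMn EFinM.
Qed.

Lemma square_integrableB f g : square_integrable f -> square_integrable g ->
  square_integrable (fun x => f x - g x).
Proof.
move=> L2f L2g.
have := square_integrableD L2f (square_integrableZ (-1) L2g).
by congr square_integrable; apply/funext => x; rewrite mulN1r.
Qed.

Lemma square_integrable0 : square_integrable (fun=> 0).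
Proof.
split=> //; apply: eq_integrable (integrable0 _ _) => // x _.
by rewrite expr0n.
Qed.

Lemma square_integrable_sum n (f : nat -> T -> R) :
  (forall i, square_integrable (f i)) ->
  square_integrable (fun x => \sum_(i < n) f i x).
Proof.
move=> L2f; elim: n => [|n IH].
  by under [X in square_integrable X]eq_fun do rewrite big_ord0; exact: square_integrable0.
under [X in square_integrable X]eq_fun do rewrite big_ord_recr/=.
exact: square_integrableD.
Qed.

(* A weighted AM-GM inequality, used in place of Cauchy-Schwarz. *)
Lemma Rintegral_mul_le t f g : 0 < t ->
  square_integrable f -> square_integrable g ->
  `|\int[mu]_x (f x * g x)| <=
    t * \int[mu]_x (f x ^+ 2) + t^-1 * \int[mu]_x (g x ^+ 2).
Proof.
move=> t0 L2f L2g; have Ifg := square_integrable_mul L2f L2g.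
have [mf If] := L2f; have [mg Ig] := L2g.
have If' := integrableZl measurableT t If.
have Ig' := integrableZl measurableT t^-1 Ig.
apply: (le_trans (le_normr_Rintegral measurableT Ifg)).
rewrite -!RintegralZl// -RintegralD//.
apply: le_Rintegral => //; first exact: (integrable_abse Ifg).
  exact: (integrableD measurableT If' Ig').
move=> x _; rewrite normrM -(real_normK (num_real (f x))) -(real_normK (num_real (g x))).
set a := `|f x|; set b := `|g x|.
have a0 : 0 <= a by exact: normr_ge0.
have b0 : 0 <= b by exact: normr_ge0.
rewrite -(ler_pM2l t0) mulrDr [t * (t^-1 * _)]mulrA divff ?gt_eqF// mul1r.
have := sqr_ge0 (t * a - b); have := mulr_ge0 (ltW t0) (mulr_ge0 a0 b0).
nra.
Qed.

Lemma Rintegral_sum n (f : nat -> T -> R) : (forall i, int1 (f i)) ->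
  int1 (fun x => \sum_(i < n) f i x) /\
  \int[mu]_x (\sum_(i < n) f i x) = \sum_(i < n) \int[mu]_x (f i x).
Proof.
move=> If; elim: n => [|n [IH1 IH2]].
  under eq_Rintegral do rewrite big_ord0.
  rewrite big_ord0 Rintegral_cst// mul0r; split=> //.
  by apply: eq_integrable (integrable0 _ _) => // x _ /=; rewrite big_ord0.
split.
  apply: eq_integrable (integrableD measurableT IH1 (If n)) => // x _ /=.
  by rewrite big_ord_recr.
rewrite big_ord_recr/= -IH2 -RintegralD//.
by apply: eq_Rintegral => x _; rewrite big_ord_recr.
Qed.

End square_integrable.

(** * Orthonormal families and pointwise limits of their partial sums *)

Section orthonormal.
Context {R : realType} {d} {T : measurableType d}.
Variable mu : {measure set T -> \bar R}.
Variable e : nat -> T -> R.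
Hypothesis L2e : forall i, square_integrable mu (e i).
Hypothesis ortho : forall i j, \int[mu]_x (e i x * e j x) = (i == j)%:R.
Implicit Types (a : nat -> R) (H : T -> R).

Definition partial_sum a n x : R := \sum_(i < n) a i * e i x.

Lemma square_integrable_partial_sum a n : square_integrable mu (partial_sum a n).
Proof. by apply: (@square_integrable_sum _ _ _ mu n (fun i x => a i * e i x)) => i; exact: square_integrableZ. Qed.

Lemma Rintegral_partial_sum a n H : square_integrable mu H ->
  \int[mu]_x (H x * partial_sum a n x) =
  \sum_(i < n) a i * \int[mu]_x (H x * e i x).
Proof.
move=> L2H; have I i := square_integrable_mul L2H (L2e i).
have I' i : mu.-integrable setT (EFin \o (fun x => a i * (H x * e i x))).
  exact: (integrableZl measurableT (a i) (I i)).
have [_ E] := Rintegral_sum n I'.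
under [RHS]eq_bigr do rewrite -RintegralZl//.
by rewrite -E; apply: eq_Rintegral => x _; rewrite mulr_sumr; apply: eq_bigr => i _; ring.
Qed.

Lemma Rintegral_sqr_partial_sum a n :
  \int[mu]_x (partial_sum a n x ^+ 2) = \sum_(i < n) a i ^+ 2.
Proof.
under eq_Rintegral do rewrite expr2.
rewrite Rintegral_partial_sum; last exact: square_integrable_partial_sum.
apply: eq_bigr => i _; rewrite expr2; congr (_ * _).
under eq_Rintegral do rewrite mulrC.
rewrite Rintegral_partial_sum//.
under eq_bigr do rewrite ortho.
rewrite (bigD1 i)//= eqxx mulr1 big1 ?addr0// => j ji.
by rewrite eq_sym (negbTE (_ : nat_of_ord j != i)) ?mulr0.
Qed.

(** The difference of the two sides is the squared distance from H to its projection. *)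
Lemma Bessel n H : square_integrable mu H ->
  \sum_(i < n) (\int[mu]_x (H x * e i x)) ^+ 2 <= \int[mu]_x (H x ^+ 2).
Proof.
move=> L2H; pose a i := \int[mu]_x (H x * e i x).
have L2s := square_integrable_partial_sum a n.
have E : \int[mu]_x ((H x - partial_sum a n x) ^+ 2) =
    \int[mu]_x (H x ^+ 2) - \sum_(i < n) a i ^+ 2.
  have I1 := L2H.2; have I2 := L2s.2; have I3 := square_integrable_mul L2H L2s.
  have I3' := integrableZl measurableT (-2) I3.
  have sqrE x : (H x - partial_sum a n x) ^+ 2 =
    (H x ^+ 2 + partial_sum a n x ^+ 2) + -2 * (H x * partial_sum a n x) by ring.
  under eq_Rintegral do rewrite sqrE.
  rewrite RintegralD//; last exact: (integrableD measurableT I1 I2).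
  rewrite RintegralD// RintegralZl// Rintegral_sqr_partial_sum Rintegral_partial_sum//.
  under [X in _ + -2 * X]eq_bigr do rewrite -/(a _) -expr2.
  ring.
rewrite -subr_ge0 -E; apply: Rintegral_ge0 => x _; exact: sqr_ge0.
Qed.

Variables (a : nat -> R) (tau : nat -> R) (h : T -> R).
Hypothesis tail : forall n m, (n <= m)%N -> \sum_(n <= i < m) a i ^+ 2 <= tau n.
Hypothesis tau0 : tau n @[n --> \oo] --> 0.
Hypothesis s_h : forall x, partial_sum a n x @[n --> \oo] --> h x.

Let mh : measurable_fun setT h.
Proof.
apply: (@measurable_fun_cvg _ _ _ _ (partial_sum a)) => [n|x _].
  by have [] := square_integrable_partial_sum a n.
exact: s_h.
Qed.

(* Fatou, applied to the squares of the differences of partial sums. *)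
Lemma integral_sqr_tail_le n :
  (\int[mu]_x ((h x - partial_sum a n x) ^+ 2)%:E <= (tau n)%:E)%E.
Proof.
pose f m x := ((partial_sum a (n + m) x - partial_sum a n x) ^+ 2)%:E.
have mf m : measurable_fun setT (f m).
  apply/measurable_EFinP; apply: measurable_funX; apply: measurable_funB.
    by have [] := square_integrable_partial_sum a (n + m).
  by have [] := square_integrable_partial_sum a n.
have f0 m x : setT x -> (0 <= f m x)%E by rewrite lee_fin sqr_ge0.
have lim_f x : limn_einf (f ^~ x) = ((h x - partial_sum a n x) ^+ 2)%:E.
  have cf : f m x @[m --> \oo] --> ((h x - partial_sum a n x) ^+ 2)%:E.
    apply: cvg_EFin; first by near=> m.
    rewrite [X in X @ _ --> _](_ : _ = (fun m => (partial_sum a (n + m) x - partial_sum a n x) ^+ 2))//.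
    rewrite expr2; under eq_fun do rewrite expr2.
    have c : partial_sum a (n + m) x - partial_sum a n x @[m --> \oo] --> h x - partial_sum a n x.
      apply: cvgB; last exact: cvg_cst.
      have := @s_h x; rewrite -(cvg_shiftn n).
      by under eq_fun do rewrite addnC.
    exact: cvgM.
  by have [-> _] := cvg_limn_einf_sup cf.
have := fatou mu measurableT mf f0.
under eq_integral do rewrite lim_f.
move=> /le_trans; apply.
rewrite limn_einf_lim; apply: lime_le; first exact: is_cvg_einfs.
near=> m; apply: (@le_trans _ _ (\int[mu]_x f m x)%E).
  by apply: ereal_inf_lbound; exists m => //=.
(* Annulling the first n coefficients makes the difference of two partial sums a partial sum again,
   so its norm is already known. *)
pose a' i := if (n <= i)%N then a i else 0.
have fE x : f m x = (partial_sum a' (n + m) x ^+ 2)%:E.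
  congr ((_ ^+ 2)%:E); rewrite /partial_sum !big_split_ord/= addrAC subrr add0r.
  rewrite [X in _ = X + _]big1 ?add0r; last first.
    by move=> i _; rewrite /a' leqNgt ltn_ord/= mul0r.
  by apply: eq_bigr => i _; rewrite /a' leq_addr.
under eq_integral do rewrite fE.
have [_ I] := square_integrable_partial_sum a' (n + m).
rewrite -[leLHS]fineK; last exact: (integrable_fin_num measurableT I).
rewrite lee_fin -/(Rintegral _ _ _) Rintegral_sqr_partial_sum.
apply: le_trans (tail (leq_addr m n)).
rewrite big_split_ord/= big1 ?add0r; last first.
  by move=> i _; rewrite /a' leqNgt ltn_ord/= expr0n.
rewrite -[X in index_iota X]add0n big_addn addKn big_mkord.
by rewrite ler_sum// => i _; rewrite /a' leq_addr addnC.
Unshelve. all: by end_near. Qed.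

Lemma square_integrable_tail n :
  square_integrable mu (fun x => h x - partial_sum a n x) /\
  \int[mu]_x ((h x - partial_sum a n x) ^+ 2) <= tau n.
Proof.
have L := integral_sqr_tail_le n.
have [ms _] := square_integrable_partial_sum a n.
have I : mu.-integrable setT (fun x => ((h x - partial_sum a n x) ^+ 2)%:E).
  apply/integrableP; split.
    by apply/measurable_EFinP; apply: measurable_funX; exact: measurable_funB.
  under eq_integral do rewrite gee0_abs ?lee_fin ?sqr_ge0//.
  exact: le_lt_trans L (ltry _).
split; first by split=> //; exact: measurable_funB.
rewrite -lee_fin; apply: le_trans L.
by rewrite /Rintegral fineK//; exact: integrable_fin_num.
Qed.

Lemma square_integrable_limit : square_integrable mu h.
Proof.
have [L _] := square_integrable_tail 0.
have := square_integrableD L (square_integrable_partial_sum a 0).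
by congr square_integrable; apply/funext => x; rewrite subrK.
Qed.

(** The pointwise limit is also a limit in mean square, with rate [tau], so pairing with a fixed H
    is continuous along the partial sums. *)
Lemma Rintegral_limit_le H C : square_integrable mu H ->
  (forall n, `|\int[mu]_x (H x * partial_sum a n x)| <= C) ->
  `|\int[mu]_x (H x * h x)| <= C.
Proof.
move=> L2H HC; apply/ler_addgt0Pr => eps eps0.
set N := \int[mu]_x (H x ^+ 2).
have N0 : 0 <= N by apply: Rintegral_ge0 => x _; exact: sqr_ge0.
(* The weight makes the H term of the AM-GM bound at most eps / 2; n is then taken so large that the
   tail, divided by t, is also at most eps / 2. *)
pose t := eps / (2 * (N + 1)).
have t0 : 0 < t by rewrite divr_gt0// mulr_gt0// ltr_wpDl.
have [n tn] : exists n, tau n <= t * (eps / 2).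
  have e0 : 0 < t * (eps / 2) by rewrite mulr_gt0// divr_gt0.
  have /cvgrPdist_le /(_ _ e0)[n _ nP] := tau0.
  exists n; have := nP n (leqnn n); rewrite sub0r normrN.
  by apply: le_trans; exact: ler_norm.
have [L2t tle] := square_integrable_tail n.
have L2s := square_integrable_partial_sum a n.
have -> : \int[mu]_x (H x * h x) = \int[mu]_x (H x * partial_sum a n x) +
    \int[mu]_x (H x * (h x - partial_sum a n x)).
  rewrite -RintegralD//; last 2 first.
  - exact: square_integrable_mul.
  - exact: square_integrable_mul.
  by apply: eq_Rintegral => x _; ring.
apply: (le_trans (ler_normD _ _)); apply: lerD; first exact: HC.
apply: (le_trans (Rintegral_mul_le t0 L2H L2t)); rewrite -/N.
have h1 : t * N <= eps / 2.
  rewrite /t mulrAC ler_pdivrMr ?mulr_gt0 ?ltr_wpDl//.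
  have := mulr_ge0 (ltW eps0) N0; nra.
have h2 : t^-1 * \int[mu]_x (h x - partial_sum a n x) ^+ 2 <= eps / 2.
  by rewrite ler_pdivrMl//; exact: le_trans tle tn.
lra.
Qed.

End orthonormal.

(** * Integrals of tensor products *)

Section tensor_product.
Context {R : realType} {d1 d2} {T1 : measurableType d1} {T2 : measurableType d2}.
Variables (m1 : {sigma_finite_measure set T1 -> \bar R})
  (m2 : {sigma_finite_measure set T2 -> \bar R}).
Implicit Types (f : T1 -> R) (g : T2 -> R).

Lemma Rintegral_tensor f g : m1.-integrable setT (EFin \o f) ->
  m2.-integrable setT (EFin \o g) ->
  (m1 \x m2)%E.-integrable setT (fun z => (f z.1 * g z.2)%:E) /\
  \int[(m1 \x m2)%E]_z (f z.1 * g z.2) = \int[m1]_x f x * \int[m2]_y g y.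
Proof.
move=> If Ig.
have mf : measurable_fun setT f by apply/measurable_EFinP; exact: measurable_int If.
have mg : measurable_fun setT g by apply/measurable_EFinP; exact: measurable_int Ig.
have mfg : measurable_fun setT (fun z : T1 * T2 => (f z.1 * g z.2)%:E).
  apply/measurable_EFinP; apply: measurable_funM.
    exact: (measurableT_comp mf measurable_fst).
  exact: (measurableT_comp mg measurable_snd).
have fin_g : (\int[m2]_y (g y)%:E)%E \is a fin_num by exact: integrable_fin_num Ig.
have I : (m1 \x m2)%E.-integrable setT (fun z => (f z.1 * g z.2)%:E).
  apply/(integrable12ltyP _ _ mfg) => /=.
  have [_ Jf] := integrableP _ _ _ If; have [_ Jg] := integrableP _ _ _ Ig.
  have E x : (\int[m2]_y `|(f x * g y)%:E| = `|(f x)%:E| * \int[m2]_y `|(g y)%:E|)%E.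
    under eq_integral do rewrite EFinM abseM.
    rewrite ge0_integralZl//; apply: measurableT_comp => //.
    exact/measurable_EFinP.
  under eq_integral do rewrite E.
  rewrite ge0_integralZr//; last 2 first.
  - by apply: measurableT_comp => //; exact/measurable_EFinP.
  - exact: integral_ge0.
  by rewrite lte_mul_pinfty//; [exact: integral_ge0|rewrite ge0_fin_numE//; exact: integral_ge0].
split=> //.
rewrite /Rintegral -(integral12_prod_meas1 I) /fubini_F/=.
have E x : (\int[m2]_y (f x * g y)%:E = (f x)%:E * \int[m2]_y (g y)%:E)%E.
  by under eq_integral do rewrite EFinM; rewrite integralZl.
under eq_integral do rewrite E.
rewrite -(fineK fin_g); under eq_integral do rewrite muleC.
rewrite (integralZl measurableT If) fineM; last 2 first.
- by [].
- exact: (integrable_fin_num measurableT If).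
exact: mulrC.
Qed.

End tensor_product.

(** * Measures with a density *)

Section density.
Context {R : realType} {d} {T : measurableType d}.
Variables mu nu : {measure set T -> \bar R}.
Local Open Scope ereal_scope.

Import HBNNSimple.

Section nonnegative_density.
Variable q : T -> R.
Hypothesis mq : measurable_fun setT q.
Hypothesis q0 : forall x, (0 <= q x)%R.
Hypothesis nuE : forall A, measurable A -> nu A = \int[mu]_(x in A) (q x)%:E.

Let mq' : measurable_fun setT (EFin \o q).
Proof. exact/measurable_EFinP. Qed.

Let integral_density_nnsfun (g : {nnsfun T >-> R}) :
  \int[nu]_x (g x)%:E = \int[mu]_x ((g x)%:E * (q x)%:E).
Proof.
under [LHS]eq_integral do rewrite fimfunE -fsumEFin//.
rewrite [LHS]ge0_integral_fsum//; last 2 first.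
- by move=> r; exact/measurable_EFinP/measurableT_comp.
- by move=> n x _; rewrite EFinM nnfun_muleindic_ge0.
under [RHS]eq_integral.
  move=> x xD; rewrite fimfunE -fsumEFin// muleC ge0_mule_fsumr; last first.
    by move=> r; rewrite EFinM nnfun_muleindic_ge0.
  over.
rewrite [RHS]ge0_integral_fsum//; last 2 first.
- move=> r; apply/emeasurable_funM => //; apply/measurable_EFinP.
  exact/measurableT_comp.
- by move=> n x _; apply: mule_ge0; [rewrite lee_fin|rewrite EFinM nnfun_muleindic_ge0].
apply: eq_fsbigr => r _; rewrite integralZl_indic_nnsfun// integral_indic// setIT.
have mB : measurable (g @^-1` [set r]) by [].
rewrite nuE// integral_mkcond.
have [r0|r0] := ltP r 0%R.
  rewrite preimage_nnfun0//; under [X in _ * X]eq_integral do rewrite patch_set0.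
  by rewrite integral0 mule0; under eq_integral do rewrite indic0 mulr0 mule0; rewrite integral0.
rewrite -ge0_integralZl//; last 2 first.
- by apply/(measurable_restrictT (EFin \o q)) => //; exact: measurable_funTS.
- by move=> x _; apply: erestrict_ge0 => y _; rewrite lee_fin.
apply: eq_integral => x _; rewrite patchE indicE; case: ifPn => xB.
  by rewrite mulr1 muleC.
by rewrite mulr0 !mule0.
Qed.

Lemma ge0_integral_density (f : T -> \bar R) : measurable_fun setT f ->
  (forall x, 0 <= f x) -> \int[nu]_x f x = \int[mu]_x (f x * (q x)%:E).
Proof.
move=> mf f0; pose g := nnsfun_approx measurableT mf.
have gf x : (g n x)%:E @[n --> \oo] --> f x by exact: cvg_nnsfun_approx.
transitivity (limn (fun n => \int[nu]_x (g n x)%:E)).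
  rewrite -monotone_convergence//=.
  - by apply: eq_integral => x _; apply/esym/cvg_lim.
  - by move=> n; exact/measurable_EFinP.
  - by move=> n x _; rewrite lee_fin.
  - by move=> x _ a b ab; rewrite lee_fin; exact/lefP/nd_nnsfun_approx.
under eq_fun do rewrite integral_density_nnsfun.
rewrite -monotone_convergence//=; last 3 first.
- by move=> n; apply: emeasurable_funM => //; exact/measurable_EFinP.
- by move=> n x _; rewrite mule_ge0// lee_fin.
- move=> x _ a b ab; apply: lee_wpmul2r; first by rewrite lee_fin.
  by rewrite lee_fin; exact/lefP/nd_nnsfun_approx.
apply: eq_integral => x _; apply: cvg_lim => //.
by apply: cvgeZr => //.
Qed.

End nonnegative_density.

Variable q : T -> R.
Hypothesis mq : measurable_fun setT q.
Hypothesis nuE : forall A, measurable A -> nu A = \int[mu]_(x in A) (q x)%:E.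

(** A bivariate density is given only as the limit of a series, with no sign known in advance; hence
    the split into positive and negative parts. *)
Let qpos x : R := Num.max (q x) 0%R.
Let qneg x : R := Num.max (- q x)%R 0%R.

Let mqpos : measurable_fun setT qpos.
Proof. exact: measurable_maxr. Qed.

Let mqneg : measurable_fun setT qneg.
Proof. by apply: measurable_maxr => //; exact: measurable_funN. Qed.

Let integralq A : \int[mu]_(x in A) (q x)%:E =
  \int[mu]_(x in A) (qpos x)%:E - \int[mu]_(x in A) (qneg x)%:E.
Proof.
rewrite integralE; congr (_ - _); apply: eq_integral => x _.
  by rewrite funeposE -EFin_max.
by rewrite funenegE -EFinN -EFin_max.
Qed.

(* [q] is not assumed nonnegative, but it is so almost everywhere, because
   [nu] is nonnegative on the set where [q] is negative. *)
Let qneg_int0 : \int[mu]_x (qneg x)%:E = 0.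
Proof.
pose N := [set x | (q x < 0)%R].
have mN : measurable N.
  have -> : N = q @^-1` `]-oo, 0%R[.
    by apply/seteqP; split=> x; rewrite /N /= in_itv.
  by rewrite -[X in measurable X]setTI; exact: mq.
have : 0 <= nu N by exact: measure_ge0.
rewrite nuE// integralq.
have -> : \int[mu]_(x in N) (qpos x)%:E = 0.
  rewrite (eq_integral (cst 0)) ?integral0// => x; rewrite inE /N/= => xN.
  by rewrite /qpos max_r// ltW.
rewrite add0e oppe_ge0 => le0.
have -> : \int[mu]_x (qneg x)%:E = \int[mu]_(x in N) (qneg x)%:E.
  rewrite [RHS]integral_mkcond; apply: eq_integral => x _; rewrite patchE.
  case: ifPn => //; rewrite notin_setE /N/= => /negP; rewrite -leNgt => xN.
  by rewrite /qneg max_r// oppr_le0.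
apply/eqP; rewrite eq_le le0/=; apply: integral_ge0 => x _.
by rewrite lee_fin /qneg le_max lexx orbT.
Qed.

Let nu_qpos A : measurable A -> nu A = \int[mu]_(x in A) (qpos x)%:E.
Proof.
move=> mA; rewrite nuE// integralq.
suff -> : \int[mu]_(x in A) (qneg x)%:E = 0 by rewrite sube0.
apply/eqP; rewrite eq_le; apply/andP; split.
  rewrite -qneg_int0; apply: ge0_subset_integral => //.
    exact/measurable_EFinP.
  by move=> x _; rewrite lee_fin /qneg le_max lexx orbT.
by apply: integral_ge0 => x _; rewrite lee_fin /qneg le_max lexx orbT.
Qed.

Let qposE : ae_eq mu setT q qpos.
Proof.
have : ae_eq mu setT (EFin \o qneg) (cst 0).
  apply/(ae_eq_integral_abs mu measurableT); first exact/measurable_EFinP.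
  rewrite -[RHS]qneg_int0; apply: eq_integral => x _.
  by rewrite /= ger0_norm// /qneg le_max lexx orbT.
apply: filterS => x /= /(_ I) [] + _; rewrite /qneg /qpos => /eqP.
by case: (leP 0%R (q x)) => // xq; rewrite max_l ?oppr_ge0 ?ltW// oppr_eq0 => /eqP.
Qed.

Lemma integral_density (f : T -> R) : measurable_fun setT f ->
  \int[nu]_x (f x)%:E = \int[mu]_x (f x * q x)%:E.
Proof.
move=> mf.
have qpos0 x : (0 <= qpos x)%R by rewrite /qpos le_max lexx orbT.
have -> : \int[mu]_x (f x * q x)%:E = \int[mu]_x (f x * qpos x)%:E.
  apply: ae_eq_integral => //.
  - by apply/measurable_EFinP; exact: measurable_funM.
  - by apply/measurable_EFinP; exact: measurable_funM.
  - by apply: filterS qposE => x /= /(_ I) -> _.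
have D g : measurable_fun setT g -> (forall x, 0 <= g x) ->
    \int[nu]_x g x = \int[mu]_x (g x * (qpos x)%:E).
  exact: ge0_integral_density.
rewrite integralE [RHS]integralE !D//.
- congr (_ - _); apply: eq_integral => x _.
    rewrite !funeposE -!EFin_max -EFinM; congr (_%:E).
    by rewrite maxr_pMl// mul0r.
  rewrite !funenegE -!EFinN -!EFin_max -EFinM; congr (_%:E).
  by rewrite maxr_pMl// mul0r mulNr.
- by apply: measurable_funeneg; exact/measurable_EFinP.
- by apply: measurable_funepos; exact/measurable_EFinP.
Qed.

Lemma integrable_density (f : T -> R) : measurable_fun setT f ->
  nu.-integrable setT (EFin \o f) <-> mu.-integrable setT (fun x => (f x * q x)%:E).
Proof.
move=> mf; have mfq : measurable_fun setT (fun x => (f x * q x)%:E).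
  by apply/measurable_EFinP; exact: measurable_funM.
have E : \int[nu]_x `|(f x)%:E| = \int[mu]_x `|(f x * q x)%:E|.
  have mf' : measurable_fun setT (fun x => `|f x|%R) by exact: measurableT_comp.
  transitivity (\int[nu]_x (`|f x|%R)%:E); first exact: eq_integral.
  rewrite (integral_density mf'); apply: ae_eq_integral => //.
  - by apply/measurable_EFinP; exact: measurable_funM.
  - exact: measurableT_comp.
  - apply: filterS qposE => x /= /(_ I) qx _.
    by rewrite normrM qx (ger0_norm (_ : 0 <= qpos x)%R)// /qpos le_max lexx orbT.
split=> /integrableP[_ I]; apply/integrableP; split=> //; last first.
- by rewrite E.
- exact/measurable_EFinP.
- by rewrite -E.
Qed.

End density.

(** * Laguerre expansion of the bivariate laws *)

Section gamma_law.
Context {R : realType}.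
Variables (b : R) (m : probability (measurableTypeR R) R).
Hypothesis b0 : 0 < b.
Hypothesis mE : forall A : set (measurableTypeR R), measurable A ->
  m A = (\int[lebesgue_measure]_(u in A `&` `]0%R, +oo[) (gamma_pdf b u)%:E)%E.
Implicit Types (u r : R) (p : {poly R}).

Local Notation leb := (@lebesgue_measure R).

Lemma pos_patchE (f : R -> R) u :
  (f \_ `]0%R, +oo[%classic) u = if 0 < u then f u else 0.
Proof. by rewrite patchE mem_setE in_itv/= andbT. Qed.

Lemma measurable_pos_patch (f : R -> R) :
  measurable_fun (`]0%R, +oo[%classic : set R) f ->
  measurable_fun setT (f \_ `]0%R, +oo[%classic).
Proof. by move=> mf; apply/(measurable_restrictT f). Qed.

Lemma gamma_law_normalized :
  (\int[leb]_(u in `]0%R, +oo[) (gamma_pdf b u)%:E = 1)%E.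
Proof. by have := mE measurableT; rewrite setTI probability_setT => <-. Qed.

Let norm_b := gamma_law_normalized.

Definition gamma_pdf0 : R -> R := gamma_pdf b \_ `]0%R, +oo[.

Lemma measurable_gamma_pdf0 : measurable_fun setT gamma_pdf0.
Proof. by apply: measurable_pos_patch; apply: measurable_funS (measurable_gamma_pdf b). Qed.

Lemma gamma_pdf0_ge0 u : 0 <= gamma_pdf0 u.
Proof. by rewrite /gamma_pdf0 pos_patchE; case: ifPn => // u0; exact: gamma_pdf_ge0. Qed.

Lemma gamma_law_density A : measurable A ->
  m A = (\int[leb]_(u in A) (gamma_pdf0 u)%:E)%E.
Proof.
move=> mA; rewrite mE// integral_mkcondr; apply: eq_integral => u _.
by rewrite /gamma_pdf0 restrict_EFin.
Qed.

Let gdensity (f : measurableTypeR R -> R) :=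
  @integral_density R _ (measurableTypeR R) leb m gamma_pdf0 measurable_gamma_pdf0 gamma_law_density f.

Let gdensity_integrable (f : measurableTypeR R -> R) :=
  @integrable_density R _ (measurableTypeR R) leb m gamma_pdf0 measurable_gamma_pdf0 gamma_law_density f.

Lemma integral_gamma_law (f : R -> R) : measurable_fun setT f ->
  (\int[m]_u (f u)%:E = \int[leb]_(u in `]0%R, +oo[) (f u * gamma_pdf b u)%:E)%E.
Proof.
move=> mf; rewrite (gdensity mf).
rewrite [RHS]integral_mkcond; apply: eq_integral => u _.
by rewrite restrict_EFin/= /gamma_pdf0 !pos_patchE; case: ifPn => //; rewrite mulr0.
Qed.

Lemma integrable_gamma_law (f : R -> R) : measurable_fun setT f ->
  m.-integrable setT (EFin \o f) <->
  leb.-integrable `]0, +oo[ (fun u => (f u * gamma_pdf b u)%:E).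
Proof.
move=> mf; split.
- move/(gdensity_integrable mf) => I.
  apply/(@integrable_mkcond _ _ _ leb `]0, +oo[%classic (fun u => (f u * gamma_pdf b u)%:E) (measurable_itv _)).
  apply: eq_integrable I => // u _.
  by rewrite restrict_EFin/= /gamma_pdf0 !pos_patchE; case: ifPn => //; rewrite mulr0.
- move/(@integrable_mkcond _ _ _ leb `]0, +oo[%classic (fun u => (f u * gamma_pdf b u)%:E) (measurable_itv _)) => I.
  apply/(gdensity_integrable mf).
  apply: eq_integrable I => // u _.
  by rewrite restrict_EFin/= /gamma_pdf0 !pos_patchE; case: ifPn => //; rewrite mulr0.
Qed.

Lemma square_integrable_gamma_law (F : R -> R) : L2_gamma b F ->
  square_integrable m (F \_ `]0%R, +oo[).
Proof.
move=> [mF FI]; have mF0 := measurable_pos_patch mF.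
split=> //; apply/(integrable_gamma_law (measurable_funX 2 mF0)).
apply/integrableP; split.
  apply/measurable_EFinP/measurable_funM.
    by apply: measurable_funS (measurable_funX 2 mF0).
  by apply: measurable_funS (measurable_gamma_pdf b).
apply: le_lt_trans FI; rewrite le_eqVlt; apply/orP; left; apply/eqP.
apply: eq_integral => u; rewrite inE/= in_itv/= andbT => u0.
by rewrite pos_patchE u0 ger0_norm// mulr_ge0 ?sqr_ge0 ?(gamma_pdf_ge0 b0 norm_b).
Qed.

Definition pos_horner p : R -> R := horner p \_ `]0%R, +oo[.

Lemma measurable_pos_horner p : measurable_fun setT (pos_horner p).
Proof.
apply: measurable_pos_patch; apply: (@measurable_funS _ _ _ _ setT) => //.
by apply: continuous_measurable_fun; exact: continuous_horner.
Qed.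

Lemma Rintegral_pos_horner p : m.-integrable setT (EFin \o pos_horner p) /\
  \int[m]_u pos_horner p u = gamma_moment b 0 p / gamma_fun b.
Proof.
have [I E] := integral_poly_gamma_pdf b0 norm_b p.
have patchp u : u \in (`]0, +oo[%classic : set R) -> pos_horner p u = p.[u].
  by rewrite inE/= in_itv/= andbT /pos_horner pos_patchE => ->.
split.
  apply/(integrable_gamma_law (measurable_pos_horner p)).
  by apply: eq_integrable I => // u up; rewrite patchp.
rewrite /Rintegral integral_gamma_law; last exact: measurable_pos_horner.
by under eq_integral => u up do rewrite patchp//; rewrite E.
Qed.

Lemma pos_hornerM p q u : pos_horner p u * pos_horner q u = pos_horner (p * q) u.
Proof. by rewrite /pos_horner !pos_patchE hornerM; case: ifPn; rewrite ?mul0r. Qed.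

(** The cut to the half-line agrees with the extension by 0 of [field_integral], so these functions
    equal the patched [laguerre_e] at every point, not merely almost surely. *)
Definition laguerre_fun k : R -> R := pos_horner (laguerre_poly b k).

Lemma square_integrable_laguerre k : square_integrable m (laguerre_fun k).
Proof.
split; first exact: measurable_pos_horner.
have [I _] := Rintegral_pos_horner (laguerre_poly b k * laguerre_poly b k).
by apply: eq_integrable I => // u _; rewrite expr2 pos_hornerM.
Qed.

Lemma laguerre_orthonormal i j :
  \int[m]_u (laguerre_fun i u * laguerre_fun j u) = (i == j)%:R.
Proof.
under eq_Rintegral do rewrite pos_hornerM.
have [_ ->] := Rintegral_pos_horner (laguerre_poly b i * laguerre_poly b j).
case: (ltngtP i j) => [ij|ij|->].
- by rewrite (laguerre_poly_orthogonal b0 norm_b)// mul0r.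
- by rewrite [X in gamma_moment _ _ X]mulrC (laguerre_poly_orthogonal b0 norm_b)// mul0r.
- by rewrite (laguerre_poly_norm b0 norm_b) divff// gt_eqF ?(gamma_fun_gt0 b0 norm_b).
Qed.

Lemma laguerre_funE k u : 0 < u -> laguerre_fun k u = laguerre_e b k u.
Proof. by move=> u0; rewrite /laguerre_fun /pos_horner pos_patchE u0 laguerre_eE. Qed.

Lemma laguerre_fun_le0 k u : u <= 0 -> laguerre_fun k u = 0.
Proof. by move=> u0; rewrite /laguerre_fun /pos_horner pos_patchE ltNge u0. Qed.

Lemma laguerre_fun0 u : 0 < u -> laguerre_fun 0 u = 1.
Proof.
move=> u0; rewrite /laguerre_fun /pos_horner pos_patchE u0.
by rewrite (laguerre_poly0 b0 norm_b) hornerE.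
Qed.

Lemma laguerre_coefE (F : R -> R) k : measurable_fun (`]0%R, +oo[ : set R) F ->
  laguerre_coef b F k = \int[m]_u ((F \_ `]0%R, +oo[) u * laguerre_fun k u).
Proof.
move=> mF; rewrite /laguerre_coef /Rintegral; congr fine.
rewrite integral_gamma_law; last first.
  by apply: measurable_funM; [exact: measurable_pos_patch|exact: measurable_pos_horner].
apply: eq_integral => u; rewrite inE/= in_itv/= andbT => u0.
by rewrite pos_patchE u0 laguerre_funE.
Qed.

Local Notation M := (m \x m)%E.

Lemma gamma_law2_density A : measurable A ->
  M A = (\int[(leb \x leb)]_(z in A) (gamma_pdf0 z.1 * gamma_pdf0 z.2)%:E)%E.
Proof.
move=> mA; transitivity (\int[m]_x (m \o xsection A) x)%E; first by [].
have mpdf := measurable_gamma_pdf0.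
rewrite (@ge0_integral_density R _ (measurableTypeR R) leb m _ mpdf gamma_pdf0_ge0 gamma_law_density)//; last first.
  exact: measurable_fun_xsection.
rewrite [RHS]integral_mkcond fubini_tonelli1; last 2 first.
- apply/(measurable_restrictT (fun z : R * R => (gamma_pdf0 z.1 * gamma_pdf0 z.2)%:E)) => //.
  apply: measurable_funTS; apply/measurable_EFinP; apply: measurable_funM.
    exact: (measurableT_comp mpdf measurable_fst).
  exact: (measurableT_comp mpdf measurable_snd).
- move=> z; apply: erestrict_ge0 => y _.
  by rewrite lee_fin mulr_ge0 ?gamma_pdf0_ge0.
apply: eq_integral => x _; rewrite /fubini_F/= gamma_law_density; last exact: measurable_xsection.
rewrite integral_mkcond -ge0_integralZr//; last 3 first.
- apply/(measurable_restrictT (EFin \o gamma_pdf0)); first exact: measurable_xsection.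
  by apply: measurable_funTS; exact/measurable_EFinP.
- by move=> y _; apply: erestrict_ge0 => z _; rewrite lee_fin gamma_pdf0_ge0.
- by rewrite lee_fin gamma_pdf0_ge0.
apply: eq_integral => y _; rewrite !patchE mem_xsection; case: ifPn => _ /=.
  by rewrite -EFinM mulrC.
by rewrite mul0e.
Qed.

Definition laguerre2 k (z : R * R) : R := laguerre_fun k z.1 * laguerre_fun k z.2.

Lemma square_integrable_tensor (f : R -> R) : square_integrable m f ->
  square_integrable M (fun z => f z.1 * f z.2) /\
  \int[M]_z ((f z.1 * f z.2) ^+ 2) = (\int[m]_u (f u ^+ 2)) ^+ 2.
Proof.
move=> [mf If]; have [I E] := Rintegral_tensor If If.
split; last first.
  by rewrite [RHS]expr2 -E; apply: eq_Rintegral => z _; rewrite exprMn.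
split; last by apply: eq_integrable I => // z _; rewrite exprMn.
apply: measurable_funM.
  exact: (measurableT_comp mf measurable_fst).
exact: (measurableT_comp mf measurable_snd).
Qed.

Lemma laguerre2_orthonormal i j :
  \int[M]_z (laguerre2 i z * laguerre2 j z) = (i == j)%:R.
Proof.
have I := square_integrable_mul (square_integrable_laguerre i) (square_integrable_laguerre j).
have [_ E] := Rintegral_tensor I I.
rewrite laguerre_orthonormal in E.
have -> : (i == j)%:R = (i == j)%:R * (i == j)%:R :> R by case: (i == j); rewrite ?mulr1 ?mulr0.
by rewrite -E; apply: eq_Rintegral => z _; rewrite /laguerre2 mulrACA.
Qed.

Lemma sum_geometric_le r n k : 0 <= r < 1 -> (n <= k)%N ->
  \sum_(n <= i < k) r ^+ i <= r ^+ n / (1 - r).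
Proof.
move=> /andP[r0 r1] nk; rewrite ler_pdivlMr ?subr_gt0//.
have E : (\sum_(n <= i < k) r ^+ i) * (1 - r) = r ^+ n - r ^+ k.
  elim: k nk => [|k IH]; first by rewrite leqn0 => /eqP ->; rewrite big_geq// mul0r subrr.
  rewrite leq_eqVlt => /predU1P[->|nk]; first by rewrite big_geq// mul0r subrr.
  by rewrite big_nat_recr//= mulrDl IH// exprS; ring.
by rewrite E gerBl exprn_ge0.
Qed.

(** * Covariance bound from the bilinear expansion *)

Section covariance_bound.
Variables (r : R) (p : R -> R -> R)
  (m2 : {measure set (measurableTypeR R * measurableTypeR R) -> \bar R}).
Hypothesis r1 : `|r| < 1.
Hypothesis pE : gamma_bivariate_pdf b r p.
Hypothesis m2E : forall A : set (measurableTypeR R * measurableTypeR R), measurable A ->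
  m2 A = (\int[leb \x leb]_(z in A `&` (`]0%R, +oo[ `*` `]0%R, +oo[)) (p z.1 z.2)%:E)%E.

(** Density of the bivariate law with respect to the product of its marginals. *)
Definition laguerre_kernel (z : R * R) : R :=
  if (0 < z.1) && (0 < z.2) then
    p z.1 z.2 / (gamma_pdf b z.1 * gamma_pdf b z.2)
  else 0.

Lemma cvg_laguerre_kernel z :
  partial_sum laguerre2 (fun i => r ^+ i) n z @[n --> \oo] --> laguerre_kernel z.
Proof.
rewrite /laguerre_kernel; case: ifPn => [/andP[z1 z2]|nz]; last first.
  rewrite [X in X @ _ --> _](_ : _ = fun=> 0); first exact: cvg_cst.
  apply/funext => n; apply: big1 => i _.
  move: nz; rewrite negb_and -!leNgt /laguerre2 => /orP[] /laguerre_fun_le0 ->.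
    by rewrite mul0r mulr0.
  by rewrite !mulr0.
have g1 := gamma_pdf_gt0 b0 norm_b z1; have g2 := gamma_pdf_gt0 b0 norm_b z2.
(* The leading 1 of the bilinear expansion is the term of index 0, as e_0 is 1 on the half-line;
   hence the shift of the index by one. *)
rewrite -(cvg_shiftS (fun n => partial_sum laguerre2 (fun i => r ^+ i) n z))/=.
have g0 : gamma_pdf b z.1 * gamma_pdf b z.2 != 0 by rewrite mulf_neq0 ?gt_eqF.
have H := pE z1 z2.
have /cvgM := H; move=> /(_ _ _ (@cvg_cst _ (gamma_pdf b z.1 * gamma_pdf b z.2)^-1 _ \oo _)).
apply: cvg_trans; apply: near_eq_cvg; near=> n.
rewrite /= mulrAC divff// mul1r /partial_sum -(big_mkord xpredT (fun i => r ^+ i * laguerre2 i z)).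
rewrite [RHS]big_ltn// expr0 mul1r /laguerre2 !laguerre_fun0// mulr1; congr (1 + _).
by apply: eq_bigr => i _; rewrite !laguerre_funE// mulrA.
Unshelve. all: by end_near. Qed.

Variables (G : R -> R) (k : nat).
Hypothesis L2G : square_integrable m G.
Hypothesis coef0 : forall j, (j <= k)%N -> \int[m]_u (G u * laguerre_fun j u) = 0.

Let square_integrable_laguerre2 i : square_integrable M (laguerre2 i).
Proof. by have [] := square_integrable_tensor (square_integrable_laguerre i). Qed.

Let r2 : 0 <= r ^+ 2 < 1.
Proof. by rewrite sqr_ge0 -real_normK ?num_real// expr_lt1. Qed.

(** The squared coefficients form a geometric series of ratio r^2 < 1, which is what makes the
    kernel square integrable. *)
Let tail n k' : (n <= k')%N ->
  \sum_(n <= i < k') (r ^+ i) ^+ 2 <= (r ^+ 2) ^+ n / (1 - r ^+ 2).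
Proof.
move=> nk; under eq_bigr do rewrite exprAC.
exact: sum_geometric_le.
Qed.

Let tail0 : (r ^+ 2) ^+ n / (1 - r ^+ 2) @[n --> \oo] --> 0.
Proof.
rewrite -[X in _ --> X](mul0r ((1 - r ^+ 2)^-1)); apply: cvgM; last exact: cvg_cst.
by apply: cvg_expr; have /andP[? ?] := r2; rewrite ger0_norm.
Qed.

Let square_integrable_kernel : square_integrable M laguerre_kernel.
Proof.
exact: (square_integrable_limit square_integrable_laguerre2 laguerre2_orthonormal
  tail cvg_laguerre_kernel).
Qed.

(** Against a partial sum of the kernel, the tensor square of G gives the sum of r^i c_i^2, where
    c_i are the Laguerre coefficients of G. Those up to k vanish, the others bring a factor at most
    |r|^(k+1), and Bessel's inequality bounds the rest uniformly in n. *)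
Lemma kernel_bound :
  `|\int[M]_z (G z.1 * G z.2 * laguerre_kernel z)| <= `|r| ^+ k.+1 * \int[m]_u (G u ^+ 2).
Proof.
have [L2GG _] := square_integrable_tensor L2G.
apply: (Rintegral_limit_le square_integrable_laguerre2 laguerre2_orthonormal
  tail tail0 cvg_laguerre_kernel L2GG) => n.
rewrite Rintegral_partial_sum//.
pose c i := \int[m]_u (G u * laguerre_fun i u).
have cE i : \int[M]_z (G z.1 * G z.2 * laguerre2 i z) = c i ^+ 2.
  have I := square_integrable_mul L2G (square_integrable_laguerre i).
  have [_ E] := Rintegral_tensor I I.
  by rewrite expr2 -E; apply: eq_Rintegral => z _; rewrite /laguerre2 mulrACA.
apply: (le_trans (ler_norm_sum _ _ _)).
apply: (@le_trans _ _ (\sum_(i < n) `|r| ^+ k.+1 * c i ^+ 2)).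
  apply: ler_sum => i _; rewrite cE normrM (ger0_norm (sqr_ge0 _)) normrX.
  have [ik|ki] := leqP i k; first by rewrite /c coef0// expr0n !mulr0.
  apply: ler_wpM2r; first exact: sqr_ge0.
  by apply: ler_wiXn2l => //; exact: ltW.
rewrite -mulr_sumr ler_wpM2l ?exprn_ge0//.
exact: (Bessel square_integrable_laguerre laguerre_orthonormal n L2G).
Qed.

Lemma bivariate_covariance_bound :
  `|fine (\int[m2]_z (G z.1 * G z.2)%:E)%E| <= `|r| ^+ k.+1 * \int[m]_u (G u ^+ 2).
Proof.
have [[mGG _] _] := square_integrable_tensor L2G.
have [mK _] := square_integrable_kernel.
(* A measurable version of p: equal to it on the open quadrant and 0 elsewhere, its measurability
   being inherited from the limit of the series. *)
pose p0 z := laguerre_kernel z * (gamma_pdf0 z.1 * gamma_pdf0 z.2).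
have mpdf2 : measurable_fun setT (fun z : R * R => gamma_pdf0 z.1 * gamma_pdf0 z.2).
  apply: measurable_funM.
    exact: (measurableT_comp measurable_gamma_pdf0 measurable_fst).
  exact: (measurableT_comp measurable_gamma_pdf0 measurable_snd).
have mp0 : measurable_fun setT p0 by exact: measurable_funM.
have m2p0 A : measurable A -> m2 A = (\int[leb \x leb]_(z in A) (p0 z)%:E)%E.
  move=> mA; rewrite m2E// integral_mkcondr; apply: eq_integral => z _.
  rewrite restrict_EFin/=; congr (_%:E).
  rewrite patchE /p0 /laguerre_kernel /gamma_pdf0 !pos_patchE.
  have -> : (z \in `]0%R, +oo[ `*` `]0%R, +oo[) = (0 < z.1) && (0 < z.2).
    by apply/idP/idP; rewrite inE/= !in_itv/= !andbT => /andP.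
  case: ifPn => [/andP[z1 z2]|_]; last by rewrite mul0r.
  by rewrite z1 z2 divfK// mulf_neq0// gt_eqF ?(gamma_pdf_gt0 b0 norm_b).
rewrite (@integral_density R _ (measurableTypeR R * measurableTypeR R)%type (leb \x leb)%E m2 p0 mp0 m2p0 _ mGG).
have -> : (\int[leb \x leb]_z (G z.1 * G z.2 * p0 z)%:E =
    \int[leb \x leb]_z (G z.1 * G z.2 * laguerre_kernel z *
      (gamma_pdf0 z.1 * gamma_pdf0 z.2))%:E)%E.
  by apply: eq_integral => z _; rewrite /p0 mulrA.
have := kernel_bound; rewrite /Rintegral.
rewrite (@integral_density R _ (measurableTypeR R * measurableTypeR R)%type
  (leb \x leb)%E M _ mpdf2 gamma_law2_density)//.
exact: measurable_funM.
Qed.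

End covariance_bound.

End gamma_law.

(** * Slutsky's lemma *)

Section slutsky.
Context {R : realType}.
Implicit Types (f : R -> R) (x y K eps eta C : R).

(** Only x is confined to the segment while y may leave it, because [le_cutoff] has no bound on
    y. *)
Lemma heine_cantor f K eps : continuous f -> 0 < eps ->
  exists2 eta : R, 0 < eta & forall x y, `|x| <= K -> `|x - y| < eta -> `|f x - f y| <= eps.
Proof.
move=> cf eps0.
have /compact_near_coveringP cK := @segment_compact R (- K) K.
pose Q (eta : R) x := forall y, `|x - y| < eta -> `|f x - f y| <= eps.
have : \forall eta \near 0^'+, `[- K, K]%classic `<=` Q eta.
  apply: cK => x _.
  have e2 : 0 < eps / 2 by rewrite divr_gt0.
  have /cvgrPdist_lt /(_ _ e2) := cf x.
  move=> /nbhs_ballP[del /= del0 Hd].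
  have Hf z : `|x - z| < del -> `|f x - f z| < eps / 2 by move=> xz; apply: Hd.
  exists (ball x (del / 2), `]0, del / 2[%classic) => /=.
    split; first by apply: nbhsx_ballx; rewrite divr_gt0.
    by near=> e => /=; rewrite in_itv/=; apply/andP; split;
      [near: e; exact: nbhs_right_gt|near: e; apply: nbhs_right_lt; rewrite divr_gt0].
  move=> [x' eta]/= []; rewrite /ball/= in_itv/= => xx' /andP[eta0 etad] y x'y.
  have h1 : `|f x - f x'| < eps / 2 by apply: Hf; apply: (lt_trans xx'); lra.
  have h2 : `|f x - f y| < eps / 2.
    apply: Hf; have -> : x - y = (x - x') + (x' - y) by ring.
    rewrite (le_lt_trans (ler_normD _ _))// [ltRHS](splitr del) ltrD//.
    exact: lt_trans x'y etad.
  have -> : f x' - f y = (f x - f y) - (f x - f x') by ring.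
  by apply: (le_trans (ler_normB _ _)); rewrite [leRHS](splitr eps) addrC lerD// ltW.
move=> nQ.
have [eta [eta0 HQ]] : exists eta : R, 0 < eta /\ `[- K, K]%classic `<=` Q eta.
  apply: (@filter_ex _ 0^'+); near=> e; split; first by near: e; exact: nbhs_right_gt.
  by near: e.
exists eta => // x y xK; apply: HQ; rewrite /= in_itv/=; by rewrite -ler_norml.
Unshelve. all: by end_near. Qed.

(** A continuous substitute for the indicator of |x| > K: convergence in law applies to it and
    transfers the tightness of the limit to [X t]. *)
Definition cutoff K x : R := Num.min 1 (Num.max 0 (`|x| - K)).

Lemma cutoff_ge0 K x : 0 <= cutoff K x.
Proof. by rewrite /cutoff le_min ler01 le_max lexx. Qed.

Lemma cutoff_le1 K x : cutoff K x <= 1.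
Proof. by rewrite /cutoff ge_min lexx. Qed.

Lemma cutoff0 K x : `|x| <= K -> cutoff K x = 0.
Proof. by move=> xK; rewrite /cutoff max_l ?subr_le0// min_r. Qed.

Lemma cutoff1 K x : K + 1 <= `|x| -> cutoff K x = 1.
Proof. by move=> xK; rewrite /cutoff min_l// le_max lerBrDl xK orbT. Qed.

Lemma continuous_cutoff K : continuous (cutoff K).
Proof.
move=> x; apply: (@continuous_min R R (cst 1) (cst 0 \max (fun y => `|y| - K))).
  exact: cst_continuous.
apply: (@continuous_max R R (cst 0) (fun y => `|y| - K)); first exact: cst_continuous.
by apply: continuousB; [exact: norm_continuous|exact: cst_continuous].
Qed.

Section integrals.
Context {d} {T : measurableType d} (P : probability T R).

Lemma bounded_comp_integrable f (X : T -> R) C : continuous f ->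
  (forall x, `|f x| <= C) -> measurable_fun setT X ->
  P.-integrable setT (EFin \o (f \o X)).
Proof.
move=> cf fC mX.
have mf : measurable_fun setT (f \o X).
  by apply: measurableT_comp => //; exact: continuous_measurable_fun.
apply: (@le_integrable _ _ _ P _ measurableT _ (EFin \o cst C)) => //.
  exact/measurable_EFinP.
  by move=> x _ /=; rewrite lee_fin (le_trans (fC _))// ler_norm.
exact: finite_measure_integrable_cst.
Qed.

End integrals.

Lemma cvg_integral_cutoff (mu : probability (measurableTypeR R) R) :
  \int[mu]_x cutoff n%:R x @[n --> \oo] --> 0.
Proof.
have mc n : measurable_fun setT (cutoff n%:R).
  by apply: continuous_measurable_fun; exact: continuous_cutoff.
have H2 : (\int[mu]_x (cutoff n%:R x)%:E)%E @[n --> \oo] --> 0%E.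
  have [||_ _] := @dominated_convergence _ (measurableTypeR R) R mu setT measurableT
    (fun n x => (cutoff n%:R x)%:E) (cst 0%E) (EFin \o cst 1)
    (fun n => (measurable_EFinP _ _).2 (mc n)) (measurable_cst _) _
    (@finite_measure_integrable_cst _ _ _ mu setT 1 measurableT) _.
  - apply: aeW => x _; apply: cvg_near_cst; exists (Num.truncn `|x|).+1 => // n /= xn.
    by rewrite cutoff0// ltW// (lt_le_trans (truncnS_gt _))// ler_nat.
  - by apply: aeW => x n _; rewrite gee0_abs ?lee_fin ?cutoff_le1 ?cutoff_ge0.
  - by rewrite integral_cst// mul0e.
exact: (fine_cvg H2).
Qed.

(** Each term covers one case: uniform continuity when x is bounded and y close to it, the cutoff,
    equal to 1, when |x| > K + 1, and Chebyshev's trick, (x - y)^2 / eta^2 >= 1, when y is at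
    distance at least eta. *)
Lemma le_cutoff f C K eps eta x y : 0 < eta -> 0 <= eps ->
  (forall u, `|f u| <= C) ->
  (forall u v, `|u| <= K + 1 -> `|u - v| < eta -> `|f u - f v| <= eps) ->
  `|f y - f x| <= eps + 2 * C * cutoff K x + 2 * C / eta ^+ 2 * (x - y) ^+ 2.
Proof.
move=> eta0 eps0 fC fU.
have C0 : 0 <= C by apply: le_trans (fC 0); exact: normr_ge0.
have fyx : `|f y - f x| <= 2 * C.
  by rewrite (le_trans (ler_normB _ _))// mulr_natl mulr2n lerD.
have t1 : 0 <= 2 * C * cutoff K x by rewrite !mulr_ge0 ?cutoff_ge0.
have t2 : 0 <= 2 * C / eta ^+ 2 * (x - y) ^+ 2.
  by apply: mulr_ge0 (sqr_ge0 _); apply: divr_ge0 (sqr_ge0 _); exact: mulr_ge0.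
have [xK|xK] := leP `|x| (K + 1); last first.
  rewrite (cutoff1 (ltW xK)) mulr1; apply: (le_trans fyx).
  by rewrite addrAC lerDr addr_ge0.
have [xy|xy] := ltP `|x - y| eta.
  by have := fU x y xK xy; rewrite distrC; lra.
have : 2 * C <= 2 * C / eta ^+ 2 * (x - y) ^+ 2; last lra.
rewrite -mulrA ler_peMr ?mulr_ge0// ler_pdivlMl ?exprn_gt0// mulr1.
have := ltW eta0; move: xy; rewrite -[X in _ -> _ -> _ <= X]real_normK ?num_real//.
by set a := `|_|; nra.
Qed.

Section cvg_in_law.
Context {d} {T : measurableType d} (P : probability T R).
Variables (X Y : R -> T -> R) (mu : probability (measurableTypeR R) R).

Lemma slutsky :
  (\forall t \near +oo, measurable_fun setT (Y t)) ->
  (forall eps, 0 < eps -> \forall t \near +oo,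
    (\int[P]_w ((X t w - Y t w) ^+ 2)%:E <= eps%:E)%E) ->
  cvg_in_law P X mu -> cvg_in_law P Y mu.
Proof.
move=> mY XY [mX cX]; split=> // f cf bf.
have [C0 [_ fC0]] := bf.
pose C : R := `|C0| + 1.
have fC u : `|f u| <= C.
  by apply: fC0 => //; rewrite /C (le_lt_trans (ler_norm C0))// ltrDl.
have C1 : 1 <= C by rewrite /C lerDr.
have fin (g : R -> R) (Z : T -> R) (c : R) : continuous g -> (forall u, `|g u| <= c) -> measurable_fun setT Z ->
    ('E_P[g \o Z] = (\int[P]_w g (Z w))%:E)%E.
  move=> cg gc mZ; rewrite unlock /Rintegral fineK//.
  exact: (integrable_fin_num measurableT (bounded_comp_integrable P cg gc mZ)).
have finmu (g : R -> R) (c : R) : continuous g -> (forall u, `|g u| <= c) ->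
    (\int[mu]_x (g x)%:E = (\int[mu]_x g x)%:E)%E.
  move=> cg gc; rewrite /Rintegral fineK//.
  have mid : measurable_fun setT (@id (measurableTypeR R)) by exact: measurable_id.
  exact: (integrable_fin_num measurableT (bounded_comp_integrable mu cg gc mid)).
have law (g : R -> R) (c : R) : continuous g -> (forall u, `|g u| <= c) -> forall eps : R, 0 < eps ->
    \forall t \near +oo, `|\int[mu]_x g x - \int[P]_w g (X t w)| <= eps.
  move=> cg gc eps eps0.
  have bg : bounded_fun g.
    by exists c; split=> [|M cM x _]; [exact: num_real|exact: le_trans (gc x) (ltW cM)].
  have := cX g cg bg; rewrite (finmu g c)// => /fine_cvgP[_ /cvgrPdist_le /(_ _ eps0)].
  apply: filterS2 mX => t mXt /=; by rewrite (fin g _ c).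
rewrite (finmu f C)//; apply/fine_cvgP; split.
  by apply: filterS mY => t mYt; rewrite (fin f _ C).
apply/cvgrPdist_le => eps eps0.
(* The final estimate collects 5 e: one from the convergence in law of f, one from uniform
   continuity, two from the cutoff and one from the mean-square distance. *)
pose e := eps / 6.
have e0 : 0 < e by rewrite divr_gt0.
have [K muK] : exists K : nat, \int[mu]_x cutoff K%:R x <= e / (2 * C).
  have eC0 : 0 < e / (2 * C) by rewrite divr_gt0// mulr_gt0// (lt_le_trans ltr01).
  have /cvgrPdist_le /(_ _ eC0)[K _ HK] := cvg_integral_cutoff mu.
  by exists K; have := HK K (leqnn _); rewrite sub0r normrN; apply: le_trans; exact: ler_norm.
have [eta eta0 Heta] := heine_cantor (K%:R + 1) cf e0.
have C0' : 0 < C by rewrite (lt_le_trans ltr01).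
have eC : 0 < e / (2 * C) by rewrite divr_gt0// mulr_gt0.
have eE : 0 < e * (2 * C / eta ^+ 2)^-1.
  by rewrite mulr_gt0// invr_gt0 divr_gt0 ?exprn_gt0// mulr_gt0.
have cut1 u : `|cutoff K%:R u| <= 1 by rewrite ger0_norm ?cutoff_ge0// cutoff_le1.
have lawf := law f C cf fC e e0.
have lawc := law (cutoff K%:R) 1 (@continuous_cutoff K%:R) cut1 _ eC.
have XYt := XY _ eE.
near=> t.
have mXt : measurable_fun setT (X t) by near: t.
have mYt : measurable_fun setT (Y t) by near: t.
rewrite /= (fin f _ C)//=.
have h1 : `|\int[mu]_x f x - \int[P]_w f (X t w)| <= e by near: t.
have h2 : `|\int[mu]_x cutoff K%:R x - \int[P]_w cutoff K%:R (X t w)| <= e / (2 * C) by near: t.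
have h3 : (\int[P]_w ((X t w - Y t w) ^+ 2)%:E <= (e * (2 * C / eta ^+ 2)^-1)%:E)%E by near: t.
have IX := bounded_comp_integrable P cf fC mXt.
have IY := bounded_comp_integrable P cf fC mYt.
have Ic := bounded_comp_integrable P (@continuous_cutoff K%:R) cut1 mXt.
have ID : P.-integrable setT (fun w => ((X t w - Y t w) ^+ 2)%:E).
  apply/integrableP; split.
    by apply/measurable_EFinP; apply: measurable_funX; exact: measurable_funB.
  under eq_integral do rewrite gee0_abs ?lee_fin ?sqr_ge0//.
  exact: le_lt_trans h3 (ltry _).
have h3' : \int[P]_w ((X t w - Y t w) ^+ 2) <= e * (2 * C / eta ^+ 2)^-1.
  by rewrite -lee_fin /Rintegral fineK//; exact: integrable_fin_num.
have key : `|\int[P]_w f (Y t w) - \int[P]_w f (X t w)| <=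
    e + 2 * C * \int[P]_w cutoff K%:R (X t w) +
    2 * C / eta ^+ 2 * \int[P]_w ((X t w - Y t w) ^+ 2).
  rewrite -RintegralB//; apply: (le_trans (le_normr_Rintegral _ _)) => //.
    exact: (integrableB measurableT IY IX).
  have Ie : P.-integrable setT (EFin \o cst e) by exact: finite_measure_integrable_cst.
  have Ic' : P.-integrable setT (EFin \o (fun w => 2 * C * cutoff K%:R (X t w))).
    exact: (integrableZl measurableT (2 * C) Ic).
  have ID' : P.-integrable setT (EFin \o (fun w => 2 * C / eta ^+ 2 * (X t w - Y t w) ^+ 2)).
    exact: (integrableZl measurableT (2 * C / eta ^+ 2) ID).
  have {1}-> : e = \int[P]_w (cst e w).
    by rewrite Rintegral_cst//= probability_setT mulr1.
  rewrite -[2 * C * _]RintegralZl// -[2 * C / eta ^+ 2 * _]RintegralZl//.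
  rewrite -RintegralD//; rewrite -RintegralD//; last first.
    exact: (integrableD measurableT Ie Ic').
  apply: le_Rintegral => //.
  - exact: (integrable_abse (integrableB measurableT IY IX)).
  - exact: (integrableD measurableT (integrableD measurableT Ie Ic') ID').
  - by move=> w _; apply: le_cutoff => //; exact: ltW.
have -> : \int[mu]_x f x - \int[P]_w f (Y t w) =
  (\int[mu]_x f x - \int[P]_w f (X t w)) - (\int[P]_w f (Y t w) - \int[P]_w f (X t w)) by ring.
apply: (le_trans (ler_normB _ _)).
have h4 : 2 * C * \int[P]_w cutoff K%:R (X t w) <= 2 * e.
  have -> : 2 * e = 2 * C * (e / (2 * C) + e / (2 * C)).
    by field; rewrite gt_eqF.
  rewrite ler_pM2l ?mulr_gt0//.
  have := ler_norm (\int[P]_w cutoff K%:R (X t w) - \int[mu]_x cutoff K%:R x).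
  rewrite distrC; lra.
have h5 : 2 * C / eta ^+ 2 * \int[P]_w ((X t w - Y t w) ^+ 2) <= e.
  rewrite -ler_pdivlMl ?divr_gt0 ?mulr_gt0 ?exprn_gt0//.
  by rewrite mulrC.
have : e * 6 = eps by rewrite /e divfK.
lra.
Unshelve. all: by end_near. Qed.

End cvg_in_law.

End slutsky.

(** * Regularly varying functions *)

Section regular_variation.
Context {R : realType}.
Implicit Types (t c q M eps : R).

Lemma powR2_gt1 c : 0 < c -> 1 < 2 `^ c :> R.
Proof.
move=> c0; have E : 1 `^ c = 1 :> R by rewrite powR1.
by rewrite -[ltLHS]E; apply: gt0_ltr_powR; rewrite ?nnegrE// ltr1n.
Qed.

Lemma near_pinfty_ex (Q : R -> Prop) :
  (\forall t \near +oo, Q t) -> exists2 M, 0 < M & forall t, M <= t -> Q t.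
Proof.
move=> [M [_ HM]]; exists (`|M| + 1); first by rewrite ltr_wpDl.
by move=> t Mt; apply: HM; rewrite (lt_le_trans _ Mt)// (le_lt_trans (ler_norm M))// ltrDl.
Qed.

(* If [e] tends to 0, the recursion forces [u] to tend to 0 along each sequence
   [2^n s], uniformly for [s] in a dyadic interval. *)
Lemma dyadic_decay (I : Type) (u : I -> R -> R) (q : R) (e : R -> R) (M : R) :
  0 <= q < 1 -> 0 < M -> e t @[t --> +oo] --> 0 ->
  (forall x t, M <= t -> u x (2 * t) <= q * u x t + e t) ->
  (forall N, exists B, forall x t, M <= t <= N -> u x t <= B) ->
  forall eps, 0 < eps -> exists2 T, 0 < T & forall t, T <= t -> forall x, u x t <= eps.
Proof.
move=> /andP[q0 q1] M0 e0 rec loc eps eps0.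
(* Chosen so that q * (eps / 2) + eps' = eps / 2: the level eps / 2 is stationary for the
   recursion. *)
pose eps' := eps * (1 - q) / 2.
have eps'0 : 0 < eps' by rewrite /eps' divr_gt0// mulr_gt0// subr_gt0.
have /near_pinfty_ex[M1 M10 HM1] : \forall t \near +oo, e t <= eps'.
  have /cvgrPdist_le/(_ _ eps'0) := e0.
  by apply: filterS => t; rewrite sub0r normrN; apply: le_trans; exact: ler_norm.
pose M2 := Num.max M M1.
have MM2 : M <= M2 by rewrite /M2 le_max lexx.
have M1M2 : M1 <= M2 by rewrite /M2 le_max lexx orbT.
have M20 : 0 < M2 by exact: lt_le_trans MM2.
have [B0 HB0] := loc (2 * M2).
pose B := `|B0|.
have M2p n : M2 <= 2 ^+ n * M2 by rewrite ler_peMl ?(ltW M20)// exprn_ege1// ler1n.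
(* On the n-th dyadic interval the initial bound B has been contracted n times, while the
   accumulated errors never exceed eps / 2. *)
have step n : forall x t, 2 ^+ n * M2 <= t <= 2 ^+ n.+1 * M2 -> u x t <= q ^+ n * B + eps / 2.
  elim: n => [|n IH] x t /andP[t1 t2].
    rewrite expr0 mul1r in t1 *; rewrite mul1r.
    have : u x t <= B0 by apply: HB0; rewrite (le_trans MM2).
    have := ler_norm B0; rewrite -/B; lra.
  have tE : t = 2 * (t / 2) by field.
  rewrite tE; apply: (le_trans (rec _ _ _)).
    rewrite ler_pdivlMr// (le_trans _ t1)// exprS mulrC -mulrA ler_pM2l//.
    exact: le_trans MM2 (M2p n).
  have h1 : u x (t / 2) <= q ^+ n * B + eps / 2.
    by apply: IH; rewrite ler_pdivlMr// ler_pdivrMr// ![_ * M2 * 2]mulrAC -!exprSr t1.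
  have h2 : e (t / 2) <= eps'.
    apply: HM1; rewrite ler_pdivlMr// (le_trans _ t1)// exprS mulrC -mulrA ler_pM2l//.
    exact: le_trans M1M2 (M2p n).
  apply: (le_trans (lerD (ler_wpM2l q0 h1) h2)).
  by rewrite exprS /eps' le_eqVlt; apply/orP; left; apply/eqP; field.
have [n Hn] : exists n, q ^+ n * B <= eps / 2.
  have c : q ^+ n * B @[n --> \oo] --> 0.
    rewrite -(mul0r B); apply: cvgM; last exact: cvg_cst.
    by apply: cvg_expr; rewrite ger0_norm.
  have e2 : 0 < eps / 2 by rewrite divr_gt0.
  have /cvgrPdist_le/(_ _ e2)[n _ Hn] := c.
  by exists n; have := Hn n (leqnn n); rewrite sub0r normrN; apply: le_trans; exact: ler_norm.
pose T := 2 ^+ n * M2.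
have T0 : 0 < T by rewrite mulr_gt0// exprn_gt0.
have M2T : M2 <= T by exact: M2p.
(* Once u is below eps on the whole interval [T, 2T], the recursion keeps it there at each further
   doubling. *)
have inv m : forall x t, T <= t <= 2 ^+ m.+1 * T -> u x t <= eps.
  elim: m => [|m IH] x t /andP[t1 t2].
    have := step n x t; rewrite t1 exprS -mulrA -/T t2 => /(_ isT); lra.
  have [t3|t3] := leP t (2 ^+ m.+1 * T); first by apply: IH; rewrite t1.
  have T2t : T <= t / 2.
    rewrite ler_pdivlMr// (le_trans _ (ltW t3))// exprS mulrC -mulrA ler_pM2l//.
    by rewrite ler_peMl ?(ltW T0)// exprn_ege1// ler1n.
  have tE : t = 2 * (t / 2) by field.
  rewrite tE; apply: (le_trans (rec _ _ _)).
    by rewrite (le_trans MM2)// (le_trans M2T).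
  have h1 : u x (t / 2) <= eps.
    apply: IH; rewrite T2t/= ler_pdivrMr// mulrAC -exprSr//.
  have h2 : e (t / 2) <= eps' by apply: HM1; rewrite (le_trans M1M2)// (le_trans M2T).
  apply: (le_trans (lerD (ler_wpM2l q0 h1) h2)).
  have : 0 <= eps * (1 - q) by rewrite mulr_ge0 ?subr_ge0 ?ltW.
  by rewrite /eps'; lra.
exists T => // t Tt x; pose m := Num.truncn (t / T).
apply: (inv m); rewrite Tt/= -ler_pdivrMr//.
apply: (le_trans (ltW (truncnS_gt _))); rewrite -/m.
by rewrite -natrX ler_nat ltnW// ltn_expl.
Qed.

Variables (g : R -> R) (delta : R).
Hypothesis delta0 : 0 < delta.
Hypothesis cg : forall t, 0 < t -> {for t, continuous g}.
Hypothesis g_gt0 : \forall t \near +oo, 0 < g t.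
Hypothesis g_rv : forall c, 0 < c -> g (c * t) / g t @[t --> +oo] --> c `^ (- delta).

Lemma regularly_varying_le c K : 0 < c -> c `^ (- delta) < K ->
  \forall t \near +oo, g (c * t) <= K * g t.
Proof.
move=> c0 cK.
have /cvgrPdist_lt := g_rv c0.
have e0 : 0 < K - c `^ (- delta) by rewrite subr_gt0.
move=> /(_ _ e0); apply: filterS2 g_gt0 => t gt0.
rewrite distrC => /(le_lt_trans (ler_norm _)).
by rewrite ltrD2r ltr_pdivrMr// => /ltW.
Qed.

(** On the logarithmic scale the sets [A n] are closed by continuity of g and cover the line by
    regular variation at each c = e^s; by Baire's theorem one of them contains an interval, where
    the bound is uniform in s. *)
Lemma regularly_varying_baire : exists s0 r n, [/\ 0 < r &
  forall s t, `|s0 - s| < r -> n.+1%:R <= t -> g (expR s * t) <= n%:R * g t].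
Proof.
pose A n := [set s | forall t, n.+1%:R <= t -> g (expR s * t) <= n%:R * g t].
have cA n : closed (A n).
  have -> : A n = \bigcap_(t in [set t | n.+1%:R <= t])
      ((fun s => g (expR s * t)) @^-1` [set y | y <= n%:R * g t]).
    by apply/seteqP; split.
  apply: closed_bigI => t /= nt; apply: closed_comp; last exact: closed_le.
  have t0 : 0 < t by apply: lt_le_trans nt.
  move=> s _; apply: continuous_comp.
    by apply: cvgM; [exact: continuous_expR|exact: cvg_cst].
  by apply: cg; rewrite mulr_gt0 ?expR_gt0.
have covA s : exists n, A n s.
  have /near_pinfty_ex[M M0 HM] : \forall t \near +oo,
      g (expR s * t) <= ((expR s) `^ (- delta) + 1) * g t /\ 0 < g t.
    near=> t; split; last by near: t.
    by near: t; apply: regularly_varying_le; [exact: expR_gt0|rewrite ltrDl].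
  (* A single index must exceed both the threshold M and the multiplicative factor. *)
  pose n := Num.truncn (M + ((expR s) `^ (- delta) + 1)).
  have := truncnS_gt (M + ((expR s) `^ (- delta) + 1)); rewrite -/n => Hn.
  have pow0 : 0 <= (expR s) `^ (- delta) := powR_ge0 _ _.
  exists n.+1 => t nt.
  have n2 : n.+1%:R <= n.+2%:R :> R by rewrite ler_nat.
  have [H1 H2] := HM t ltac:(lra).
  by apply: (le_trans H1); rewrite ler_wpM2r ?ltW//; lra.
have [n nd] : exists n, ~ dense (~` A n).
  apply/not_existsP => nA.
  have : dense (\bigcap_n ~` A n).
    apply: Baire => n; split; first exact: closed_openC.
    by have := nA n; rewrite not_notE.
  move=> /(_ setT) []; [by exists 0|exact: openT|].
  by move=> s [_ Hs]; have [n An] := covA s; exact: (Hs n I).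
have [D [[s0 Ds0] [oD DA]]] : exists D : set R, D !=set0 /\ open D /\ D `<=` A n.
  apply: contrapT => H; apply: nd => D D0 oD; apply: contrapT => H2.
  apply: H; exists D; split => //; split => // s Ds; apply: contrapT => nAs.
  by apply: H2; exists s.
have /nbhs_ballP[r /= r0 Hr] : nbhs s0 D by exact: open_nbhs_nbhs.
exists s0, r, n; split=> // s t ss nt; exact: (DA s (Hr s ss)).
Unshelve. all: by end_near. Qed.

Lemma near_forall_lt (N : nat) (Q : nat -> R -> Prop) :
  (forall i, (i <= N)%N -> \forall t \near +oo, Q i t) ->
  \forall t \near +oo, forall i, (i <= N)%N -> Q i t.
Proof.
elim: N => [|N IH] H; first by apply: filterS (H 0%N isT) => t Qt i; rewrite leqn0 => /eqP ->.
have H1 := IH (fun i iN => H i (leqW iN)).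
apply: filterS2 H1 (H N.+1 (leqnn _)) => t h1 h2 i.
by rewrite leq_eqVlt => /predU1P[->//|]; rewrite ltnS; exact: h1.
Qed.

(* The upper half of the uniform convergence theorem for regular variation. *)
Lemma regularly_varying_uniform : exists2 C, 0 < C &
  \forall t \near +oo, forall s, t <= s <= 2 * t -> g s <= C * g t.
Proof.
have [s0 [r [n [r0 H]]]] := regularly_varying_baire.
(* Translates of the Baire interval cover [0, ln 2]: writing s = e^w t and taking i the integer part
   of w / r, the point w - v i is within r of s0. Only the N + 1 pointwise bounds at e^(v i) remain
   to be assumed of t. *)
pose N := Num.truncn (ln 2 / r).
pose v i := i%:R * r - s0.
(* As v i >= - |s0|, all the limits e^(- delta v i) lie below this one constant. *)
pose K := expR (delta * `|s0|) + 1.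
have K1 : 1 < K by rewrite /K ltrDr expR_gt0.
have vK i : expR (v i) `^ (- delta) < K.
  rewrite -expRM /K; apply: (@le_lt_trans _ _ (expR (delta * `|s0|))); last by rewrite ltrDl.
  rewrite ler_expR mulrN -mulNr mulrC ler_pM2l// /v opprB.
  have ir0 : 0 <= i%:R * r by rewrite mulr_ge0// ltW.
  by have := ler_norm s0; lra.
exists (n%:R * K + 1); first by rewrite ltr_wpDl// mulr_ge0// ltW// (lt_trans ltr01).
near=> t.
have gt0 : 0 < g t by near: t.
have t0 : 0 < t by near: t; exact: nbhs_pinfty_gt.
have tn : expR s0 * n.+1%:R <= t by near: t; apply: nbhs_pinfty_ge; exact: num_real.
have tv : forall i, (i <= N)%N -> g (expR (v i) * t) <= K * g t.
  near: t; apply: near_forall_lt => i _.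
  by apply: regularly_varying_le; [exact: expR_gt0|exact: vK].
move=> s /andP[ts s2t].
have st0 : 0 < s / t by rewrite divr_gt0// (lt_le_trans t0).
pose w := ln (s / t).
have w0 : 0 <= w by rewrite /w ln_ge0// ler_pdivlMr// mul1r.
have w2 : w <= ln 2 by rewrite /w ler_ln ?posrE// ler_pdivrMr.
pose i := Num.truncn (w / r).
have wr0 : 0 <= w / r by rewrite divr_ge0// ltW.
have iN : (i <= N)%N by apply: le_truncn; rewrite ler_pM2r ?invr_gt0.
have /andP[i1 i2] := truncn_itv wr0; rewrite -/i in i1 i2.
rewrite ler_pdivlMr// in i1; rewrite ltr_pdivrMr// -natr1 mulrDl mul1r in i2.
have sE : s = expR (w - v i) * (expR (v i) * t).
  by rewrite mulrA -expRD subrK /w lnK ?posrE// divfK// gt_eqF.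
have vt : n.+1%:R <= expR (v i) * t.
  apply: (@le_trans _ _ (expR (- s0) * t)).
    by rewrite expRN mulrC ler_pdivlMr ?expR_gt0// mulrC.
  by rewrite ler_pM2r// ler_expR /v lerDr mulr_ge0// ltW.
rewrite sE; apply: (le_trans (H _ _ _ vt)).
  rewrite /v; have -> : s0 - (w - (i%:R * r - s0)) = - (w - i%:R * r) by ring.
  by rewrite normrN ger0_norm ?subr_ge0// ltrBlDl.
apply: (@le_trans _ _ (n%:R * (K * g t))); first by rewrite ler_wpM2l// tv.
by rewrite mulrA ler_pM2r// lerDl.
Unshelve. all: by end_near. Qed.

(** Since g(2t) / g(t) tends to 2^(- delta) < 1, [dyadic_decay] applies with q midway between this
    limit and 1, no error term and a one-point index type. *)
Lemma regularly_varying_cvg0 : g t @[t --> +oo] --> 0.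
Proof.
have q1 : 2 `^ (- delta) < 1 :> R.
  by rewrite powRN invf_lt1 ?powR_gt0// powR2_gt1.
pose q := (2 `^ (- delta) + 1) / 2.
have q0 : 0 <= q < 1.
  by have := powR_ge0 2 (- delta); rewrite /q => ?; apply/andP; split; lra.
have q2 : 2 `^ (- delta) < q by rewrite /q; lra.
have /near_pinfty_ex[M M0 HM] := regularly_varying_le (@ltr0n R 2) q2.
have H : forall eps, 0 < eps -> exists2 T, 0 < T & forall t, T <= t -> forall x : unit, g t <= eps.
  apply: (@dyadic_decay unit (fun=> g) q (fun=> 0) M) => //.
  - exact: cvg_cst.
  - by move=> _ t Mt; rewrite addr0; exact: HM.
  - move=> N.
    have [MN|NM] := leP M N; last first.
      by exists 0 => _ t /andP[h1 h2]; have := lt_le_trans NM (le_trans h1 h2); rewrite ltxx.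
    have cgMN : {within `[M, N], continuous g}.
      by apply: continuous_in_subspaceT => t; rewrite inE/= in_itv/= => /andP[Mt _]; apply: cg; exact: lt_le_trans Mt.
    have [c _ Hc] := EVT_max MN cgMN.
    by exists (g c) => _ t tMN; apply: Hc.
apply/cvgrPdist_le => eps eps0.
have [T T0 HT] := H _ eps0.
near=> t; rewrite sub0r normrN ger0_norm; last by apply: ltW; near: t.
by apply: (HT _ _ tt); near: t; apply: nbhs_pinfty_ge; exact: num_real.
Unshelve. all: by end_near. Qed.

(** * Integrals over dyadic shells *)

Section shell_integrals.
Variables (d k : nat).
Hypothesis kdelta : k%:R * delta < d%:R.

(** The reference order of magnitude; it varies regularly with the positive index d - k delta. *)
Let Phi t := g t ^+ k * t ^+ d.

Let cvg_Phi c : 0 < c -> Phi (c * t) / Phi t @[t --> +oo] --> c `^ (d%:R - k%:R * delta).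
Proof.
move=> c0.
have -> : c `^ (d%:R - k%:R * delta) = (c `^ (- delta)) ^+ k * c ^+ d.
  rewrite powRD ?(gt_eqF c0) ?implybT// powR_mulrn ?(ltW c0)// mulrC; congr (_ * _).
  by rewrite -powR_mulrn ?powR_ge0// -powRrM mulNr [delta * _]mulrC.
have : (g (c * t) / g t) ^+ k * c ^+ d @[t --> +oo] --> (c `^ (- delta)) ^+ k * c ^+ d.
  apply: cvgM; last exact: cvg_cst.
  by apply: (@continuous_cvg _ _ _ _ _ _ (fun x : R => x ^+ k)); [exact: exprn_continuous|exact: g_rv].
apply: cvg_trans; apply: near_eq_cvg; near=> t.
have t0 : 0 < t by near: t; exact: nbhs_pinfty_gt.
have gt0 : 0 < g t by near: t.
rewrite /Phi !exprMn exprVn; field.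
by rewrite !expf_neq0// gt_eqF.
Unshelve. all: by end_near. Qed.

(* [J x t] stands for the integral of [min(1, |g|^(k+1))] over the ball of
   radius [t] around [x]. *)
Lemma shell_decay (I : Type) (J : I -> R -> R) :
  (forall x t, 0 <= J x t) ->
  (forall x t, 0 < t -> J x t <= (2 * t) ^+ d) ->
  (forall x t c, 0 < t -> 0 <= c -> (forall s, t <= s <= 2 * t -> `|g s| <= c) ->
    J x (2 * t) <= J x t + (4 * t) ^+ d * c ^+ k.+1) ->
  forall r eps, 0 < r -> 0 < eps ->
  \forall t \near +oo, forall x, J x (r * t) <= eps * (g t ^+ k * t ^+ d).
Proof.
move=> J0 Jball Jshell r eps r0 eps0.
have [C C0 HC] := regularly_varying_uniform.
(* Doubling t multiplies [Phi] by nearly p > 1, hence eventually by at least p', so J / Phi is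
   contracted by 1 / p'. The new shell contributes (4 t)^d (C g t)^(k+1), which relative to [Phi t]
   is a constant times g t and tends to 0. *)
pose p := 2 `^ (d%:R - k%:R * delta) : R.
have p1 : 1 < p by rewrite /p powR2_gt1// subr_gt0.
pose p' := (p + 1) / 2.
have p'1 : 1 < p' by rewrite /p'; lra.
have p'p : p' < p by rewrite /p'; lra.
have rec : \forall t \near +oo, [/\ 0 < g t, p' * Phi t <= Phi (2 * t) &
    forall s, t <= s <= 2 * t -> `|g s| <= C * g t].
  have /cvgrPdist_lt /(_ _ (_ : 0 < p - p')) H := cvg_Phi (@ltr0n R 2).
  have gs : \forall t \near +oo, forall s, t <= s -> 0 < g s.
    have /near_pinfty_ex[M M0 HM] := g_gt0.
    near=> t; move=> s ts; apply: HM; apply: le_trans ts; near: t.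
    by apply: nbhs_pinfty_ge; exact: num_real.
  near=> t.
  have t0 : 0 < t by near: t; exact: nbhs_pinfty_gt.
  have gst : forall s, t <= s -> 0 < g s by near: t.
  have gt0 : 0 < g t by exact: gst.
  split=> //.
  - have Phit : 0 < Phi t by rewrite mulr_gt0// exprn_gt0.
    rewrite -ler_pdivlMr//.
    have : `|p - Phi (2 * t) / Phi t| < p - p' by near: t; apply: H; rewrite subr_gt0.
    by move=> /(le_lt_trans (ler_norm _)); lra.
  - have : forall s, t <= s <= 2 * t -> g s <= C * g t by near: t.
    move=> Hs s sts; rewrite gtr0_norm; first exact: Hs.
    by apply: gst; case/andP : sts.
have /near_pinfty_ex[M M0 HM] := rec.
pose q := p'^-1.
have p'0 : 0 < p' by lra.
have q01 : 0 <= q < 1 by rewrite /q invr_ge0 (ltW p'0) invf_lt1.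
have PhiP t : M <= t -> 0 < Phi t.
  move=> Mt; have [gt0 _ _] := HM t Mt.
  by rewrite mulr_gt0// exprn_gt0//; exact: lt_le_trans Mt.
pose c1 : R := 4 ^+ d * C ^+ k.+1.
have c10 : 0 <= c1 by rewrite mulr_ge0 ?exprn_ge0 ?(ltW C0).
(* The decay is obtained at r t in terms of [Phi (r * t)]; the denominator absorbs the limit of Phi
   (r t) / Phi t, with a margin of 1. *)
pose eps1 := eps / (r `^ (d%:R - k%:R * delta) + 1).
have eps10 : 0 < eps1 by rewrite divr_gt0// ltr_wpDl ?powR_ge0.
have [T T0 HT] : exists2 T : R, 0 < T &
    forall t, T <= t -> forall x, J x t / Phi t <= eps1.
  move: eps1 eps10; apply: (@dyadic_decay I (fun x t => J x t / Phi t) q (fun t => c1 * g t) M q01 M0).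
  - rewrite -[X in _ --> X](mulr0 c1); apply: cvgM; first exact: cvg_cst.
    exact: regularly_varying_cvg0.
  - move=> x t Mt; have [gt0 Hp Hs] := HM t Mt.
    have t0 : 0 < t by exact: lt_le_trans Mt.
    have M2t : M <= 2 * t by rewrite (le_trans Mt)// ler_peMl ?(ltW t0)// ler1n.
    have Cg0 : 0 <= C * g t by rewrite mulr_ge0 ?ltW.
    have HJ := Jshell x t (C * g t) t0 Cg0 Hs.
    have P1 := PhiP _ Mt; have P2 := PhiP _ M2t.
    have E : (4 * t) ^+ d * (C * g t) ^+ k.+1 = c1 * g t * Phi t.
      by rewrite /c1 /Phi !exprMn !exprS; ring.
    have a0 : 0 <= J x t / Phi t + c1 * g t.
      by apply: addr_ge0; [apply: divr_ge0; [exact: J0|exact: ltW]|exact: mulr_ge0 c10 (ltW gt0)].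
    have qP : Phi t / Phi (2 * t) <= q.
      by rewrite ler_pdivrMr// /q -ler_pdivrMl ?invr_gt0 ?invrK//; lra.
    apply: (@le_trans _ _ ((J x t / Phi t + c1 * g t) * (Phi t / Phi (2 * t)))).
      rewrite [leRHS]mulrA ler_pM2r ?invr_gt0// [leRHS]mulrDl divfK ?(gt_eqF P1)//.
      by rewrite -E.
    apply: (le_trans (ler_wpM2l a0 qP)); rewrite mulrC mulrDr lerD2l.
    by rewrite ler_piMl ?(mulr_ge0 c10 (ltW gt0))//; case/andP : q01 => _ /ltW.
  (* On a bounded range J is at most the volume of a cube, and the continuous [Phi] is at least its
     positive minimum. *)
  - move=> N; have [MN|NM] := leP M N; last first.
      by exists 0 => x t /andP[h1 h2]; have := lt_le_trans NM (le_trans h1 h2); rewrite ltxx.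
    have cPhi (t : R) : 0 < t -> {for t, continuous Phi}.
      move=> t0; apply: continuousM; last exact: exprn_continuous.
      apply: (@continuous_comp _ _ _ g (fun x : R => x ^+ k)); first exact: cg.
      exact: exprn_continuous.
    have cMN : {within `[M, N], continuous Phi}.
      apply: continuous_in_subspaceT => t; rewrite inE/= in_itv/= => /andP[Mt _].
      by apply: cPhi; exact: lt_le_trans Mt.
    have [c cI Hc] := EVT_min MN cMN.
    have Pc : 0 < Phi c by apply: PhiP; move: cI; rewrite in_itv/= => /andP[].
    exists ((2 * N) ^+ d / Phi c) => x t /andP[Mt tN].
    have t0 : 0 < t by exact: lt_le_trans Mt.
    apply: ler_pM; rewrite ?J0 ?invr_ge0 ?(ltW (PhiP _ Mt))//.
      apply: (le_trans (Jball x t t0)); apply: lerXn2r.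
      - by rewrite nnegrE mulr_ge0 ?(ltW t0).
      - by rewrite nnegrE mulr_ge0// (le_trans (ltW t0)).
      - by rewrite ler_pM2l.
    rewrite lef_pV2 ?posrE ?Pc ?(PhiP _ Mt)//.
    by apply: Hc; rewrite in_itv/= Mt.
have H2 := cvg_Phi r0.
near=> t => x.
have t0 : 0 < t by near: t; exact: nbhs_pinfty_gt.
have Mt : M <= t by near: t; apply: nbhs_pinfty_ge; exact: num_real.
have Mrt : M / r <= t by near: t; apply: nbhs_pinfty_ge; exact: num_real.
have Trt : T / r <= t by near: t; apply: nbhs_pinfty_ge; exact: num_real.
rewrite ler_pdivrMr// mulrC in Mrt; rewrite ler_pdivrMr// mulrC in Trt.
have := HT _ Trt x; rewrite ler_pdivrMr ?PhiP// => /le_trans; apply.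
have : `|r `^ (d%:R - k%:R * delta) - Phi (r * t) / Phi t| < 1.
  by near: t; move/cvgrPdist_lt : H2; apply.
rewrite distrC => /(le_lt_trans (ler_norm _)).
rewrite ltrBlDl ltr_pdivrMr ?PhiP// => /ltW Hr.
apply: (@le_trans _ _ (eps1 * ((r `^ (d%:R - k%:R * delta) + 1) * Phi t))).
  by rewrite ler_pM2l.
rewrite mulrA /eps1 divfK// gt_eqF// ltr_wpDl ?powR_ge0//.
Unshelve. all: by end_near. Qed.

End shell_integrals.

End regular_variation.

(** * Geometry of the Lebesgue measure on row vectors *)

(** Packs the scaled image as a bundled measure, the form to which the uniqueness theorems for
    Lebesgue and product measures apply. *)
Lemma scaled_pushforward {d1 d2} {T1 : measurableType d1} {T2 : measurableType d2}
    {R : realType} (c : {nonneg R}) (m : {measure set T1 -> \bar R}) (f : T1 -> T2) :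
  measurable_fun setT f -> exists nu : {measure set T2 -> \bar R},
    forall A, nu A = (c%:num%:E * m (f @^-1` A))%E.
Proof.
move=> mf.
have [m' m'E] : exists m' : {measure set T2 -> \bar R}, m' = pushforward m f :> (_ -> _).
  by eexists; reflexivity.
by exists (mscale c m') => A; rewrite -[m (f @^-1` A)]/(pushforward m f A) -m'E.
Unshelve. all: exact: mf.
Qed.

Section lebesgue_scaling.
Context {R : realType}.
Implicit Types (t : R).

Local Notation leb := (@lebesgue_measure R).

(** The image of Lebesgue measure under the dilation, renormalized by 1 / t, agrees with it on
    half-open intervals, hence everywhere by uniqueness. *)
Lemma lebesgue_measure_scale t (A : set (measurableTypeR R)) : 0 < t -> measurable A ->
  leb ((fun x => t^-1 * x) @^-1` A) = (t%:E * leb A)%E.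
Proof.
move=> t0 mA.
have ti0 : 0 <= t^-1 by rewrite invr_ge0 ltW.
have mS : measurable_fun setT ((fun x => t^-1 * x) : measurableTypeR R -> measurableTypeR R).
  exact: measurable_funM.
have [nu nuE] := scaled_pushforward (NngNum ti0) leb mS.
have /(_ _ A mA) -> := @lebesgue_measure_unique R nu.
  by rewrite nuE muleA -EFinM mulfV ?gt_eqF// mul1e.
move=> _ [[a b] _ <-] /=; rewrite nuE.
have -> : (fun x => t^-1 * x) @^-1` `]a, b] = `]t * a, t * b]%classic.
  apply/seteqP; split=> x /=; rewrite !in_itv/= ltr_pdivlMl// ler_pdivrMl//.
have L (x y : R) : leb `]x, y] = (Num.max 0 (y - x))%:E.
  rewrite lebesgue_measure_itv/= lte_fin; case: ltP => xy.
    by rewrite max_r ?subr_ge0 ?(ltW xy)// EFinB.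
  by rewrite max_l// subr_le0.
transitivity ((NngNum ti0)%:num%:E * (Num.max 0 (t * b - t * a))%:E)%E; last first.
  by congr (_ * _)%E; rewrite -L.
rewrite L -EFinM; congr (_%:E); rewrite /= -mulrBr -[X in Num.max X (t * _)](mulr0 t) -maxr_pMr ?(ltW t0)//.
by rewrite mulrA mulVf ?gt_eqF// mul1r.
Qed.

Lemma measurable_rV_scale n t : measurable_fun setT (fun v : 'rV[R]_n => t *: v).
Proof.
apply: measurable_fun_rV => i; under eq_fun do rewrite mxE.
by apply: measurable_funM => //; exact: measurable_rV_coord.
Qed.

(** Induction along [rV_cons]: the renormalized image of the product measure has the right value on
    rectangles, by the one-dimensional case and the induction hypothesis, so uniqueness of product
    measures concludes. *)
Lemma lebesgue_rV_scale n t (A : set 'rV[R]_n) : 0 < t -> measurable A ->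
  lebesgue_rV n ((fun v => t^-1 *: v) @^-1` A) = ((t ^+ n)%:E * lebesgue_rV n A)%E.
Proof.
move=> t0; elim: n A => [|n IH] A mA.
  rewrite expr0 mul1e; congr (dirac _ _).
  by apply/seteqP; split=> v; rewrite /= (thinmx0 v) scaler0.
pose S (z : measurableTypeR R * 'rV[R]_n) : measurableTypeR R * 'rV[R]_n := (t^-1 * z.1, t^-1 *: z.2).
have mS : measurable_fun setT S.
  apply: measurable_fun_pair.
    by apply: measurable_funM => //; exact: measurable_fst.
  by apply: measurableT_comp; [exact: measurable_rV_scale|exact: measurable_snd].
have mS1 : measurable_fun setT ((fun x => t^-1 * x) : measurableTypeR R -> measurableTypeR R).
  exact: measurable_funM.
have ti0 : 0 <= t^-1 ^+ n.+1 by rewrite exprn_ge0// invr_ge0 ltW.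
have tn0 : t ^+ n != 0 by rewrite expf_neq0// gt_eqF.
have t1 : t != 0 by rewrite gt_eqF.
have mB : measurable (@rV_cons R n @^-1` A).
  by rewrite -[X in measurable X]setTI; exact: measurable_rV_cons.
have [nu nuE] := scaled_pushforward (NngNum ti0) (leb \x lebesgue_rV n)%E mS.
have E := @product_measure_unique _ _ _ _ R leb (lebesgue_rV n) nu _ _ mB.
rewrite /= /lebesgue_rV_step /pushforward E; last first.
  move=> A1 A2 mA1 mA2; rewrite nuE.
  pose B1 : set (measurableTypeR R) := (fun x => t^-1 * x) @^-1` A1.
  pose B2 : set 'rV[R]_n := (fun v => t^-1 *: v) @^-1` A2.
  have mB1 : measurable B1.
    by rewrite -[X in measurable X]setTI; exact: mS1.
  have mB2 : measurable B2.
    by rewrite -[X in measurable X]setTI; apply: measurable_rV_scale.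
  transitivity ((t^-1 ^+ n.+1)%:E * (leb B1 * lebesgue_rV n B2))%E.
    by congr (_ * _)%E; exact: product_measure1E.
  have e1 : leb B1 = (t%:E * leb A1)%E by exact: lebesgue_measure_scale.
  have e2 : lebesgue_rV n B2 = ((t ^+ n)%:E * lebesgue_rV n A2)%E by exact: IH.
  have simp (a1 a2 : \bar R) :
      ((t^-1 ^+ n.+1)%:E * (t%:E * a1 * ((t ^+ n)%:E * a2)) = a1 * a2)%E.
    rewrite [(t%:E * a1 * _)%E]muleACA -EFinM -exprS [LHS]muleA -EFinM -exprMn.
    by rewrite mulVf// expr1n mul1e.
  by rewrite e1 e2; exact: simp.
rewrite nuE [RHS]muleA -EFinM -exprMn mulfV// expr1n mul1e.
congr ((_ \x _)%E _); apply/seteqP; split=> z /=.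
all: by congr A; apply/rowP => i; rewrite !mxE; case: unliftP => //= j _; rewrite mxE.
Qed.

Lemma homotheticE n t (A : set 'rV[R]_n) : 0 < t ->
  homothetic t A = (fun v => t^-1 *: v) @^-1` A.
Proof.
move=> t0; apply/seteqP; split=> v /=.
  by move=> [x Ax <-]; rewrite scalerA mulVf ?gt_eqF// scale1r.
by move=> Av; exists (t^-1 *: v) => //; rewrite scalerA mulfV ?gt_eqF// scale1r.
Qed.

Lemma measurable_homothetic n t (A : set 'rV[R]_n) : 0 < t -> measurable A ->
  measurable (homothetic t A).
Proof.
move=> t0 mA; rewrite homotheticE// -[X in measurable X]setTI.
exact: measurable_rV_scale.
Qed.

Lemma lebesgue_rV_homothetic n t (A : set 'rV[R]_n) : 0 < t -> measurable A ->
  lebesgue_rV n (homothetic t A) = ((t ^+ n)%:E * lebesgue_rV n A)%E.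
Proof. by move=> t0 mA; rewrite homotheticE// lebesgue_rV_scale. Qed.

End lebesgue_scaling.

(** * Measurable sets and Euclidean balls of row vectors *)

Section row_vectors.
Context {R : realType} {n : nat}.
Implicit Types (x y v : 'rV[R]_n) (A : set 'rV[R]_n).

Lemma measurable_rV_box (B : 'I_n -> set R) : (forall i, measurable (B i)) ->
  measurable [set v : 'rV[R]_n | forall i, B i (v ord0 i)].
Proof.
move=> mB.
have -> : [set v : 'rV[R]_n | forall i, B i (v ord0 i)] =
    \bigcap_(j in [set: 'I_n]) ((fun v : 'rV[R]_n => v ord0 j) @^-1` B j).
  by apply/seteqP; split=> [v vA j _|v vA j]; exact: vA.
apply: fin_bigcap_measurable => // j _; rewrite -[X in measurable X]setTI.
exact: measurable_rV_coord.
Qed.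

Lemma measurable_rV_ball x e : measurable (ball x e).
Proof.
have [e0|e0] := ltP 0 e; last first.
  rewrite (_ : ball x e = set0) => [|]; first exact: measurable0.
  by apply/seteqP; split=> // y [+ _]; rewrite ltNge e0.
have -> : ball x e = [set v | forall i, ball (x ord0 i) e (v ord0 i)].
  apply/seteqP; split=> y; first by move=> [_ +] i; exact.
  by move=> xy; split=> // i j; rewrite ord1.
exact: (@measurable_rV_box (fun i => ball (x ord0 i) e) (fun i => measurable_ball _ _)).
Qed.

(** The sigma-algebra is generated by the coordinates and not by open sets. A compact set is the
    intersection over m of finite unions of sup-norm balls of radius 1 / (m + 1) centred in it, and
    such balls are boxes. *)
Lemma compact_measurable_rV A : compact A -> measurable A.
Proof.
move=> cA.
have clA : closed A by apply: compact_closed => //; exact: norm_hausdorff.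
have H m : exists U, [/\ measurable U, A `<=` U &
    forall y, U y -> exists2 x, A x & ball x m.+1%:R^-1 y].
  have := cA; rewrite compact_cover => /(_ _ A (fun x => ball x m.+1%:R^-1)).
  case.
  - by move=> x _; apply: ball_open; rewrite invr_gt0.
  - by move=> x Ax; exists x => //; apply: ballxx; rewrite invr_gt0.
  move=> D DA AD; exists (cover [set` D] (fun x => ball x m.+1%:R^-1)); split=> //.
    by apply: fin_bigcup_measurable => // x _; exact: measurable_rV_ball.
  by move=> y [x xD xy]; exists x => //; have := set_mem (DA x xD).
have [U HU] := choice H.
have -> : A = \bigcap_m U m.
  apply/seteqP; split=> [y Ay m _|y Uy]; first by have [_ + _] := HU m; apply.
  apply: clA => B /nbhs_ballP[e /= e0 eB].
  have [m me] : exists m : nat, m.+1%:R^-1 < e.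
    exists (Num.truncn e^-1); rewrite -[ltRHS]invrK ltf_pV2 ?posrE ?invr_gt0//.
    exact: truncnS_gt.
  have [_ _ /(_ y (Uy m I))[x Ax xy]] := HU m.
  exists x; split=> //; apply: eB; apply: ball_sym.
  by apply: le_ball xy; exact: ltW.
by apply: bigcap_measurable => // m _; have [] := HU m.
Qed.

Lemma enorm_ge0 x : 0 <= enorm x. Proof. exact: sqrtr_ge0. Qed.

Lemma measurable_enorm_sub x : measurable_fun setT (fun y => enorm (x - y)).
Proof.
have msqrt : measurable_fun setT (@Num.sqrt R).
  by apply: continuous_measurable_fun; exact: sqrt_continuous.
apply: (measurableT_comp msqrt).
apply: measurable_sum => i; apply: measurable_funX.
under eq_fun do rewrite !mxE.
by apply: measurable_funB => //; exact: measurable_rV_coord.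
Qed.

Lemma coord_le_enorm x i : `|x ord0 i| <= enorm x.
Proof.
rewrite -sqrtr_sqr ler_sqrt; last by apply: sumr_ge0 => j _; exact: sqr_ge0.
by rewrite (bigD1 i)//= lerDl; apply: sumr_ge0 => j _; exact: sqr_ge0.
Qed.

Lemma enorm_eq0 x : enorm x = 0 -> x = 0.
Proof.
move=> x0; apply/rowP => i; rewrite mxE; apply/eqP; rewrite -normr_le0 -x0.
exact: coord_le_enorm.
Qed.

Lemma enormB x y t : (forall i, `|x ord0 i| <= t) -> (forall i, `|y ord0 i| <= t) ->
  enorm (x - y) <= Num.sqrt n%:R * (2 * t).
Proof.
move=> xt yt.
(* In dimension 0 the hypotheses say nothing about the sign of t. *)
have [n0|n0] := posnP n.
  rewrite /enorm big1 ?sqrtr0//; last first.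
    by move=> i; exfalso; move: (leq_ltn_trans (leq0n _) (ltn_ord i)); rewrite lt0n n0.
  by rewrite n0 sqrtr0 mul0r.
have t0 : 0 <= t by apply: le_trans (xt (Ordinal n0)).
have -> : Num.sqrt n%:R * (2 * t) = Num.sqrt (n%:R * (2 * t) ^+ 2).
  by rewrite sqrtrM// sqrtr_sqr ger0_norm// mulr_ge0.
rewrite ler_sqrt; last by rewrite mulr_ge0 ?sqr_ge0.
rewrite mulr_natl -[X in _ *+ X](card_ord n) -sumr_const; apply: ler_sum => i _.
rewrite -real_normK ?num_real// lerXn2r ?nnegrE ?mulr_ge0// !mxE.
by rewrite (le_trans (ler_normB _ _))// mulr_natl mulr2n lerD.
Qed.

Lemma compact_coord_bounded A : compact A -> exists2 B, 0 < B &
  forall x, A x -> forall i, `|x ord0 i| <= B.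
Proof.
move=> /compact_bounded[M [_ HM]]; exists (`|M| + 1); first by rewrite ltr_wpDl.
move=> x Ax i.
have : `|x| <= `|M| + 1 by apply: HM => //; rewrite (le_lt_trans (ler_norm M))// ltrDl.
apply: le_trans; rewrite [leRHS]/Num.Def.normr/= mx_normrE.
by apply: (le_bigmax _ (fun ij => `|x ij.1 ij.2|) (ord0, i)).
Qed.

Definition eball x t : set 'rV[R]_n := [set y | enorm (x - y) <= t].

Lemma measurable_eball x t : measurable (eball x t).
Proof.
have -> : eball x t = (fun y => enorm (x - y)) @^-1` `]-oo, t].
  by apply/seteqP; split=> y; rewrite /eball /= in_itv.
by rewrite -[X in measurable X]setTI; exact: measurable_enorm_sub.
Qed.

(** The ball is enclosed in a cube of side 2 t; only the order t^n matters for the shells. *)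
Lemma lebesgue_rV_eball x t : 0 <= t ->
  (lebesgue_rV n (eball x t) <= ((2 * t) ^+ n)%:E)%E.
Proof.
move=> t0; pose B i : set R := `[x ord0 i - t, x ord0 i + t]%classic.
have mB i : measurable (B i) by exact: measurable_itv.
apply: (@le_trans _ _ (lebesgue_rV n [set v | forall i, B i (v ord0 i)])).
  apply: le_measure; [by apply: mem_set; exact: measurable_eball|by apply: mem_set; exact: measurable_rV_box mB|].
  move=> y /= xy i; rewrite /B/= in_itv/=.
  have := le_trans (coord_le_enorm (x - y) i) xy.
  by rewrite !mxE ler_norml => /andP[? ?]; apply/andP; split; lra.
rewrite lebesgue_rV_box// le_eqVlt; apply/orP; left; apply/eqP.
rewrite (eq_bigr (fun=> (2 * t)%:E)).
  elim: n {x B mB} => [|m IH]; first by rewrite big_ord0.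
  by rewrite big_ord_recr/= IH exprSr.
move=> i _; rewrite lebesgue_measure_itv/= lte_fin.
case: ifPn => [_|]; first by rewrite -EFinD; congr (_%:E); ring.
by rewrite -leNgt => h; congr (_%:E); lra.
Qed.

End row_vectors.

(** * Integrals of second-order random fields *)

Section random_field_integral.
Context {R : realType} {d1 d2} {T : measurableType d1} {Omega : measurableType d2}.
Variables (m : {sigma_finite_measure set T -> \bar R}) (P : probability Omega R).
Variables (A : set T) (V : T -> Omega -> R) (N : R).
Hypothesis mA : measurable A.
Hypothesis finA : (m A < +oo)%E.
Hypothesis mV : measurable_fun setT (fun z : T * Omega => V z.1 z.2).
Hypothesis V2 : forall x, (\int[P]_w (V x w ^+ 2)%:E <= N%:E)%E.

Let a : R := fine (m A).

Let aE : m A = a%:E.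
Proof. by rewrite /a fineK// ge0_fin_numE. Qed.

Let a0 : 0 <= a.
Proof. by rewrite /a fine_ge0. Qed.

(** The indicator turns integrals over A into integrals over the whole product space, where Fubini's
    theorem is applied. *)
Definition cut_field (z : T * Omega) : R := \1_A z.1 * V z.1 z.2.

Definition region_integral w : R := \int[m]_(x in A) V x w.

Let mI : measurable_fun setT (\1_A : T -> R).
Proof. exact: measurable_indic. Qed.

Let integrableI : m.-integrable setT (EFin \o (\1_A : T -> R)).
Proof.
apply/integrableP; split; first exact/measurable_EFinP.
under eq_integral do rewrite /= ger0_norm//.
by rewrite integral_indic// setIT.
Qed.

Lemma measurable_cut_field : measurable_fun setT cut_field.
Proof.
apply: measurable_funM => //.
exact: (measurableT_comp mI measurable_fst).
Qed.

Lemma measurable_field_section x : measurable_fun setT (V x).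
Proof. exact: (measurableT_comp mV (measurable_pair1 x)). Qed.

Lemma square_integrable_field x : square_integrable P (V x).
Proof.
split; first exact: measurable_field_section.
apply/integrableP; split.
  by apply/measurable_EFinP; apply: measurable_funX; exact: measurable_field_section.
under eq_integral do rewrite gee0_abs ?lee_fin ?sqr_ge0//.
exact: le_lt_trans (V2 x) (ltry _).
Qed.

Lemma square_integrable_indic : square_integrable m (\1_A : T -> R).
Proof.
split; first exact: measurable_indic.
have I := integrableI.
apply: eq_integrable I => // x _ /=.
by rewrite indicE; case: (x \in A); rewrite ?expr1n ?expr0n.
Qed.

Let Q := (m \x P)%E.

Lemma square_integrable_lift (Z : Omega -> R) : square_integrable P Z ->
  square_integrable Q (fun z => \1_A z.1 * Z z.2).
Proof.
move=> [mZ IZ]; split.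
  apply: measurable_funM.
    exact: (measurableT_comp mI measurable_fst).
  exact: (measurableT_comp mZ measurable_snd).
have [_ I1] := square_integrable_indic.
have [I _] := Rintegral_tensor I1 IZ.
by apply: eq_integrable I => // z _; rewrite exprMn.
Qed.

Lemma square_integrable_cut_field : square_integrable Q cut_field.
Proof.
split; first exact: measurable_cut_field.
pose f2 (z : T * Omega) := (cut_field z ^+ 2)%:E.
have f20 z : (0 <= f2 z)%E by rewrite lee_fin sqr_ge0.
have mU2 : measurable_fun setT f2.
  by apply/measurable_EFinP; apply: measurable_funX; exact: measurable_cut_field.
apply/integrableP; split => //.
under eq_integral do rewrite gee0_abs ?lee_fin ?sqr_ge0//.
rewrite (@fubini_tonelli1 _ _ T Omega R m P f2 mU2 f20).
apply: (@le_lt_trans _ _ (\int[m]_x ((N * \1_A x)%:E))%E); last first.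
  have [_ I] := square_integrable_indic.
  have I1 := integrableI.
  have /integrableP[_] := integrableZl measurableT N I1.
  apply: le_lt_trans; rewrite ge0_le_integral//.
  - move=> x _; rewrite lee_fin mulr_ge0//.
    by have := V2 x; rewrite -lee_fin; apply: le_trans; apply: integral_ge0 => w _; rewrite lee_fin sqr_ge0.
  - by apply/measurable_EFinP; apply: measurable_funM => //; exact: measurable_indic.
  - apply: measurableT_comp => //; apply: emeasurable_funM => //.
    by apply/measurable_EFinP; exact: measurable_indic.
  - by move=> x _; rewrite -EFinM /= lee_fin ler_norm.
apply: ge0_le_integral => //.
- by move=> x _; apply: integral_ge0 => w _; rewrite lee_fin sqr_ge0.
- exact: (@measurable_fun_fubini_tonelli_F _ _ T Omega R P f2 mU2 f20).
- by apply/measurable_EFinP; apply: measurable_funM => //; exact: measurable_indic.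
- move=> x _; rewrite /fubini_F/= /f2 /cut_field/= indicE.
  case: (x \in A).
    by under eq_integral do rewrite mul1r; rewrite mulr1; exact: V2.
  by under eq_integral do rewrite mul0r expr0n; rewrite integral0 mulr0.
Qed.

(** The function is the product of 1_A Z and 1_A V, both square integrable for the product measure
    because A has finite measure. *)
Lemma integrable_lift_cut_field (Z : Omega -> R) : square_integrable P Z ->
  Q.-integrable setT (fun z => (Z z.2 * cut_field z)%:E).
Proof.
move=> LZ; have := square_integrable_mul (square_integrable_lift LZ) square_integrable_cut_field.
apply: eq_integrable => // z _ /=; congr (_%:E).
by rewrite /cut_field indicE; case: (_ \in A); rewrite ?mul1r// !mul0r mulr0.
Qed.

Lemma square_integrable_cst1 : square_integrable P (fun=> 1).
Proof.
split=> //; have I : P.-integrable setT (EFin \o cst 1) by exact: finite_measure_integrable_cst.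
by apply: eq_integrable I => // w _; rewrite expr1n.
Qed.

Lemma integrable_cut_field : Q.-integrable setT (EFin \o cut_field).
Proof.
apply: eq_integrable (integrable_lift_cut_field square_integrable_cst1) => // z _.
by rewrite mul1r.
Qed.

(** Linearity of integrals along a trajectory requires this integrability, so identities between
    [region_integral]s are obtained almost surely only. *)
Lemma ae_integrable_field :
  {ae P, forall w, m.-integrable A (fun x => (V x w)%:E)}.
Proof.
have := ae_integrable2 integrable_cut_field.
apply: filterS => w /= I; apply/(integrable_mkcond _ mA).
apply: eq_integrable I => // x _ /=; rewrite patchE /cut_field/= indicE.
by case: ifPn => xA; rewrite ?mul1r ?mul0r.
Qed.

Lemma region_integralE w :
  region_integral w = fine (\int[m]_x (cut_field (x, w))%:E).
Proof.
rewrite /region_integral /Rintegral integral_mkcond; congr fine.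
apply: eq_integral => x _; rewrite patchE /cut_field/= indicE.
by case: ifPn => xA; rewrite ?mul1r ?mul0r.
Qed.

Lemma measurable_region_integral : measurable_fun setT region_integral.
Proof.
have mG := measurable_fubini_G integrable_cut_field.
rewrite (_ : region_integral = fine \o fubini_G m (EFin \o cut_field)).
  by apply: measurableT_comp => //; exact: fine_measurable.
by apply/funext => w; rewrite region_integralE.
Qed.

(** Cauchy-Schwarz against 1_A, read off the positivity of the integral of ((1 + a) f - c 1_A)^2,
    where c is the integral of f over A. The constant 1 + a instead of a spares the case of a null
    set. *)
Lemma sqr_region_integral_le :
  {ae P, forall w, (region_integral w ^+ 2)%:E <=
    (1 + a)%:E * \int[m]_x (cut_field (x, w) ^+ 2)%:E}%E.
Proof.
have [_ I2] := square_integrable_cut_field.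
have := ae_integrable2 I2; apply: filterS => w /= I.
pose f x := cut_field (x, w).
have Lf : square_integrable m f.
  split => //; exact: (measurableT_comp measurable_cut_field (measurable_pair2 w)).
have cE : region_integral w = \int[m]_x (f x * \1_A x).
  rewrite region_integralE; congr fine; apply: eq_integral => x _ /=; congr (_%:E).
  by rewrite /f /cut_field/= indicE; case: (x \in A); rewrite ?mulr1 ?mul0r.
set c := region_integral w in cE *.
have Lg := square_integrable_indic.
have [_ I1] := Lg.
have If1 := square_integrable_mul Lf Lg.
have E1 : \int[m]_x ((\1_A x : R) ^+ 2) = a.
  rewrite /a /Rintegral; congr fine.
  rewrite -[X in m X]setIT -integral_indic//; apply: eq_integral => x _ /=.
  by rewrite indicE; case: (x \in A); rewrite ?expr1n ?expr0n.
set F := \int[m]_x (f x ^+ 2).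
have E : \int[m]_x (((1 + a) * f x - c * \1_A x) ^+ 2) =
    (1 + a) ^+ 2 * F - 2 * (1 + a) * c ^+ 2 + c ^+ 2 * a.
  have sq x : ((1 + a) * f x - c * \1_A x) ^+ 2 =
    ((1 + a) ^+ 2 * f x ^+ 2 + c ^+ 2 * (\1_A x : R) ^+ 2) + - (2 * (1 + a) * c) * (f x * \1_A x) by ring.
  under eq_Rintegral do rewrite sq.
  have J1 : m.-integrable setT (EFin \o (fun x => (1 + a) ^+ 2 * f x ^+ 2)).
    exact: (integrableZl measurableT ((1 + a) ^+ 2) I).
  have J2 : m.-integrable setT (EFin \o (fun x => c ^+ 2 * (\1_A x : R) ^+ 2)).
    exact: (integrableZl measurableT (c ^+ 2) I1).
  have J3 : m.-integrable setT (EFin \o (fun x => - (2 * (1 + a) * c) * (f x * \1_A x))).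
    exact: (integrableZl measurableT (- (2 * (1 + a) * c)) If1).
  rewrite RintegralD//; last exact: (integrableD measurableT J1 J2).
  rewrite RintegralD// !RintegralZl// -cE E1 -/F; ring.
have pos : 0 <= (1 + a) ^+ 2 * F - 2 * (1 + a) * c ^+ 2 + c ^+ 2 * a.
  by rewrite -E; apply: Rintegral_ge0 => x _; exact: sqr_ge0.
have F0 : 0 <= F by apply: Rintegral_ge0 => x _; exact: sqr_ge0.
have -> : (\int[m]_x (cut_field (x, w) ^+ 2)%:E = F%:E)%E.
  by rewrite /F /Rintegral fineK//; exact: (integrable_fin_num measurableT I).
rewrite -EFinM lee_fin.
have c20 := sqr_ge0 c.
have h : c ^+ 2 * (2 + a) <= (1 + a) * F * (2 + a) by have := mulr_ge0 (addr_ge0 ler01 a0) F0; nra.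
by move: h; rewrite ler_pM2r// ltr_wpDr.
Qed.

Lemma square_integrable_region_integral : square_integrable P region_integral.
Proof.
have mY := measurable_region_integral.
split=> //; apply/integrableP; split.
  by apply/measurable_EFinP; exact: measurable_funX.
under eq_integral do rewrite gee0_abs ?lee_fin ?sqr_ge0//.
pose f2 (z : T * Omega) := (cut_field z ^+ 2)%:E.
have f20 z : (0 <= f2 z)%E by rewrite lee_fin sqr_ge0.
have mU2 : measurable_fun setT f2.
  by apply/measurable_EFinP; apply: measurable_funX; exact: measurable_cut_field.
have [_ /integrableP[_ I2]] := square_integrable_cut_field.
have mG := @measurable_fun_fubini_tonelli_G _ _ T Omega R m f2 mU2 f20.
apply: (@le_lt_trans _ _ (\int[P]_w ((1 + a)%:E * \int[m]_x (cut_field (x, w) ^+ 2)%:E))%E).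
  apply: ae_ge0_le_integral => //.
  - by move=> w _; rewrite lee_fin sqr_ge0.
  - by apply/measurable_EFinP; exact: measurable_funX.
  - move=> w _; apply: mule_ge0; first by rewrite lee_fin addr_ge0.
    by apply: integral_ge0 => x _; rewrite lee_fin sqr_ge0.
  - by apply: emeasurable_funM => //; exact: mG.
  - by apply: filterS sqr_region_integral_le => w /= + _.
rewrite ge0_integralZl//; last 2 first.
- by move=> w _; apply: integral_ge0 => x _; rewrite lee_fin sqr_ge0.
- by rewrite lee_fin addr_ge0.
have := @fubini_tonelli2 _ _ T Omega R m P f2 mU2 f20.
rewrite /fubini_G/= => <-.
apply: lte_mul_pinfty => //; first by rewrite lee_fin addr_ge0.
move: I2; apply: le_lt_trans; apply: ge0_le_integral => //.
  exact: measurableT_comp.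
by move=> z _; exact: lee_abs.
Qed.

Lemma integral_mul_region_integral (Z : Omega -> R) : square_integrable P Z ->
  (\int[P]_w (Z w * region_integral w)%:E =
   \int[m]_(x in A) \int[P]_w (Z w * V x w)%:E)%E.
Proof.
move=> LZ; have I := integrable_lift_cut_field LZ.
have [mZ _] := LZ.
transitivity (\int[P]_w \int[m]_x (Z w * cut_field (x, w))%:E)%E.
  apply: ae_eq_integral => //.
  - apply/measurable_EFinP; apply: measurable_funM => //; exact: measurable_region_integral.
  - exact: (measurable_fubini_G I).
  - have := ae_integrable2 integrable_cut_field; apply: filterS => w /= Iw _.
    rewrite region_integralE EFinM fineK; last exact: (integrable_fin_num measurableT Iw).
    by rewrite -integralZl.
rewrite -(Fubini I) [RHS]integral_mkcond; apply: eq_integral => x _.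
rewrite patchE /cut_field/= indicE; case: ifPn => xA.
  by apply: eq_integral => w _; rewrite mul1r.
by under eq_integral do rewrite mul0r mulr0; rewrite integral0.
Qed.

Lemma integral_mul_region_integral_le (Z : Omega -> R) (k : T -> R) (kappa : R) :
  square_integrable P Z -> measurable_fun setT k ->
  (forall x, A x -> `|\int[P]_w (Z w * V x w)| <= k x) ->
  (\int[m]_(x in A) (k x)%:E <= kappa%:E)%E ->
  `|\int[P]_w (Z w * region_integral w)| <= kappa.
Proof.
move=> LZ mk Zk kk; have I := integrable_lift_cut_field LZ.
have LY := square_integrable_region_integral.
have IZY := square_integrable_mul LZ LY.
rewrite -lee_fin EFin_normr_Rintegral//.
rewrite integral_mul_region_integral//.
have mF : measurable_fun A (fun x => \int[P]_w (Z w * V x w)%:E)%E.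
  have mF1 := measurable_fubini_F I.
  apply: (eq_measurable_fun (fun x => \int[P]_w (Z w * cut_field (x, w))%:E)%E).
    move=> x xA; apply: eq_integral => w _.
    by rewrite /cut_field/= indicE xA mul1r.
  exact: measurable_funTS.
apply: (le_trans (le_abse_integral _ _ _)) => //.
apply: le_trans kk; apply: ge0_le_integral => //.
- exact: measurableT_comp.
- by apply/measurable_EFinP; exact: measurable_funTS.
- move=> x xA; have IZV := square_integrable_mul LZ (square_integrable_field x).
  by rewrite -EFin_normr_Rintegral// lee_fin; exact: Zk.
Qed.

(* The double integral of the covariances is bounded one variable at a time. *)
Lemma region_integral_variance (K : T -> T -> R) (kappa : R) :
  (forall x, measurable_fun setT (K x)) ->
  (forall x y, A x -> A y -> `|\int[P]_w (V x w * V y w)| <= K x y) ->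
  (forall x, A x -> \int[m]_(y in A) (K x y)%:E <= kappa%:E)%E ->
  \int[P]_w (region_integral w ^+ 2) <= kappa * a.
Proof.
move=> mK VK Kk.
apply: (le_trans (ler_norm _)); under eq_Rintegral do rewrite expr2.
(* Here Z is the region integral itself; the bound kappa on its covariance with each [V x] comes
   from a second use of the same lemma, with Z = [V x]. *)
apply: (@integral_mul_region_integral_le _ (fun=> kappa)).
- exact: square_integrable_region_integral.
- by [].
- move=> x Ax.
  have -> : \int[P]_w (region_integral w * V x w) = \int[P]_w (V x w * region_integral w).
    by apply: eq_Rintegral => w _; rewrite mulrC.
  apply: (@integral_mul_region_integral_le _ (K x)) => //.
  - exact: square_integrable_field.
  - by move=> y Ay; exact: VK.
  - exact: Kk.
- by rewrite integral_cst// EFinM -aE.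
Qed.

End random_field_integral.

(** * Functionals of Gamma-correlated fields *)

Lemma integral_law {R : realType} {d d'} {T : measurableType d} {T' : measurableType d'}
    (P : {measure set T -> \bar R}) (m : {measure set T' -> \bar R}) (X : T -> T') (f : T' -> R) :
  measurable_fun setT X -> (forall A, measurable A -> m A = P (X @^-1` A)) ->
  measurable_fun setT f ->
  (\int[P]_w (f (X w))%:E = \int[m]_y (f y)%:E)%E.
Proof.
move=> mX mE mf.
have ge0 (g : T' -> \bar R) : measurable_fun setT g -> (forall y, 0 <= g y)%E ->
    (\int[P]_w g (X w) = \int[m]_y g y)%E.
  move=> mg g0; have := ge0_integral_pushforward mX P measurableT mg (fun y _ => g0 y).
  rewrite preimage_setT => <-.
  by apply: eq_measure_integral => A mA _; rewrite mE.
have mf' : measurable_fun setT (EFin \o f) by exact/measurable_EFinP.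
rewrite integralE [RHS]integralE -!ge0//.
- congr (_ - _)%E; apply: eq_integral => w _.
    by rewrite !funeposE.
  by rewrite !funenegE.
- exact: measurable_funeneg.
- exact: measurable_funepos.
Qed.

Lemma law_exists {R : realType} {d d'} {T : measurableType d} {T' : measurableType d'}
    (P : probability T R) (X : T -> T') : measurable_fun setT X ->
  exists m : probability T' R, forall A, m A = P (X @^-1` A).
Proof.
move=> mX; pose X' : {mfun T >-> T'} := HB.pack X (isMeasurableFun.Build _ _ _ _ _ mX).
by exists (distribution P X').
Qed.

(** Terms of a convergent series tend to 0. This provides the ratio below 1 for the geometric tails
    of the Laguerre kernel. *)
Lemma summable_powers_lt1 {R : realType} (r : R) :
  cvgn [series r ^+ (2 * n.+1)]_n -> `|r| < 1.
Proof.
move=> /cvg_series_cvg_0 /cvgrPdist_lt /(_ 1 ltr01)[n _ Hn].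
rewrite ltNge; apply/negP => r1; have := Hn n (leqnn n).
by rewrite sub0r normrN normrX ltNge exprn_ege1.
Qed.

(** * The correlation function and the kernel built from its powers *)

Section gamma_correlated.
Context {R : realType} {d : nat} {dO : measure_display}
  {Omega : measurableType dO} (P : probability Omega R).
Variables (beta : R) (gamma : R -> R) (xi : 'rV[R]_d -> Omega -> R).
Hypothesis d_gt0 : (0 < d)%N.
Hypothesis beta0 : 0 < beta.
Hypothesis hxi : gamma_correlated_field P beta gamma xi.
Variables (delta : R) (L : R -> R).
Hypothesis delta0 : 0 < delta.
Hypothesis hL : slowly_varying L.
Hypothesis hgamma : forall z : 'rV[R]_d, z != 0 ->
  gamma (enorm z) = L (enorm z) / enorm z `^ delta.

(** A unit vector: its multiples realize every t > 0 as a norm, which carries the hypotheses on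
    [gamma (enorm z)] over to [gamma] on the half-line. *)
Let e0 : 'rV[R]_d := delta_mx ord0 (Ordinal d_gt0).

Let enorm_e0 t : enorm (t *: e0) = `|t|.
Proof.
rewrite /enorm (bigD1 (Ordinal d_gt0))//= !mxE !eqxx mulr1 big1 ?addr0 ?sqrtr_sqr//.
by move=> i ni; rewrite !mxE eqxx (negbTE ni) mulr0 expr0n.
Qed.

Lemma correlation_powerE (t : R) : 0 < t -> gamma t = L t / t `^ delta.
Proof.
move=> t0; have := @hgamma (t *: e0); rewrite enorm_e0 gtr0_norm//; apply.
by apply/eqP => z0; have := enorm_e0 t; rewrite z0 gtr0_norm// /enorm big1 ?sqrtr0;
  [move=> h; move: t0; rewrite -h ltxx|move=> i _; rewrite mxE expr0n].
Qed.

Let continuous_gamma_abs : continuous (fun t : R => gamma `|t|).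
Proof.
have -> : (fun t : R => gamma `|t|) = (fun z : 'rV[R]_d => gamma (enorm z)) \o (fun t : R => t *: e0).
  by apply/funext => t /=; rewrite enorm_e0.
move=> t; apply: continuous_comp; first exact: scalel_continuous.
exact: (gcf_gamma_continuous hxi).
Qed.

Let continuous_gamma (t : R) : 0 < t -> {for t, continuous gamma}.
Proof.
move=> t0; have := @continuous_gamma_abs t; rewrite /continuous_at gtr0_norm//.
apply: cvg_trans; apply: near_eq_cvg; near=> s.
by rewrite gtr0_norm//; near: s; exact: lt_nbhsr.
Unshelve. all: by end_near. Qed.

Lemma correlation_gt0 : \forall t \near +oo, 0 < gamma t.
Proof.
have [_ L0 _] := hL; near=> t.
have t0 : 0 < t by near: t; exact: nbhs_pinfty_gt.
by rewrite correlation_powerE// divr_gt0 ?powR_gt0//; near: t.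
Unshelve. all: by end_near. Qed.

Let gamma_rv (c : R) : 0 < c -> gamma (c * t) / gamma t @[t --> +oo] --> c `^ (- delta).
Proof.
move=> c0; have [_ L0 Lsv] := hL.
have : L (c * t) / L t * c `^ (- delta) @[t --> +oo] --> 1 * c `^ (- delta).
  by apply: cvgM; [exact: Lsv|exact: cvg_cst].
rewrite mul1r; apply: cvg_trans; apply: near_eq_cvg; near=> t.
have t0 : 0 < t by near: t; exact: nbhs_pinfty_gt.
have Lt0 : 0 < L t by near: t.
rewrite !correlation_powerE ?mulr_gt0// powRM ?(ltW c0) ?(ltW t0)// powRN.
by field; rewrite !gt_eqF ?powR_gt0.
Unshelve. all: by end_near. Qed.

Lemma field_correlation_lt1 (x y : 'rV[R]_d) : x != y -> `|gamma (enorm (x - y))| < 1.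
Proof.
move=> xy; apply: summable_powers_lt1; apply: (gcf_gamma_summable hxi).
rewrite lt_def enorm_ge0 andbT; apply: contra_neq xy => /enorm_eq0 /eqP.
by rewrite subr_eq0 => /eqP.
Qed.

Section kernel.
Variable k : nat.

(* Dominates [|gamma|^(k+1)] away from the diagonal, and the constant 1 on it. *)
Let h (s : R) : R := Num.min 1 (Num.max (\1_[set 0] s) (`|gamma `|s| | ^+ k.+1)).

Let mh : measurable_fun setT h.
Proof.
apply: measurable_minr => //; apply: measurable_maxr.
  by apply: measurable_indic; exact: measurable_set1.
apply: measurable_funX; apply: measurableT_comp => //.
exact: continuous_measurable_fun.
Qed.

Let h_ge0 (s : R) : 0 <= h s.
Proof. by rewrite /h le_min ler01 le_max exprn_ge0 ?orbT. Qed.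

Let h_le1 (s : R) : h s <= 1. Proof. by rewrite /h ge_min lexx. Qed.

Let h0 : h 0 = 1.
Proof. by rewrite /h min_l// le_max indicE mem_set// lexx. Qed.

Let h_pos (s : R) : 0 < s -> h s <= `|gamma s| ^+ k.+1.
Proof.
move=> s0; rewrite /h indicE memNset; last by move=> /= E; move: s0; rewrite E ltxx.
by rewrite ge_min; apply/orP; right; rewrite (gtr0_norm s0) max_r// exprn_ge0.
Qed.

Let h_dist (x y : 'rV[R]_d) : x != y -> h (enorm (x - y)) = `|gamma (enorm (x - y))| ^+ k.+1.
Proof.
move=> xy; have s0 : 0 < enorm (x - y).
  rewrite lt_def enorm_ge0 andbT; apply: contra_neq xy => /enorm_eq0 /eqP.
  by rewrite subr_eq0 => /eqP.
rewrite /h indicE memNset; last by move=> /= E; move: s0; rewrite E ltxx.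
rewrite (gtr0_norm s0) max_r ?exprn_ge0// min_r//.
by rewrite exprn_ile1// ltW// field_correlation_lt1.
Qed.

Definition dist_kernel (x y : 'rV[R]_d) : R := h (enorm (x - y)).

Lemma measurable_dist_kernel x : measurable_fun setT (dist_kernel x).
Proof. exact: (measurableT_comp mh (measurable_enorm_sub x)). Qed.

Lemma dist_kernel_ge0 x y : 0 <= dist_kernel x y. Proof. exact: h_ge0. Qed.

Lemma dist_kernel_diag x : dist_kernel x x = 1.
Proof.
rewrite /dist_kernel subrr; have -> : enorm (0 : 'rV[R]_d) = 0.
  by rewrite /enorm big1 ?sqrtr0// => i _; rewrite mxE expr0n.
exact: h0.
Qed.

Lemma dist_kernelE x y : x != y -> dist_kernel x y = `|gamma (enorm (x - y))| ^+ k.+1.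
Proof. exact: h_dist. Qed.

Let I x t := (\int[lebesgue_rV d]_(y in eball x t) (dist_kernel x y)%:E)%E.

Let mK x D' : measurable_fun D' (fun y => (dist_kernel x y)%:E).
Proof. by apply: measurable_funTS; apply/measurable_EFinP; exact: measurable_dist_kernel. Qed.

Let I_ge0 x t : (0 <= I x t)%E.
Proof. by apply: integral_ge0 => y _; rewrite lee_fin dist_kernel_ge0. Qed.

Let I_le x (t : R) : 0 <= t -> (I x t <= ((2 * t) ^+ d)%:E)%E.
Proof.
move=> t0; apply: le_trans (lebesgue_rV_eball x t0).
rewrite -[leRHS]mul1e -integral_cst; last exact: measurable_eball.
apply: ge0_le_integral => //; first exact: measurable_eball.
  by move=> y _; rewrite lee_fin dist_kernel_ge0.
by move=> y _; rewrite lee_fin; exact: h_le1.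
Qed.

Let I_fin x (t : R) : 0 <= t -> I x t \is a fin_num.
Proof. by move=> t0; rewrite ge0_fin_numE// (le_lt_trans (I_le x t0))// ltry. Qed.

(** The added shell lies in the ball of radius 2 t, of volume at most (4 t)^d, and distances to x in
    it range over [t, 2 t]. *)
Let I_shell x (t c : R) : (0 < t)%R -> (0 <= c)%R ->
  (forall s : R, t <= s <= 2 * t -> `|gamma s| <= c)%R ->
  (I x (2 * t)%R <= I x t + ((4 * t) ^+ d * c ^+ k.+1)%:E)%E.
Proof.
move=> t0 c0 Hc.
have m1 := measurable_eball x t; have m2 := measurable_eball x (2 * t).
rewrite /I.
have -> : eball x (2 * t) = eball x t `|` (eball x (2 * t) `\` eball x t).
  rewrite setUDr setDv setD0; apply/seteqP; split => y /=; first by right.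
  by move=> [|//]; rewrite /eball/= => /le_trans; apply; lra.
rewrite ge0_integral_setU//; last 3 first.
- exact: measurableD.
- by move=> y _; rewrite lee_fin dist_kernel_ge0.
- by apply/disj_set2P; rewrite setDE setICA setICr setI0.
rewrite leeD2l//.
apply: (@le_trans _ _ (\int[lebesgue_rV d]_(y in eball x (2 * t)%R `\` eball x t) (c ^+ k.+1)%:E)%E).
  apply: ge0_le_integral => //.
  - exact: measurableD.
  - by move=> y _; rewrite lee_fin dist_kernel_ge0.
  - move=> y [/= yt2 /negP]; rewrite -ltNge => yt; rewrite lee_fin.
    have y0 : 0 < enorm (x - y) by exact: lt_trans yt.
    apply: (le_trans (h_pos y0)); apply: lerXn2r; rewrite ?nnegrE//.
    by apply: Hc; rewrite (ltW yt).
rewrite integral_cst//; last exact: measurableD.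
rewrite [in leRHS]mulrC EFinM; apply: lee_wpmul2l; first by rewrite lee_fin exprn_ge0.
apply: (@le_trans _ _ (lebesgue_rV d (eball x (2 * t)))).
  by apply: le_measure => //; apply/mem_set => //; exact: measurableD.
have -> : 4 * t = 2 * (2 * t) by ring.
by apply: lebesgue_rV_eball; rewrite mulr_ge0 ?ltW.
Qed.

Lemma dist_kernel_small (r eps : R) : k%:R * delta < d%:R -> 0 < r -> 0 < eps ->
  \forall t \near +oo, forall x : 'rV[R]_d,
    (\int[lebesgue_rV d]_(y in eball x (r * t)%R) (dist_kernel x y)%:E <=
     (eps * (gamma t ^+ k * t ^+ d))%:E)%E.
Proof.
move=> kd r0 eps0.
have H := @shell_decay R gamma delta delta0 continuous_gamma correlation_gt0 gamma_rv
  d k kd 'rV[R]_d (fun x t => fine (I x t)).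
have {H}H : \forall t \near +oo, forall x, fine (I x (r * t)) <= eps * (gamma t ^+ k * t ^+ d).
  apply: H => //.
  - by move=> x t; exact: fine_ge0.
  - move=> x t /ltW t0; rewrite -lee_fin fineK; [exact: I_le|exact: I_fin].
  - move=> x t c t0 c0 Hc; rewrite -lee_fin EFinD !fineK ?I_fin ?mulr_ge0 ?(ltW t0)//.
    exact: I_shell.
near=> t => x.
have t0 : 0 <= r * t.
  by rewrite mulr_ge0 ?(ltW r0)//; near: t; apply: nbhs_pinfty_ge; exact: num_real.
rewrite -/(I x (r * t)) -(fineK (I_fin x t0)) lee_fin.
by move: x {t0}; near: t.
Unshelve. all: by end_near. Qed.

End kernel.

End gamma_correlated.

(** * Reduction to the leading Laguerre term *)

Section laguerre_reduction.
Context {R : realType} {d : nat} {dO : measure_display}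
  {Omega : measurableType dO} (P : probability Omega R).
Variables (beta : R) (gamma : R -> R) (xi : 'rV[R]_d -> Omega -> R).
Hypothesis d_gt0 : (0 < d)%N.
Hypothesis beta0 : 0 < beta.
Hypothesis hxi : gamma_correlated_field P beta gamma xi.
Variables (F : R -> R) (k : nat).
Hypothesis hF : L2_gamma beta F.
Hypothesis hk : laguerre_rank beta F k.

Variable m : probability (measurableTypeR R) R.
Hypothesis xi_law : forall x (A : set (measurableTypeR R)), measurable A ->
  m A = P (xi x @^-1` A).

Let mE : forall A : set (measurableTypeR R), measurable A ->
  m A = (\int[lebesgue_measure]_(u in A `&` `]0%R, +oo[) (gamma_pdf beta u)%:E)%E.
Proof. by move=> A mA; rewrite (xi_law 0)// (gcf_marginal hxi). Qed.

Lemma measurable_field_value x :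
  measurable_fun setT (xi x : Omega -> measurableTypeR R).
Proof. exact: (measurableT_comp (gcf_measurable hxi) (measurable_pair1 x)). Qed.

Let F0 := F \_ `]0%R, +oo[.
Let e := laguerre_fun beta.
Let C j := laguerre_coef beta F j.

Let L2F0 : square_integrable m F0.
Proof. exact: (square_integrable_gamma_law beta0 mE hF). Qed.

Let L2e j : square_integrable m (e j).
Proof. exact: (square_integrable_laguerre beta0 mE). Qed.

Let L2cst (c : R) : square_integrable m (fun=> c).
Proof.
split; first exact: measurable_cst.
exact: finite_measure_integrable_cst.
Qed.

(** The constant is subtracted on the whole line, unlike C 0 * e 0, which vanishes for u <= 0: its
    integral over D(T) is then exactly the centering term of [S_L]. *)
Definition laguerre_remainder (u : R) : R := F0 u - C 0 - C k * e k u.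

Let G := laguerre_remainder.

Lemma square_integrable_remainder : square_integrable m G.
Proof.
apply: square_integrableB; last exact: square_integrableZ.
exact: square_integrableB.
Qed.

Lemma remainder_orthogonal j : (j <= k)%N -> \int[m]_u (G u * e j u) = 0.
Proof.
move=> jk; have [k1 Ck0 Cj0] := hk.
(* C 0 may be replaced by C 0 * e 0 here: e 0 is 1 on the half-line, and e j vanishes off it. *)
have E u : G u * e j u = (F0 u * e j u + - C 0 * (e 0 u * e j u)) + - C k * (e k u * e j u).
  rewrite /G /laguerre_remainder; have [u0|u0] := ltP 0 u.
    have -> : e 0 u = 1 by exact: (laguerre_fun0 beta0 mE u0).
    by move: (F0 u) (C 0) (C k) (e k u) (e j u) => ? ? ? ? ?; ring.
  have -> : e j u = 0 by exact: laguerre_fun_le0.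
  by move: (F0 u) (C 0) (C k) (e k u) (e 0 u) => ? ? ? ? ?; ring.
under eq_Rintegral do rewrite E.
have I1 := square_integrable_mul L2F0 (L2e j).
have I2 := integrableZl measurableT (- C 0) (square_integrable_mul (L2e 0) (L2e j)).
have I3 := integrableZl measurableT (- C k) (square_integrable_mul (L2e k) (L2e j)).
rewrite RintegralD//; last exact: (integrableD measurableT I1 I2).
rewrite RintegralD//.
rewrite !RintegralZl//; try exact: square_integrable_mul.
rewrite !(laguerre_orthonormal beta0 mE) -(laguerre_coefE mE j (proj1 hF)) -/(C j).
have {Cj0} : forall i, (0 < i < k)%N -> C i = 0 by exact: Cj0.
move: (C) => c ci0.
have [j0|j0] := posnP j.
  by rewrite j0 eqxx (gtn_eqF k1) mulr1 mulr0 addr0 subrr.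
rewrite (ltn_eqF j0) mulr0 addr0.
have [kj|kj] := eqVneq k j; first by rewrite kj mulr1 subrr.
by rewrite mulr0 addr0 ci0// j0 ltn_neqAle eq_sym kj.
Qed.

Let N := \int[m]_u (G u ^+ 2).

Let N0 : 0 <= N.
Proof. by apply: Rintegral_ge0 => u _; exact: sqr_ge0. Qed.

Lemma second_moment_law (H : R -> R) x : square_integrable m H ->
  (\int[P]_w (H (xi x w) ^+ 2)%:E <= (\int[m]_u (H u ^+ 2))%:E)%E.
Proof.
move=> [mH IH]; have mH2 : measurable_fun setT (fun u : measurableTypeR R => H u ^+ 2).
  exact: measurable_funX.
rewrite (integral_law (measurable_field_value x) (xi_law x) mH2).
by rewrite /Rintegral fineK//; exact: (integrable_fin_num measurableT IH).
Qed.

Lemma measurable_field_comp (H : R -> R) : square_integrable m H ->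
  measurable_fun setT (fun z : 'rV[R]_d * Omega => H (xi z.1 z.2)).
Proof. by move=> [mH _]; exact: (measurableT_comp mH (gcf_measurable hxi)). Qed.

(** The factor 2 is the price of the diagonal, where AM-GM with weight 1 gives N + N; off the
    diagonal the Laguerre bound has constant N. *)
Lemma remainder_covariance x y :
  `|\int[P]_w (G (xi x w) * G (xi y w))| <= 2 * N * dist_kernel gamma k x y.
Proof.
have L2G := square_integrable_remainder; have [mG _] := L2G.
have [<-|xy] := eqVneq x y.
  have L2 : square_integrable P (fun w => G (xi x w)).
    apply: (@square_integrable_field _ _ _ _ _ P (fun x w => G (xi x w)) N).
      exact: measurable_field_comp.
    by move=> z; exact: second_moment_law.
  have := Rintegral_mul_le ltr01 L2 L2.
  rewrite dist_kernel_diag mulr1 invr1 !mul1r => /le_trans; apply.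
  rewrite mulr_natl mulr2n lerD//.
    rewrite -lee_fin; apply: le_trans (second_moment_law x L2G).
    by rewrite /Rintegral fineK//; have [_ I] := L2; exact: (integrable_fin_num measurableT I).
  rewrite -lee_fin; apply: le_trans (second_moment_law x L2G).
  by rewrite /Rintegral fineK//; have [_ I] := L2; exact: (integrable_fin_num measurableT I).
have [p pE p2] := gcf_bivariate hxi xy.
pose Z w : measurableTypeR R * measurableTypeR R := (xi x w, xi y w).
have mZ : measurable_fun setT Z.
  by apply: measurable_fun_pair; exact: measurable_field_value.
have [m2 m2E] := law_exists P mZ.
have mGG : measurable_fun setT
    (fun z : measurableTypeR R * measurableTypeR R => G z.1 * G z.2).
  apply: measurable_funM.
    exact: (measurableT_comp mG measurable_fst).
  exact: (measurableT_comp mG measurable_snd).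
have r1 := field_correlation_lt1 hxi xy.
have := @bivariate_covariance_bound R beta m beta0 mE _ p m2 r1 pE _ G k L2G remainder_orthogonal.
rewrite (dist_kernelE hxi)// => H.
rewrite /Rintegral (integral_law mZ (fun A _ => m2E A) mGG).
apply: (le_trans (H (fun A mA => eq_trans (m2E A) (p2 A mA)))).
rewrite mulrC -/N ler_wpM2r ?exprn_ge0// ler_peMl// ler1n//.
Qed.

Variables (delta : R) (L : R -> R).
Hypothesis delta0 : 0 < delta.
Hypothesis hL : slowly_varying L.
Hypothesis hgamma : forall z : 'rV[R]_d, z != 0 ->
  gamma (enorm z) = L (enorm z) / enorm z `^ delta.
Hypothesis kdelta : k%:R * delta < d%:R.
Variable D : set 'rV[R]_d.
Hypothesis cD : compact D.

Let mD : measurable D. Proof. exact: compact_measurable_rV. Qed.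

Let finD : (lebesgue_rV d D < +oo)%E.
Proof.
have [B B0 HB] := compact_coord_bounded cD.
have sub : D `<=` eball 0 (Num.sqrt d%:R * (2 * B)).
  move=> y Dy; apply: enormB => i; last exact: HB.
  by rewrite mxE normr0 ltW.
have r0 : 0 <= Num.sqrt d%:R * (2 * B) by rewrite mulr_ge0 ?sqrtr_ge0// mulr_ge0// ltW.
apply: (@le_lt_trans _ _ (lebesgue_rV d (eball 0 (Num.sqrt d%:R * (2 * B))))).
  by apply: le_measure => //; apply/mem_set => //; exact: measurable_eball.
by apply: le_lt_trans (lebesgue_rV_eball _ r0) (ltry _).
Qed.

Let v := fine (lebesgue_rV d D).

Let v0 : 0 <= v. Proof. exact: fine_ge0. Qed.

Let volE t : 0 < t -> lebesgue_rV d (homothetic t D) = (t ^+ d * v)%:E.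
Proof.
by move=> t0; rewrite lebesgue_rV_homothetic// EFinM /v fineK// ge0_fin_numE.
Qed.

Let volfin t : 0 < t -> (lebesgue_rV d (homothetic t D) < +oo)%E.
Proof. by move=> t0; rewrite volE// ltry. Qed.

Let Y t := region_integral (lebesgue_rV d) (homothetic t D) (fun x w => G (xi x w)).

Lemma remainder_integral_small (eps : R) : 0 < eps ->
  \forall t \near +oo, \int[P]_w (Y t w ^+ 2) <= eps * (gamma t ^+ k * (t ^+ d) ^+ 2).
Proof.
move=> eps0; have L2G := square_integrable_remainder.
have [B B0 HB] := compact_coord_bounded cD.
(* A bound on the diameter of D, so that D(t) lies in the ball of radius r t around any of its
   points. *)
pose r := Num.sqrt d%:R * (2 * B).
have r0 : 0 < r by rewrite mulr_gt0 ?sqrtr_gt0 ?ltr0n// mulr_gt0.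
(* Compensates the factor 2 N from the covariances and the volume v; the added 1 keeps the
   denominator positive when N or v is 0. *)
pose eps1 := eps / (2 * N * v + 1).
have Nv : 0 <= 2 * N * v by rewrite mulr_ge0// mulr_ge0.
have eps10 : 0 < eps1 by rewrite divr_gt0// ltr_wpDl.
have small := dist_kernel_small d_gt0 hxi delta0 hL hgamma kdelta r0 eps10.
near=> t.
have t0 : 0 < t by near: t; exact: nbhs_pinfty_gt.
have gt0 : 0 < gamma t by near: t; exact: (correlation_gt0 d_gt0 hL hgamma).
have smallt : forall x : 'rV[R]_d,
    (\int[lebesgue_rV d]_(y in eball x (r * t)%R) (dist_kernel gamma k x y)%:E <=
     (eps1 * (gamma t ^+ k * t ^+ d))%:E)%E by near: t.
have mA := measurable_homothetic t0 mD.
have V2 x : (\int[P]_w (G (xi x w) ^+ 2)%:E <= N%:E)%E by exact: second_moment_law.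
have gd0 : 0 <= gamma t ^+ k * t ^+ d by rewrite mulr_ge0 ?exprn_ge0 ?(ltW t0) ?(ltW gt0).
have H := region_integral_variance mA (volfin t0) (measurable_field_comp L2G) V2
  (K := fun x y => 2 * N * dist_kernel gamma k x y)
  (kappa := 2 * N * (eps1 * (gamma t ^+ k * t ^+ d))).
apply: (le_trans (H _ _ _)).
- move=> x; apply: measurable_funM => //; exact: (measurable_dist_kernel d_gt0 hxi).
- by move=> x y _ _; exact: remainder_covariance.
- move=> x [x' Dx' <-].
  have mK : measurable_fun setT (fun y => (dist_kernel gamma k (t *: x') y)%:E).
    by apply/measurable_EFinP; exact: (measurable_dist_kernel d_gt0 hxi).
  under eq_integral do rewrite EFinM.
  rewrite ge0_integralZl_EFin//; last 3 first.
  + by move=> y _; rewrite lee_fin dist_kernel_ge0.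
  + exact: measurable_funTS.
  + by rewrite mulr_ge0.
  rewrite [leRHS]EFinM; apply: lee_wpmul2l; first by rewrite lee_fin mulr_ge0.
  apply: (@le_trans _ _ (\int[lebesgue_rV d]_(y in eball (t *: x') (r * t)%R)
    (dist_kernel gamma k (t *: x') y)%:E)%E); last exact: smallt.
  apply: ge0_subset_integral => //.
  + exact: measurable_eball.
  + exact: measurable_funTS.
  + by move=> y _; rewrite lee_fin dist_kernel_ge0.
  + move=> y [y' Dy' <-]; rewrite /eball/=.
    have -> : r * t = Num.sqrt d%:R * (2 * (t * B)) by rewrite /r; ring.
    by apply: enormB => i; rewrite mxE normrM gtr0_norm// ler_pM2l// HB.
- rewrite volE//=.
  have -> : 2 * N * (eps1 * (gamma t ^+ k * t ^+ d)) * (t ^+ d * v) =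
      (2 * N * v * eps1) * (gamma t ^+ k * (t ^+ d) ^+ 2) by ring.
  apply: ler_wpM2r; first by rewrite mulr_ge0 ?sqr_ge0// exprn_ge0// ltW.
  rewrite /eps1 mulrCA ler_piMr ?(ltW eps0)// ler_pdivrMr ?mul1r ?lerDl//.
  by rewrite ltr_wpDl.
Unshelve. all: by end_near. Qed.

Let norm := normalization delta L D k.

(** Since gamma t = L t / t^delta, the product L(t)^k t^(2d - k delta) is gamma(t)^k t^(2d), the
    order that bounds the second moment of [Y t]. Powers of [L t] combine where [L t] is positive,
    hence the restriction to large t. *)
Lemma normalization_sqr : \forall t \near +oo,
  norm t ^+ 2 = a_const k delta D ^+ 2 * (gamma t ^+ k * (t ^+ d) ^+ 2).
Proof.
have [_ L0 _] := hL; near=> t.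
have t0 : 0 < t by near: t; exact: nbhs_pinfty_gt.
have Lt0 : 0 < L t by near: t.
rewrite (correlation_powerE d_gt0 hgamma)// /norm /normalization !exprMn -mulrA; congr (_ * _).
have -> : (L t `^ (k%:R / 2)) ^+ 2 = L t ^+ k.
  by rewrite -powR_mulrn ?powR_ge0// -powRrM divfK// powR_mulrn// ltW.
have -> : (t `^ (d%:R - k%:R * delta / 2)) ^+ 2 = (t `^ delta) ^- k * (t ^+ d) ^+ 2.
  rewrite -powR_mulrn ?powR_ge0// -powRrM -exprM.
  rewrite -[t ^+ (d * 2)]powR_mulrn ?(ltW t0)// -powR_mulrn ?powR_ge0// -powRrM -powRN.
  rewrite -powRD ?(gt_eqF t0) ?implybT//; congr (_ `^ _).
  by rewrite natrM; field.
by rewrite exprVn mulrA.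
Unshelve. all: by end_near. Qed.

Let I (H : R -> R) t := region_integral (lebesgue_rV d) (homothetic t D) (fun x w => H (xi x w)).

Let field_integralE (H : R -> R) t w : field_integral xi H (homothetic t D) w =
  I (H \_ `]0%R, +oo[) t w.
Proof. by []. Qed.

Let patch_e j : laguerre_e beta j \_ `]0%R, +oo[ = e j.
Proof.
apply/funext => u; rewrite pos_patchE; case: ifPn => u0.
  by rewrite -laguerre_funE.
by rewrite [e j u]laguerre_fun_le0// leNgt.
Qed.

Let measurable_I (H : R -> R) t : 0 < t -> square_integrable m H -> measurable_fun setT (I H t).
Proof.
move=> t0 L2H; apply: measurable_region_integral (measurable_field_comp L2H) _ => //.
- exact: measurable_homothetic.
- exact: volfin.
- by move=> x; exact: second_moment_law.
Qed.

Let S1 t := S_L beta delta L D xi F k t.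
Let S2 t := S_L_leading beta delta L D xi F k t.

Lemma measurable_S_L t : 0 < t -> measurable_fun setT (S1 t).
Proof.
move=> t0; apply: measurable_funM => //; apply: measurable_funB => //.
exact: (measurable_I t0 L2F0).
Qed.

Lemma measurable_S_L_leading t : 0 < t -> measurable_fun setT (S2 t).
Proof.
move=> t0; apply: measurable_funM => //.
have := measurable_I t0 (L2e k); rewrite -patch_e.
by apply: eq_measurable_fun => w _; rewrite field_integralE.
Qed.

(** Splitting the integral of G into its three parts is legitimate on trajectories along which each
    part is integrable over D(t), and these have probability 1. *)
Lemma S_L_remainder t : 0 < t ->
  {ae P, forall w, S1 t w - S2 t w = (norm t)^-1 * Y t w}.
Proof.
move=> t0; have mA := measurable_homothetic t0 mD.
have ae H : square_integrable m H ->
    {ae P, forall w, (lebesgue_rV d).-integrable (homothetic t D) (fun x => (H (xi x w))%:E)}.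
  move=> L2H; apply: ae_integrable_field (measurable_field_comp L2H) _ => //.
    exact: volfin.
  by move=> x; exact: second_moment_law.
apply: filterS2 (ae _ L2F0) (ae _ (L2e k)) => w J1 J2.
rewrite /S1 /S2 /S_L /S_L_leading !field_integralE patch_e -/norm.
have J0 : (lebesgue_rV d).-integrable (homothetic t D) (EFin \o (fun=> - C 0)).
  apply/integrableP; split; first exact: measurable_cst.
  by rewrite /= integral_cst//; apply: lte_mul_pinfty => //; exact: volfin.
have J2' := integrableZl mA (- C k) J2.
have -> : Y t w = I F0 t w + \int[lebesgue_rV d]_(x in homothetic t D) (- C 0) + - C k * I (e k) t w.
  rewrite /I /region_integral -RintegralZl// -RintegralD//.
  rewrite -RintegralD//; last exact: (integrableD mA J1 J0).
  apply: eq_Rintegral => x _; rewrite /G /laguerre_remainder mulNr//.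
have -> : \int[lebesgue_rV d]_(x in homothetic t D) (- C 0) = - C 0 * (t ^+ d * v).
  by rewrite Rintegral_cst//; congr (_ * _); have := congr1 fine (volE t0).
rewrite -/v -/(C 0) -/(C k) -/F0.
by move: (I F0 t w) (I (e k) t w) (norm t)^-1 (C 0) (C k) v (t ^+ d) => ? ? ? ? ? ? ?; ring.
Qed.

Lemma S_L_difference_small (eps : R) : 0 < eps ->
  \forall t \near +oo, (\int[P]_w ((S1 t w - S2 t w) ^+ 2)%:E <= eps%:E)%E.
Proof.
move=> eps0; have L2G := square_integrable_remainder.
(* With a zero constant the normalization is 0, as is its inverse, and both functionals vanish
   identically. *)
have [a0|a0] := eqVneq (a_const k delta D) 0.
  near=> t; rewrite integral0_eq ?lee_fin ?(ltW eps0)// => w _.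
  rewrite /S1 /S2 /S_L /S_L_leading /normalization a0 !mul0r invr0 !(mul0r, mulr0).
  by rewrite subrr expr0n.
have a20 : 0 < a_const k delta D ^+ 2 by rewrite exprn_even_gt0.
have small := remainder_integral_small (mulr_gt0 eps0 a20).
have nsq := normalization_sqr.
near=> t.
have t0 : 0 < t by near: t; exact: nbhs_pinfty_gt.
have gt0 : 0 < gamma t by near: t; exact: (correlation_gt0 d_gt0 hL hgamma).
have mA := measurable_homothetic t0 mD.
have L2Y : square_integrable P (Y t).
  apply: square_integrable_region_integral (measurable_field_comp L2G) _ => //.
    exact: volfin.
  by move=> x; exact: second_moment_law.
have [mY IY] := L2Y.
have nE : norm t ^+ 2 = a_const k delta D ^+ 2 * (gamma t ^+ k * (t ^+ d) ^+ 2) by near: t.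
have n0 : 0 < norm t ^+ 2 by rewrite nE mulr_gt0// mulr_gt0 ?exprn_gt0.
have E : (\int[P]_w ((S1 t w - S2 t w) ^+ 2)%:E =
    \int[P]_w (norm t ^- 2 * Y t w ^+ 2)%:E)%E.
  apply: ae_eq_integral => //.
  - apply/measurable_EFinP; apply: measurable_funX; apply: measurable_funB.
      exact: measurable_S_L.
    exact: measurable_S_L_leading.
  - apply/measurable_EFinP; apply: measurable_funM => //; exact: measurable_funX.
  - by apply: filterS (S_L_remainder t0) => w -> _; rewrite exprMn exprVn.
rewrite E; under eq_integral do rewrite EFinM.
rewrite integralZl//.
have -> : (\int[P]_w (Y t w ^+ 2)%:E = (\int[P]_w (Y t w ^+ 2))%:E)%E.
  by rewrite /Rintegral fineK//; exact: (integrable_fin_num measurableT IY).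
rewrite -EFinM lee_fin ler_pdivrMl// nE [leRHS]mulrC [leRHS]mulrA.
by near: t.
Unshelve. all: by end_near. Qed.

Lemma S_L_reduction (mu : probability (measurableTypeR R) R) :
  cvg_in_law P S1 mu -> cvg_in_law P S2 mu.
Proof.
apply: slutsky; last by move=> eps; exact: S_L_difference_small.
near=> t; apply: measurable_S_L_leading; near: t; exact: nbhs_pinfty_gt.
Unshelve. all: by end_near. Qed.

End laguerre_reduction.

Theorem theorem1 (R : realType) (d : nat) (hd : (1 <= d)%N)
  (dO : measure_display) (Omega : measurableType dO) (P : probability Omega R)
  (beta : R) (hbeta : 0 < beta) (gamma : R -> R)
  (xi : 'rV[R]_d -> Omega -> R)
  (hxi : gamma_correlated_field P beta gamma xi)
  (delta : R) (hdelta : 0 < delta < d%:R)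
  (L : R -> R) (hL : slowly_varying L)
  (hgamma : forall z : 'rV[R]_d, z != 0 ->
     gamma (enorm z) = L (enorm z) / enorm z `^ delta)
  (D : set 'rV[R]_d) (hD : regular_compact_domain D)
  (F : R -> R) (hF : L2_gamma beta F)
  (k : nat) (hk : laguerre_rank beta F k)
  (hkdelta : 0 < delta < d%:R / k%:R)
  (mu : probability (measurableTypeR R) R) :
  cvg_in_law P (S_L beta delta L D xi F k) mu ->
  cvg_in_law P (S_L_leading beta delta L D xi F k) mu.
Proof.
have [delta0 dk] := andP hkdelta; have [k1 _ _] := hk; have [cD _ _ _ _] := hD.
have mX : measurable_fun setT (xi 0 : Omega -> measurableTypeR R).
  exact: measurable_field_value hxi 0.
(* The law at the origin serves at every point, since all marginals have the same density. *)
have [m mE] := law_exists P mX.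
have law x (A : set (measurableTypeR R)) : measurable A -> m A = P (xi x @^-1` A).
  by move=> mA; rewrite mE !(gcf_marginal hxi).
have kdelta : k%:R * delta < d%:R.
  by rewrite mulrC -ltr_pdivlMr// ltr0n.
exact: (S_L_reduction hd hbeta hxi hF hk law delta0 hL hgamma kdelta cD).
Qed.
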